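(* Let $r\ge 3$ be a fixed integer and let $L=\{\ell_1,\dots,\ell_s\}\subset[0,r-1]$ be a fixed subset of size $s\notin\{1,r\}$ with $\ell_1<\ell_2<\dots<\ell_s$. Then the following statements hold. (1) If $\ell_1,\ell_2,\dots,\ell_s,r$ do not form an arithmetic progression, then $\Psi_r(n,L)=o(n^s)$ as $n\to\infty$. If further $r-\ell_s=\ell_s-\ell_{s-1}$, then $\Psi_r(n,L)=O(n^{s-1})$. (2) If $\ell_1,\ell_2,\dots,\ell_s,r$ form an arithmetic progression and $d:=r-\ell_s=\dots=\ell_2-\ell_1=(r-\ell_1)/s$ is the common difference, then there exists $n_0=n_0(r,L)$ such that for any $n>n_0$ we have $$\Psi_r(n,L)=N\bigl(K_s,\,T(\lfloor (n-\ell_1)/d\rfloor,\,s)\bigr)=(1+o(1))\left(\frac{n-\ell_1}{r-\ell_1}\right)^{s},$$ and the extremal graph is unique up to isomorphism, namely the graph $G_{n,r,L}$.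
   Context: For integers $a<b$, $[a,b]=\{a,a+1,\dots,b\}$. $N(K_r,G)$ denotes the number of copies of the complete graph $K_r$ on $r$ vertices in the graph $G$. The associated $r$-graph of a graph $G$ is $\mathcal{H}_G^r=\{S\in\binom{V(G)}{r}: G[S]\cong K_r\}$, where $G[S]$ is the induced subgraph. A family of sets is $L$-intersecting if the intersection size of any two distinct members belongs to $L$. A graph $G$ is $(K_r,L)$-intersecting if $\mathcal{H}_G^r$ is $L$-intersecting. Define $$\Psi_r(n,L)=\max\{N(K_r,G): G\text{ is an }n\text{-vertex }(K_r,L)\text{-intersecting graph}\}.$$ The Turán graph $T(n,t)$ is the balanced complete $t$-partite graph on $n$ vertices. $G+H$ denotes the graph obtained from the vertex-disjoint union of $G$ and $H$ by adding all edges between $V(G)$ and $V(H)$. In the setting of part (2), write $n-\ell_1=md+\lambda$ with $\lambda\in[0,d-1]$, so $m=\lfloor (n-\ell_1)/d\rfloor$, and let $\hat T(m,s,d)$ be the blow-up of $T(m,s)$ obtained by replacing each vertex by a clique $K_d$ (cliques replacing adjacent vertices are completely joined, and there are no edges between cliques replacing non-adjacent vertices). Then $G_{n,r,L}:=K_{\ell_1}+\hat T(m,s,d)$, which has $\ell_1+md=n-\lambda$ vertices.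
   Formalization: Uniqueness of the extremal graph is stated up to vertices and edges in no copy of K_r: G is extremal iff the union of its copies of K_r is isomorphic to G_{n,r,L}; literally it fails, as G_{n,r,L} has n-λ vertices and for d≥3 edges can be added without creating a K_r. *)

(* Defs.v *)
From HB Require Import structures.
From mathcomp Require Import all_boot.

Set Implicit Arguments.
Unset Strict Implicit.
Unset Printing Implicit Defensive.

(* Finite simple graphs on the vertex set T, given by their set of edges. An
   n-vertex graph is a graph on 'I_n. *)
Record sgraph (T : finType) := SGraph {
  edges :> {set {set T}};
  edges_card2 : [forall (A | A \in edges), #|A| == 2] }.

HB.instance Definition _ (T : finType) := [isSub for @edges T].
HB.instance Definition _ (T : finType) := [Finite of sgraph T by <:].

Definition adj (T : finType) (G : sgraph T) (x y : T) : bool :=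
  [set x; y] \in edges G.

Definition rel_edges (T : finType) (e : rel T) : {set {set T}} :=
  [set [set p.1; p.2] | p : T * T & (p.1 != p.2) && e p.1 p.2].

Lemma rel_edges_card2 (T : finType) (e : rel T) :
  [forall (A | A \in rel_edges e), #|A| == 2].
Proof.
apply/forall_inP => A /imsetP[[x y]]; rewrite inE /= => /andP[xy _] ->.
by rewrite cards2 xy.
Qed.

Definition graph_of_rel (T : finType) (e : rel T) : sgraph T :=
  SGraph (rel_edges_card2 e).

Lemma adj_graph_of_rel (T : finType) (e : rel T) (x y : T) :
  adj (graph_of_rel e) x y = (x != y) && (e x y || e y x).
Proof.
apply/imsetP/andP => [[[a b]]|[xy]].
  rewrite inE /= => /andP[ab eab] /setP E.
  have := E b; have := E a; have := E y; have := E x.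
  rewrite !inE !eqxx !orbT /= => /esym/orP[]/eqP-> /esym/orP[]/eqP->.
  - by rewrite eq_sym (negbTE ab).
  - by move=> _ _; rewrite ab eab.
  - by move=> _ _; rewrite eq_sym ab eab orbT.
  - by rewrite (negbTE ab).
case/orP => exy; first by exists (x, y); rewrite ?inE /= ?xy.
by exists (y, x); rewrite ?inE /= 1?eq_sym ?xy // setUC.
Qed.

Definition graph_iso (T U : finType) (G : sgraph T) (H : sgraph U) : Prop :=
  exists2 f : T -> U, bijective f & forall x y, adj H (f x) (f y) = adj G x y.

(* The associated r-graph: the vertex sets of the copies of K_r in G. *)
Definition cliques (r : nat) (T : finType) (G : sgraph T) : {set {set T}} :=
  [set S : {set T} | (#|S| == r) &&
     [forall x in S, forall y in S, (x != y) ==> adj G x y]].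

(* N(K_r, G) *)
Definition nb_cliques (r : nat) (T : finType) (G : sgraph T) : nat :=
  #|cliques r G|.

Definition set_intersecting (L : seq nat) (T : finType) (F : {set {set T}}) :
    bool :=
  [forall A in F, forall B in F, (A != B) ==> (#|A :&: B| \in L)].

Definition clique_intersecting (r : nat) (L : seq nat) (T : finType)
    (G : sgraph T) : bool :=
  set_intersecting L (cliques r G).

Definition Psi (r n : nat) (L : seq nat) : nat :=
  \max_(G : sgraph 'I_n | clique_intersecting r L G) nb_cliques r G.

Definition extremal (r n : nat) (L : seq nat) (G : sgraph 'I_n) : Prop :=
  clique_intersecting r L G /\ nb_cliques r G = Psi r n L.

Definition complete_graph (n : nat) : sgraph 'I_n :=
  graph_of_rel (fun _ _ : 'I_n => true).

(* The parts are the residue classes modulo t. *)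
Definition turan_graph (n t : nat) : sgraph 'I_n :=
  graph_of_rel (fun i j : 'I_n => i %% t != j %% t).

Definition graph_join (T U : finType) (G : sgraph T) (H : sgraph U) :
    sgraph (T + U)%type :=
  graph_of_rel (fun a b : T + U =>
    match a, b with
    | inl x, inl y => adj G x y
    | inr x, inr y => adj H x y
    | _, _ => true
    end).

(* Each vertex x becomes the clique {x} * 'I_d. *)
Definition clique_blowup (T : finType) (G : sgraph T) (d : nat) :
    sgraph (T * 'I_d)%type :=
  graph_of_rel (fun a b : T * 'I_d => (a.1 == b.1) || adj G a.1 b.1).

(* K_{l1} + \hat T(m, s, d), with m = floor ((n - l1) / d). *)
Definition extremal_graph (n l1 s d : nat) :
    sgraph ('I_l1 + 'I_((n - l1) %/ d) * 'I_d)%type :=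
  graph_join (complete_graph l1) (clique_blowup (turan_graph ((n - l1) %/ d) s) d).

(* The subgraph of G formed by the vertices and the edges that lie in some copy
   of K_r. Being extremal puts no constraint on the remaining ones: leftover
   vertices, and edges in no copy of K_r, can be added or deleted freely. *)
Definition clique_part (r : nat) (T : finType) (G : sgraph T) :
    sgraph {x : T | x \in cover (cliques r G)} :=
  graph_of_rel (fun x y : {x : T | x \in cover (cliques r G)} =>
    [exists S in cliques r G, (val x \in S) && (val y \in S)]).

Definition arith_prog (d : nat) (a : seq nat) : bool :=
  sorted (fun x y => y == x + d) a.

(* Main.v *)
(* Call X a flat of an r-uniform family F if every set B of size at most r admits a
   member A of F with X \subset A and A :&: B \subset X. If F is L-intersecting, two flats meet
   in a set whose size is r or belongs to L. A family with no flat of size l1 has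
   O(n^(s-1)) members; otherwise such a flat C is contained in every member.
   Applied to the members through a given set, this shows that up to O(n^(s-1))
   exceptions the flats of sizes l2, l3, l4 inside a member behave like the flats
   of rank 1, 2, 3 of a matroid.

   Not an arithmetic progression. Passing to the members through a further vertex
   removes l1 from L, so one may assume that l2, ..., ls, r is an arithmetic
   progression of difference d <> l2 - l1. If s >= 3, a count in a flat of rank 3
   shows that there are only O(n^(s-1)) members. If s = 2, almost every member is
   the union of C and of k >= 3 blocks of size l2 - l1, any two of which determine
   it, and the K_k removal lemma gives o(n^2).

   Arithmetic progression. The flats of size l2 are disjoint outside C, and the
   graph of those whose union is a clique contains no K_(s+1); its copies of K_s
   correspond to the r-cliques covered by these flats. Zykov's theorem bounds
   their number, and a vertex outside all these flats lies in only O(n^(s-2))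
   cliques, fewer than what an additional flat would create. *)
Require Import Defs.
From mathcomp Require Import all_boot all_order all_algebra.
From mathcomp Require Import zify ring lra.

Set Implicit Arguments.
Unset Strict Implicit.
Unset Printing Implicit Defensive.

(** * Flats of an L-intersecting family *)

(** The exceptions are cheap because of an exponent count. Fix i points whose star has lost the i
    smallest sizes. If they lie in no flat of the next size, their star has only O(n^(s-i-1))
    members, and there are at most n^i such choices, so each of the ranks i = 1, 2, 3 costs
    O(n^(s-1)). The bound o(n^s) comes entirely from the base case s = 2 of the induction. For r = 3
    and L = {0, 1} this case is the Ruzsa-Szemeredi problem on edge-disjoint triangles, where no
    power of n can be saved, so a removal lemma is natural there. The condition r - ls = ls - l(s-1)
    avoids this case: for s = 2 it says that the sizes form an arithmetic progression. For an
    arithmetic progression, s <> r means that d > 1 or l1 > 0. If d = 1 and l1 = 0, then L =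
    [0, r-1], every graph is allowed, and the graph of flats of size l2 may well contain K_(s+1). *)

Ltac nat_lia :=
  repeat match goal with
  | H : is_true (leq _ _) |- _ => move: H
  | H : is_true (negb (@eq_op Datatypes_nat__canonical__eqtype_Equality _ _)) |- _ =>
    move: H
  | H : @eq nat _ _ |- _ => move: H
  end; clear; lia.

Lemma card_le_covered (I U : finType) (V : {set U}) (P : {pred I}) (f : I -> {set U})
  m :
  {in V, forall x, exists2 i, i \in P & x \in f i} ->
  (forall i, i \in P -> #|f i| <= m) -> #|V| <= #|P| * m.
Proof.
move=> cov le_m; apply: (@leq_trans (\sum_(i in P) #|f i|)); last first.
  by rewrite -sum_nat_const; apply: leq_sum.
apply: (@leq_trans #|\bigcup_(i in P) f i|); last first.
  elim/big_rec2: _ => [|i n W _ Hn]; first by rewrite cards0.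
  by rewrite (leq_trans (leq_card_setU _ _)) ?leq_add2l.
apply: subset_leq_card; apply/subsetP => x /cov[i Pi xi].
by apply/bigcupP; exists i.
Qed.

Section Flats.
Variable (T : finType).
Implicit Types (F : {set {set T}}) (A B X Y Z : {set T}).

Definition uniform r F := [forall A in F, #|A| == r].

Definition star F Z : {set {set T}} := [set A in F | Z \subset A].

(* The members of an r-uniform F are flats, and so are the kernels of the
   sunflowers in F with more than r petals. Members of F through two given flats
   X and Y can be chosen to meet exactly in X :&: Y, see flat_cap. *)
Definition flat r F X :=
  [forall B : {set T}, (#|B| <= r) ==>
     [exists A in F, (X \subset A) && (A :&: B \subset X)]].

Lemma uniformP r F : reflect {in F, forall A, #|A| = r} (uniform r F).
Proof.
apply: (iffP forall_inP) => H A AF; first exact/eqP/H.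
by apply/eqP/H.
Qed.

Lemma intersectingP L F :
  reflect {in F &, forall A B, A != B -> #|A :&: B| \in L}
    (set_intersecting L F).
Proof.
apply: (iffP forall_inP) => [H A B AF BF|H A AF].
  by have /forall_inP/(_ _ BF)/implyP := H A AF.
by apply/forall_inP => B BF; apply/implyP; apply: H.
Qed.

Lemma flatP r F X :
  reflect (forall B, #|B| <= r ->
             exists2 A, A \in F & (X \subset A) && (A :&: B \subset X))
    (flat r F X).
Proof.
apply: (iffP forallP) => [H B Br|H B].
  by have /implyP/(_ Br)/exists_inP := H B.
by apply/implyP => Br; apply/exists_inP/H.
Qed.

Lemma starS F Z : star F Z \subset F.
Proof. by apply/subsetP => A; rewrite inE => /andP[]. Qed.

Lemma mem_star F Z A : (A \in star F Z) = (A \in F) && (Z \subset A).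
Proof. by rewrite inE. Qed.

Lemma uniformS r F F' : F' \subset F -> uniform r F -> uniform r F'.
Proof. by move=> /subsetP s /uniformP u; apply/uniformP => A /s/u. Qed.

Lemma intersectingS L F F' :
  F' \subset F -> set_intersecting L F -> set_intersecting L F'.
Proof.
by move=> /subsetP s /intersectingP u; apply/intersectingP => A B /s AF /s /(u _ _ AF).
Qed.

Lemma star_star F Y Z : star (star F Y) Z = star F (Y :|: Z).
Proof. by apply/setP => A; rewrite !inE subUset andbA. Qed.

Lemma flatS r F F' X : F' \subset F -> flat r F' X -> flat r F X.
Proof.
move=> /subsetP s /flatP H; apply/flatP => B /H[A /s AF AX]; by exists A.
Qed.

Lemma mem_flat r F A : A \in F -> flat r F A.
Proof. by move=> AF; apply/flatP => B _; exists A; rewrite ?subxx ?subsetIl. Qed.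

Lemma flat_star r F X Z : #|Z| <= r -> flat r (star F Z) X -> Z \subset X.
Proof.
move=> Zr /flatP/(_ Z Zr)[A]; rewrite inE => /andP[_ ZA] /andP[_].
by rewrite (setIidPr ZA).
Qed.

Lemma flat_sub r F X : flat r F X -> exists2 A, A \in F & X \subset A.
Proof.
move=> /flatP/(_ set0); rewrite cards0 => /(_ isT)[A AF /andP[]]; by exists A.
Qed.

Lemma flat_card r F X : uniform r F -> flat r F X -> #|X| <= r.
Proof.
move=> /uniformP u /flat_sub[A AF XA]; by rewrite -(u _ AF) subset_leq_card.
Qed.

Lemma flat_cap r L F X Y : uniform r F -> set_intersecting L F ->
  flat r F X -> flat r F Y -> #|X :&: Y| \in r :: L.
Proof.
move=> u /intersectingP I fX fY.
have [B BF /andP[YB BX]] := flatP _ _ _ fY X (flat_card u fX).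
have Br : #|B| <= r by rewrite (uniformP _ _ u).
have [A AF /andP[XA AB]] := flatP _ _ _ fX B Br.
have <- : A :&: B = X :&: Y.
  apply/eqP; rewrite eqEsubset andbC (setISS XA YB) /=.
  apply/subsetP => x xAB; have xX := subsetP AB _ xAB; rewrite inE xX /=.
  by apply: (subsetP BX); move: xAB; rewrite !inE xX => /andP[_ ->].
have [<-|AB'] := eqVneq A B; first by rewrite setIid (uniformP _ _ u) ?mem_head.
by rewrite inE I ?orbT.
Qed.

(** The petals are disjoint, so a set B of at most r elements misses one of them. Otherwise [f]
    would pick distinct points of B in more than r petals. *)
Lemma sunflower_flat r F (S : {set {set T}}) X : S \subset F -> r < #|S| ->
  {in S, forall A, X \subset A} -> {in S &, forall A B, A != B -> A :&: B = X} ->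
  flat r F X.
Proof.
move=> SF rS XS SX; apply/flatP => B Br.
have [/existsP[A /andP[AS AB]]|/existsPn N] :=
    boolP [exists A, (A \in S) && (A :&: B \subset X)].
  by exists A; rewrite ?(subsetP SF) ?XS.
have [f fP] : exists f : {set T} -> T, {in S, forall A, f A \in (A :&: B) :\: X}.
  have [S0|[A0 A0S]] := set_0Vmem S; first by rewrite S0 cards0 in rS.
  have := N A0; rewrite A0S /= => /subsetPn[x0 _ _].
  exists (fun A => odflt x0 [pick x in (A :&: B) :\: X]) => A AS.
  case: pickP => //= H; have := N A; rewrite AS /= => /subsetPn[x xAB xX].
  by have := H x; rewrite /= inE xX xAB.
suff : #|f @: S| <= #|B|.
  rewrite card_in_imset => [|A A' AS A'S ff]; first by move/leq_trans/(_ Br);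
    rewrite leqNgt rS.
  apply/eqP; apply: contraTT (fP _ AS) => AA'.
  have := fP _ A'S; rewrite -ff -(SX _ _ AS A'S AA') !inE => /andP[_ /andP[-> ->]].
  by case: (f A \in A).
apply: subset_leq_card; apply/subsetP => _ /imsetP[A AS ->].
by have := fP _ AS; rewrite !inE => /and3P[_ _].
Qed.

Lemma star_intersecting l L F Y : set_intersecting (l :: L) F -> l < #|Y| ->
  set_intersecting L (star F Y).
Proof.
move=> /intersectingP I lY; apply/intersectingP => A B.
rewrite !mem_star => /andP[AF YA] /andP[BF YB] AB.
have /subset_leq_card : Y \subset A :&: B by rewrite subsetI YA.
by have := I _ _ AF BF AB; rewrite inE => /orP[/eqP->|//]; rewrite leqNgt lY.
Qed.

(** The members other than A0 have at most 2^r traces on A0, so some trace X is shared by more than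
    r of them. Since X already has the size l of all pairwise intersections, these members form a
    sunflower with kernel X. *)
Lemma equi_flat r l F (M : {set {set T}}) : uniform r F -> M \subset F ->
  {in M &, forall A B, A != B -> #|A :&: B| = l} ->
  2 ^ r * r + 1 < #|M| -> exists2 X, flat r F X & #|X| = l.
Proof.
move=> u MF Ml Mr.
have [M0|[A0 A0M]] := set_0Vmem M; first by rewrite M0 cards0 in Mr.
have A0r : #|A0| = r by apply: (uniformP _ _ u); apply: (subsetP MF).
pose f X := [set B in M :\ A0 | B :&: A0 == X].
have [/existsP[X rX]|/existsPn N] := boolP [exists X, r < #|f X|]; last first.
  have : #|M :\ A0| <= #|powerset A0| * r.
    apply: (@card_le_covered _ _ _ _ f) => [B BM|X _]; last by rewrite leqNgt N.
    exists (B :&: A0); first by rewrite inE subsetIr.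
    by rewrite in_set BM eqxx.
  by rewrite card_powerset A0r; move: (cardsD1 A0 M); rewrite A0M; lia.
have [fX0|[B0]] := set_0Vmem (f X); first by rewrite fX0 cards0 in rX.
have Xl B : B \in f X -> (B \in M) /\ #|X| = l.
  rewrite !inE => /andP[/andP[BA0 BM] /eqP <-]; split=> //; exact: Ml.
have Xs B : B \in f X -> X \subset B.
  by rewrite inE => /andP[_ /eqP <-]; rewrite subsetIl.
move=> B0f; exists X; last by case/Xl: B0f.
apply: (@sunflower_flat r F (f X)) => // [|A B Af Bf AB].
  by apply: subset_trans MF; apply/subsetP => B /Xl[].
have [[AM Xl'] [BM _]] := (Xl _ Af, Xl _ Bf).
by apply/esym/eqP; rewrite eqEcard subsetI !Xs // (Ml _ _ AM BM AB) Xl' /=.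
Qed.

(** The member A is itself a flat, so the size of [X :&: A] is admissible, hence at least l. *)
Lemma flat_min_sub r l L F X A : path ltn l (rcons L r) -> uniform r F ->
  set_intersecting (l :: L) F -> flat r F X -> #|X| = l -> A \in F ->
  X \subset A.
Proof.
move=> /(order_path_min ltn_trans)/allP lr u I fX Xl AF.
suff : #|X| <= #|X :&: A|.
  by move=> H; apply/setIidPl/eqP; rewrite eqEcard subsetIl.
have := flat_cap u I fX (mem_flat r AF); rewrite Xl !inE.
case/or3P => [/eqP->|/eqP->|AL] //; apply: ltnW; apply: lr.
  by rewrite mem_rcons mem_head.
by rewrite mem_rcons inE AL orbT.
Qed.

Lemma card_le_link r l L F X m : path ltn l (rcons L r) -> uniform r F ->
  set_intersecting (l :: L) F -> flat r F X -> #|X| = l ->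
  (forall x, x \notin X -> #|star F (x |: X)| <= m) -> #|F| <= #|T| * m.
Proof.
move=> lLr u I fX Xl le_m; have XF := flat_min_sub lLr u I fX Xl.
have lr : l < r.
  by apply: (allP (order_path_min ltn_trans lLr)); rewrite mem_rcons mem_head.
apply: (@leq_trans (#|[predC X]| * m)); last by rewrite leq_mul2r max_card orbT.
apply: (@card_le_covered _ _ _ _ (fun x => star F (x |: X))) => [A AF|x /le_m //].
have /subsetPn[x xA xX] : ~~ (A \subset X).
  by apply: contraL lr => /subset_leq_card; rewrite Xl (uniformP _ _ u) // -leqNgt.
by exists x; rewrite // mem_star AF subUset sub1set xA XF.
Qed.

End Flats.

(* A maximal subfamily whose members meet pairwise in exactly l = min L elements
   either contains a sunflower with kernel of size l, or is bounded; in the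
   latter case all of F is covered by boundedly many stars of (l + 1)-sets. *)
Lemma flat_or_small r L : sorted ltn (rcons L r) -> exists C : nat,
  forall (T : finType) (F : {set {set T}}),
    uniform r F -> set_intersecting L F ->
    #|F| <= C * #|T| ^ size L /\
    ((exists2 X, flat r F X & #|X| = head r L) \/
     #|F| * #|T| <= C * #|T| ^ size L).
Proof.
elim: L => [|l L IH] /= lLr.
  exists 1 => T F u I.
  have F1 : #|F| <= 1.
    rewrite leqNgt; apply/negP => /card_gt1P[A [B [AF BF AB]]].
    by have := intersectingP _ _ I _ _ AF BF AB.
  split=> //; have [->|[A AF]] := set_0Vmem F; first by right; rewrite cards0.
  by left; exists A; [exact: mem_flat|exact: (uniformP _ _ u)].
have [C HC] := IH (path_sorted lLr).
have lr : l < r.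
  by apply: (allP (order_path_min ltn_trans lLr)); rewrite mem_rcons mem_head.
exists ((2 ^ r * r + 2) * 2 ^ r * C + C) => T F u I.
set C' := _ + C.
have star_small (Y : {set T}) : l < #|Y| -> #|star F Y| <= C * #|T| ^ size L.
  move=> lY; have [] // := HC T (star F Y); first exact: uniformS (starS _ _) u.
  exact: star_intersecting I lY.
have [[X fX Xl]|small] : (exists2 X, flat r F X & #|X| = l) \/
    #|F| <= C' * #|T| ^ size L.
  pose P (M : {set {set T}}) := (M \subset F) &&
    [forall A in M, forall B in M, (A != B) ==> (#|A :&: B| == l)].
  have [M /maxsetP[/andP[MF /forall_inP Ml] Mmax] _] : {M | maxset P M & set0 \subset
    M}.
    apply: maxset_exists; rewrite /P sub0set; apply/forall_inP => A.
    by rewrite inE.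
  have {}Ml : {in M &, forall A B, A != B -> #|A :&: B| = l}.
    move=> A B AM BM AB; apply/eqP.
    by have /forall_inP/(_ _ BM)/implyP := Ml _ AM; apply.
  have [Mbig|Msmall] := ltnP (2 ^ r * r + 1) #|M|; first by left;
    exact: equi_flat Ml Mbig.
  (* M has at most 2 ^ r * r + 1 members, each with at most 2 ^ r subsets Y larger than l, and the
     induction hypothesis bounds the star of each Y. *)
  right; apply: (@leq_trans (#|M| * (2 ^ r * (C * #|T| ^ size L)))); last first.
    rewrite !mulnA leq_mul2r; apply/orP; right; rewrite -!mulnA;
      apply: leq_trans (leq_addr _ _).
    rewrite -mulnA leq_mul2r; apply/orP; right; lia.
  apply: (@card_le_covered _ _ _ _ (fun A => [set B in F | l < #|A :&: B|])) => [B
    BF|A AM].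
    have [BM|BM] := boolP (B \in M).
      by exists B => //; rewrite inE BF setIid (uniformP _ _ u).
    have [/exists_inP[A AM AB]|/exists_inPn N] := boolP [exists A in M, l < #|A :&: B|].
      by exists A; rewrite // inE BF.
    case/negP: BM; rewrite -(Mmax (B |: M)) ?setU11 ?subsetU1 //.
    have MB A : A \in M -> A != B -> #|A :&: B| = l.
      move=> AM AB; have AF := subsetP MF _ AM.
      have := intersectingP _ _ I _ _ AF BF AB; rewrite inE => /orP[/eqP//|AL].
      case/negP: (N _ AM); apply: (allP (order_path_min ltn_trans lLr)).
      by rewrite mem_rcons inE AL orbT.
    rewrite /P subUset sub1set BF MF; apply/forall_inP => A1 A1M.
    apply/forall_inP => A2 A2M; apply/implyP => A12; apply/eqP.
    case/setU1P: A1M A12 => [->|A1M]; case/setU1P: A2M => [->|A2M] A12.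
    - by rewrite eqxx in A12.
    - by rewrite setIC MB // eq_sym.
    - by rewrite MB.
    - exact: Ml.
  have Ar : #|A| = r by apply: (uniformP _ _ u); apply: (subsetP MF).
  rewrite -{1}Ar -card_powerset.
  apply: (@leq_trans (#|[pred Y in powerset A | l < #|Y|]| * (C * #|T| ^ size L))).
    apply: (@card_le_covered _ _ _ _ (star F)) => [B|Y /andP[_]];
      last exact: star_small.
    rewrite inE => /andP[BF lAB]; exists (A :&: B);
      last by rewrite mem_star BF subsetIr.
    by rewrite !inE subsetIl.
  rewrite leq_mul2r; apply/orP; right; apply: subset_leq_card.
  by apply/subsetP => Y /andP[].
- split; last by left; exists X.
  have XF := flat_min_sub lLr u I fX Xl.
  rewrite expnS mulnCA; apply: (card_le_link lLr u I fX Xl) => x xX.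
  apply: leq_trans (star_small (x |: X) _) _; first by rewrite cardsU1 xX Xl.
  by rewrite leq_mul2r leq_addl orbT.
- split.
    have [F0|[A AF]] := set_0Vmem F; first by rewrite F0 cards0.
    have T0 : 0 < #|T|.
      apply: leq_trans (max_card A); rewrite (uniformP _ _ u) //;
        exact: leq_ltn_trans lr.
    by rewrite (leq_trans small) // leq_mul2l expnS leq_pmull ?orbT.
  by right; rewrite expnS mulnCA mulnC leq_mul2l small orbT.
Qed.

(** The substitute for a closure operator: [X :&: Y] has an admissible size and contains Z, so if no
    admissible size lies in [#|Z|, #|X|) it is all of X. *)
Lemma flat_subset (T : finType) r L (F : {set {set T}}) (X Y Z : {set T}) :
  uniform r F -> set_intersecting L F -> flat r F X -> flat r F Y ->
  Z \subset X -> Z \subset Y ->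
  (forall l : nat, l \in r :: L -> #|Z| <= l -> #|X| <= l) -> X \subset Y.
Proof.
move=> u I fX fY ZX ZY H; apply/setIidPl/eqP.
rewrite eqEcard subsetIl; apply: H; first exact: flat_cap u I fX fY.
by apply: subset_leq_card; rewrite subsetI ZX.
Qed.

(** The exceptional sets: the star of Y has only sizes in L left, yet no flat of the next size
    contains Y. For empty L the next size is r, the size of the members. *)
Definition unspanned (T : finType) r L (F : {set {set T}}) (Y : {set T}) :=
  set_intersecting L (star F Y) &&
  [forall X : {set T}, flat r F X && (#|X| == head r L) ==> ~~ (Y \subset X)].

Lemma unspannedPn (T : finType) r L (F : {set {set T}}) (Y : {set T}) :
  ~~ unspanned r L F Y -> set_intersecting L (star F Y) ->
  exists X : {set T}, [/\ flat r F X, #|X| = head r L & Y \subset X].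
Proof.
rewrite /unspanned => H I; move: H; rewrite I /= => /forallPn[X].
rewrite negb_imply negbK.
by move=> /andP[/andP[fX /eqP Xl] YX]; exists X.
Qed.

(** A flat of size [head r L] of the star of an unspanned set would be a flat of F containing that
    set. So only the second alternative of [flat_or_small] is left, and it saves a factor #|T|. *)
Lemma card_unspanned r L : sorted ltn (rcons L r) -> exists C : nat,
  forall (T I : finType) (F : {set {set T}}) (f : I -> {set T}) (P : {pred I}),
    uniform r F -> (forall i, i \in P -> unspanned r L F (f i)) ->
    #|[set A in F | [exists i in P, f i \subset A]]| * #|T|
      <= #|P| * (C * #|T| ^ size L).
Proof.
move=> sL; have [C HC] := flat_or_small sL; exists C => T I F f P u Pf.
have H i : i \in P -> #|star F (f i)| * #|T| <= C * #|T| ^ size L.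
  move=> /Pf /andP[Ii /forallP N]; have ui := uniformS (starS F (f i)) u.
  have [_ [[X fX Xl]|//]] := HC T _ ui Ii.
  have [A AF XA] := flat_sub fX.
  have fr : #|f i| <= r.
    by rewrite -(uniformP _ _ ui _ AF) subset_leq_card //; move: AF;
      rewrite mem_star => /andP[].
  by have := N X; rewrite (flatS (starS _ _) fX) Xl eqxx (flat_star fr fX).
have [T0|T0] := posnP #|T|; first by rewrite T0 muln0.
rewrite -leq_divRL //; apply: (@leq_trans (#|P| * (C * #|T| ^ size L %/ #|T|))).
  apply: (@card_le_covered _ _ _ P (fun i => star F (f i))) => [A|i iP].
    rewrite inE => /andP[AF /exists_inP[i iP fA]]; exists i => //.
    by rewrite mem_star AF.
  by rewrite leq_divRL ?H.
by rewrite leq_divRL // -mulnA leq_mul2l leq_trunc_div orbT.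
Qed.

(* X is the flat of size l2 through x, M1 and M2 are two flats of size l3 through
   X, and P = M1 :|: M2 is the flat of size l4. The flat M of size l3 through
   points y of M1 and z of M2 lies in P and meets M1 and M2 in flats of size at
   most l2, hence l3 <= 2 * l2 - l1; as M contains the two flats of size l2
   through y and z, there is equality. *)
Lemma design_rank3 (T : finType) r l1 l2 l3 L (F : {set {set T}}) (C A : {set T}) :
  sorted ltn (rcons [:: l1, l2, l3 & L] r) ->
  head r L - l3 = l3 - l2 -> l3 - l2 != l2 - l1 ->
  uniform r F -> set_intersecting [:: l1, l2, l3 & L] F ->
  flat r F C -> #|C| = l1 -> A \in F ->
  {in A, forall x, ~~ unspanned r [:: l2, l3 & L] F [set x]} ->
  {in A &, forall x y, ~~ unspanned r [:: l3 & L] F [set x; y]} ->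
  {in A & &, forall x y z, ~~ unspanned r L F [set x; y; z]} ->
  False.
Proof.
move=> sL d3 d2 u I fC Cl AF N1 N2 N3.
have Hl (l : nat) : l \in [:: r, l1, l2, l3 & L] -> [\/ l = l1, l = l2, l = l3 | head
  r L <= l].
  rewrite !inE => /or4P[/eqP->|/eqP->|/eqP->|].
  - move: sL => /=; case: L {d3 I N1 N2 N3} => [|l4 L] /=; first by move=> *;
    apply: Or44.
    by move=> /and4P[_ _ _ /(order_path_min ltn_trans)/allP/(_ r)];
      rewrite mem_rcons mem_head => /(_ isT)/ltnW; apply: Or44.
  - exact: Or41.
  - exact: Or42.
  case/predU1P => [->|lL]; first exact: Or43.
  apply: Or44; move: sL lL => /=; case: L {d3 I N1 N2 N3} => [|l4 L] //=.
  move=> /and4P[_ _ _ /(order_path_min ltn_trans)/allP lt4].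
  rewrite inE => /predU1P[->//|lL]; apply/ltnW/lt4; by rewrite mem_rcons inE lL orbT.
have [l12 l23 l34 h4r] : [/\ l1 < l2, l2 < l3, l3 < head r L & head r L <= r].
  move: sL => /= /and3P[-> -> H]; split=> //.
    by case: L H {d3 I N1 N2 N3 Hl} => [|l4 L] /= /andP[].
  case: L H {d3 I N1 N2 N3 Hl} => [|l4 L] //= /andP[_ /(order_path_min
    ltn_trans)/allP/(_ r)].
  by rewrite mem_rcons mem_head => /(_ isT)/ltnW.
set h := head r L in Hl d3 l34 h4r.
have fA := mem_flat r AF; have Ar := uniformP _ _ u _ AF.
have sub (X Y Z : {set T}) : flat r F X -> flat r F Y -> Z \subset X -> Z \subset Y ->
    (forall l : nat, l \in [:: r, l1, l2, l3 & L] -> #|Z| <= l -> #|X| <= l) -> X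
      \subset Y.
  by move=> fX fY ZX ZY; apply: (flat_subset u I fX fY ZX ZY).
have CX X : flat r F X -> C \subset X.
  move=> fX; apply: (sub _ _ set0); rewrite ?sub0set // => l /Hl.
  by rewrite Cl cards0 => -[->|->|->|]; nat_lia.
(* All members through Y contain Z, so they share more than l elements and the least size l drops
   out of the list. *)
have starI (Y Z : {set T}) l K : set_intersecting (l :: K) (star F Y) -> l < #|Z| ->
    (forall B, B \in F -> Y \subset B -> Z \subset B) -> set_intersecting K (star F Y).
  move=> IY lZ YZ; apply/(intersectingS _ (star_intersecting IY lZ))/subsetP => B.
  by rewrite !mem_star => /andP[BF YB]; rewrite BF YB YZ.
(* The rank 1 flat through x is the least flat through x, as no admissible size lies strictly
   between l1 and l2. [line] is the analogue in rank 2. *)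
have atom x : x \in A -> x \notin C ->
    exists X, [/\ flat r F X, #|X| = l2, x \in X & forall Y, flat r F Y -> x \in Y ->
      X \subset Y].
  move=> xA xC; have : set_intersecting [:: l2, l3 & L] (star F [set x]).
    apply: (@starI _ (x |: C) l1) => [||B BF]; first exact: intersectingS (starS _ _) I.
      by rewrite cardsU1 xC Cl; nat_lia.
    by rewrite subUset => ->; rewrite CX //; apply: mem_flat.
  move: (N1 _ xA) => /unspannedPn H /H [X [fX /= Xl]].
  rewrite sub1set => xX; exists X; split=> // Y fY xY.
  apply: (sub _ _ (x |: C)) => //; rewrite ?subUset ?sub1set ?xX ?xY ?CX //.
  move=> l /Hl; rewrite cardsU1 xC Cl Xl /=; move=> [->|->|->|]; nat_lia.
have line x y X : x \in A -> y \in A -> x \notin C -> flat r F X -> #|X| = l2 ->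
    x \in X -> (forall Y, flat r F Y -> x \in Y -> X \subset Y) -> y \notin X ->
    exists M, [/\ flat r F M, #|M| = l3, x \in M, y \in M &
      forall Y, flat r F Y -> x \in Y -> y \in Y -> M \subset Y].
  move=> xA yA xC fX Xl xX Xmin yX.
  have XY Y : flat r F Y -> x \in Y -> y \in Y -> y |: X \subset Y.
    by move=> fY xY yY; rewrite subUset sub1set yY Xmin.
  have cXY : #|y |: X| = l2.+1 by rewrite cardsU1 yX Xl.
  have : set_intersecting [:: l3 & L] (star F [set x; y]).
    have YB B : B \in F -> [set x; y] \subset B -> y |: X \subset B.
      by move=> BF; rewrite subUset !sub1set => /andP[xB yB]; rewrite XY //;
        apply: mem_flat.
    apply: (@starI _ (y |: X) l2) => //; last by rewrite cXY.
    apply: (@starI _ (y |: X) l1) => //; last by rewrite cXY; nat_lia.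
    exact: intersectingS (starS _ _) I.
  move: (N2 _ _ xA yA) => /unspannedPn H /H [M [fM /= Ml]].
  rewrite subUset !sub1set => /andP[xM yM]; exists M; split=> // Y fY xY yY.
  apply: (sub _ _ (y |: X)); rewrite ?XY // => l /Hl; rewrite cXY Ml.
  move=> [->|->|->|]; nat_lia.
have pickA (X : {set T}) : #|X| < r -> exists2 x, x \in A & x \notin X.
  move=> Xr; apply/subsetPn; apply: contraL Xr => /subset_leq_card.
  by rewrite Ar -leqNgt.
have [x xA xC] : exists2 x, x \in A & x \notin C by apply: pickA; rewrite Cl; nat_lia.
have [X [fX Xl xX Xmin]] := atom x xA xC.
have [y yA yX] : exists2 y, y \in A & y \notin X by apply: pickA; rewrite Xl; nat_lia.
have [M1 [fM1 M1l xM1 yM1 M1min]] := line x y X xA yA xC fX Xl xX Xmin yX.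
have [z zA zM1] : exists2 z, z \in A & z \notin M1 by apply: pickA; rewrite M1l;
  nat_lia.
have zX : z \notin X by apply: contra zM1 => /(subsetP (Xmin _ fM1 xM1)).
have [M2 [fM2 M2l xM2 zM2 M2min]] := line x z X xA zA xC fX Xl xX Xmin zX.
have [P [fP Pl xP yP zP]] : exists P, [/\ flat r F P, #|P| = h, x \in P, y \in P & z
  \in P].
  have YB B : B \in F -> [set x; y; z] \subset B -> z |: M1 \subset B.
    move=> BF; rewrite !subUset !sub1set => /andP[/andP[xB yB] ->].
    by rewrite M1min //; apply: mem_flat.
  have cM : #|z |: M1| = l3.+1 by rewrite cardsU1 zM1 M1l.
  have : set_intersecting L (star F [set x; y; z]).
    apply: (@starI _ (z |: M1) l3); [|by rewrite cM|exact: YB].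
    apply: (@starI _ (z |: M1) l2); [|by rewrite cM; nat_lia|exact: YB].
    apply: (@starI _ (z |: M1) l1); [|by rewrite cM; nat_lia|exact: YB].
    exact: intersectingS (starS _ _) I.
  move: (N3 _ _ _ xA yA zA) => /unspannedPn H /H [P [fP /= Pl]].
  by rewrite !subUset !sub1set => /andP[/andP[xP yP] zP]; exists P.
have M1P := M1min _ fP xP yP; have M2P := M2min _ fP xP zP.
have capX M : flat r F M -> #|M| = l3 -> M != M1 -> #|M :&: M1| <= l2.
  move=> fM Ml NM; have := flat_cap u I fM fM1 => /Hl.
  have : #|M :&: M1| < l3; last by move=> ? [] *; nat_lia.
  rewrite ltn_neqAle -{2}Ml subset_leq_card ?subsetIl // andbT.
  apply: contra NM => /eqP E; rewrite eqEcard Ml M1l leqnn andbT.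
  by apply/setIidPl/eqP; rewrite eqEcard subsetIl E Ml /=.
have NM21 : M2 != M1 by apply: contra zM1 => /eqP <-.
have M12 : M2 :&: M1 = X.
  apply/esym/eqP; rewrite eqEcard subsetI !Xmin //= Xl; exact: capX.
(* Here [d3] enters: M1 and M2 share X, so their union has 2 * l3 - l2 = h elements, the size of
   P. *)
have PM : P = M1 :|: M2.
  apply/esym/eqP; rewrite eqEcard subUset M1P M2P cardsU setIC M12.
  rewrite Pl M1l M2l Xl /=; nat_lia.
have yC : y \notin C by apply: contra yX => /(subsetP (CX _ fX)).
have zC : z \notin C by apply: contra zX => /(subsetP (CX _ fX)).
have [Y [fY Yl yY Ymin]] := atom y yA yC.
have [Z [fZ Zl zZ Zmin]] := atom z zA zC.
have zY : z \notin Y by apply: contra zM1 => /(subsetP (Ymin _ fM1 yM1)).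
have [M [fM Ml yM zM Mmin]] := line y z Y yA zA yC fY Yl yY Ymin zY.
have yM2 : y \notin M2 by apply: contra yX => yM2; rewrite -M12 inE yM2.
have MM1 : #|M :&: M1| <= l2 by apply: capX => //; apply: contra zM1 => /eqP <-.
have MM2 : #|M :&: M2| <= l2.
  have /Hl := flat_cap u I fM fM2.
  have : #|M :&: M2| < l3; last by move=> ? [] *; nat_lia.
  rewrite ltn_neqAle -{2}Ml subset_leq_card ?subsetIl // andbT.
  apply: contra yM2 => /eqP E; apply: (subsetP _ _ yM).
  by apply/setIidPl/eqP; rewrite eqEcard subsetIl E Ml /=.
have up : l3 + l1 <= l2 + l2.
  have {1}<- : #|M :&: M1 :|: M :&: M2| = l3.
    by rewrite -setIUr -PM (setIidPl _) // Mmin.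
  rewrite cardsU.
  have : l1 <= #|(M :&: M1) :&: (M :&: M2)|.
    by rewrite -Cl subset_leq_card // !subsetI !CX.
  have := subset_leq_card (subsetIl (M :&: M1) (M :&: M2)); nat_lia.
have lo : l2 + l2 <= l3 + l1.
  have : #|Y :|: Z| <= l3 by rewrite -Ml subset_leq_card // subUset Ymin // Zmin.
  rewrite cardsU Yl Zl; suff : #|Y :&: Z| <= l1 by nat_lia.
  have /Hl := flat_cap u I fY fZ.
  have : #|Y :&: Z| < l2; last by move=> ? [] *; nat_lia.
  rewrite ltn_neqAle -{2}Yl subset_leq_card ?subsetIl // andbT.
  apply: contra zY => /eqP E; apply: (subsetP _ _ zZ).
  by apply/setIidPr/eqP; rewrite eqEcard subsetIr E Zl /=.
by move/eqP: d2; nat_lia.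
Qed.

(** By [design_rank3], every member contains an unspanned point, pair or triple once a core exists.
    With one, two or three points the list of sizes is one, two or three shorter, so each kind
    contributes the same order. The factor #|T| on the left avoids a predecessor in the exponent. *)
Lemma rank3_bound r l1 l2 l3 L : sorted ltn (rcons [:: l1, l2, l3 & L] r) ->
  head r L - l3 = l3 - l2 -> l3 - l2 != l2 - l1 -> exists C : nat,
  forall (T : finType) (F : {set {set T}}),
    uniform r F -> set_intersecting [:: l1, l2, l3 & L] F ->
    #|F| * #|T| <= C * #|T| ^ size [:: l1, l2, l3 & L].
Proof.
move=> sL d3 d2.
have s1 : sorted ltn (rcons [:: l2, l3 & L] r) by exact: path_sorted sL.
have s2 : sorted ltn (rcons [:: l3 & L] r) by exact: path_sorted s1.
have s3 : sorted ltn (rcons L r) by exact: path_sorted s2.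
have [C0 H0] := flat_or_small sL.
have [C1 H1] := card_unspanned s1.
have [C2 H2] := card_unspanned s2.
have [C3 H3] := card_unspanned s3.
exists (C0 + C1 + C2 + C3) => T F u I.
have [_ [[C fC Cl]|small]] := H0 T F u I; last first.
  by apply: leq_trans small _; rewrite leq_mul2r -!addnA leq_addr orbT.
have {}H1 := H1 T T F (fun x => [set x]) [pred x | unspanned r [:: l2, l3 & L] F [set
  x]] u (fun x => id).
have {}H2 := H2 T _ F (fun p : T * T => [set p.1; p.2])
  [pred p | unspanned r [:: l3 & L] F [set p.1; p.2]] u (fun x => id).
have {}H3 := H3 T _ F (fun p : T * T * T => [set p.1.1; p.1.2; p.2])
  [pred p | unspanned r L F [set p.1.1; p.1.2; p.2]] u (fun x => id).
set F1 := finset _ in H1; set F2 := finset _ in H2; set F3 := finset _ in H3.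
have FF : F \subset F1 :|: F2 :|: F3.
  apply/subsetP => A AF; rewrite -[_ \in _]negbK; apply/negP.
  rewrite !inE AF /= !negb_or => /andP[/andP[N1 N2] N3].
  apply: (design_rank3 sL d3 d2 u I fC Cl AF).
  - move=> x xA; apply: contra N1 => Ux.
    by apply/exists_inP; exists x; rewrite ?inE ?sub1set.
  - move=> x y xA yA; apply: contra N2 => Ux.
    by apply/exists_inP; exists (x, y); rewrite ?inE // subUset !sub1set xA.
  - move=> x y z xA yA zA; apply: contra N3 => Ux.
    by apply/exists_inP; exists (x, y, z); rewrite ?inE // !subUset !sub1set xA yA.
have leF : #|F| <= #|F1| + #|F2| + #|F3|.
  apply: leq_trans (subset_leq_card FF) _.
  by rewrite (leq_trans (leq_card_setU _ _)) // leq_add2r leq_card_setU.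
apply: (@leq_trans ((#|F1| + #|F2| + #|F3|) * #|T|));
  first by rewrite leq_mul2r leF orbT.
have up (U : finType) (P : {pred U}) m c : #|P| * m <= #|U| * m + c.
  by apply: leq_trans (leq_addr _ _); rewrite leq_mul2r max_card orbT.
rewrite !mulnDl; move: (leq_trans H1 (up _ _ _ 0)) (leq_trans H2 (up _ _ _ 0))
  (leq_trans H3 (up _ _ _ 0)).
rewrite !card_prod /= !expnS !addn0;
  move: (leq0n (C0 * (#|T| * (#|T| * (#|T| * #|T| ^ size L))))).
move: (#|F1|) (#|F2|) (#|F3|) (#|T| ^ size L) (#|T|) => f1 f2 f3 N n; clear; lia.
Qed.

(** The flat of size l1 lies in every member, so the members through one further vertex no longer
    meet in l1 elements. There are at most #|T| such links. *)
Lemma link_flat_bound r l1 L : sorted ltn (rcons (l1 :: L) r) ->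
  (exists C : nat, forall (T : finType) (F : {set {set T}}),
    uniform r F -> set_intersecting L F ->
    #|F| * #|T| <= C * #|T| ^ size L) ->
  exists C : nat, forall (T : finType) (F : {set {set T}}),
    uniform r F -> set_intersecting (l1 :: L) F ->
    #|F| * #|T| <= C * #|T| ^ (size L).+1.
Proof.
move=> sL [C HC]; have [C0 H0] := flat_or_small sL.
exists (C0 + C) => T F u I.
have [_ [[X fX Xl]|small]] := H0 T F u I; last first.
  by apply: leq_trans small _; rewrite leq_mul2r leq_addr orbT.
have [T0|T0] := posnP #|T|; first by rewrite T0 muln0.
have leF : #|F| <= #|T| * (C * #|T| ^ size L %/ #|T|).
  apply: (card_le_link sL u I fX Xl) => x xX.
  rewrite leq_divRL // HC ?(uniformS (starS _ _)) //.
  by apply: star_intersecting I _; rewrite cardsU1 xX Xl.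
apply: leq_trans (leq_mul leF (leqnn _)) _.
rewrite -mulnA (leq_trans (leq_mul (leqnn _) (leq_trunc_div _ _))) //.
by rewrite mulnCA -expnS leq_mul2r leq_addl orbT.
Qed.

Lemma arith_progP d a b s : arith_prog d [:: a, b & s] ->
  (b == a + d) && arith_prog d (b :: s).
Proof. by []. Qed.

(** Sizes are removed from the front until the remaining tail is an arithmetic progression but
    prepending one more size is not, which is the situation of [rank3_bound]. With two sizes the gap
    condition contradicts the assumption, so the removal lemma is never reached. *)
Lemma non_arith_bound r L : sorted ltn (rcons L r) -> 1 < size L ->
  ~ (exists d, arith_prog d (rcons L r)) ->
  r - nth 0 L (size L - 1) = nth 0 L (size L - 1) - nth 0 L (size L - 2) ->
  exists C : nat, forall (T : finType) (F : {set {set T}}),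
    uniform r F -> set_intersecting L F ->
    #|F| * #|T| <= C * #|T| ^ size L.
Proof.
elim: L => [//|l1 [//|l2 [_ sL _ nAP /= E|l3 L IH sL _ nAP E]]].
  case: nAP; exists (r - l2); move: sL E; rewrite /= /arith_prog /=; lia.
have /= sL1 := path_sorted sL.
have [/= AP|nAP'] := boolP (arith_prog (l3 - l2) (rcons [:: l2, l3 & L] r)).
  apply: rank3_bound => //.
    by move: AP sL1; case: L {IH sL nAP E} => [|l4 L] /=; rewrite /arith_prog /=; lia.
  apply/eqP => E'; apply: nAP; exists (l3 - l2).
  move: AP sL; rewrite /arith_prog /= => -> ; lia.
apply: (link_flat_bound sL); apply: (IH sL1 isT); last first.
  by move: E; rewrite /= !subSS !subn0.
  move=> [d dAP]; case/negP: nAP'; suff -> : l3 - l2 = d by [].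
  by move: dAP => /arith_progP/andP[/eqP-> _]; rewrite addKn.
Qed.

(** * The clique removal lemma *)

Section Removal.
Import Order.TTheory GRing.Theory Num.Theory.
Local Open Scope ring_scope.

(** * Conditional averages and their energy *)

Section CondExp.
Variables (R : realFieldType) (P : finType) (f : P -> R).

(** The conditional expectation of f given k = a; on an empty fibre it is 0 / 0 = 0. *)
Definition fib_avg (K : finType) (k : P -> K) (a : K) : R :=
  (\sum_(p | k p == a) f p) / #|[pred p | k p == a]|%:R.

Lemma sum_fib_avg (K : finType) (k : P -> K) a :
  \sum_(p | k p == a) fib_avg k a = \sum_(p | k p == a) f p.
Proof.
rewrite sumr_const -[_ *+ _]mulr_natr /fib_avg.
have [c0|c0] := posnP #|[pred p | k p == a]|; last first.
  by rewrite divfK // pnatr_eq0 -lt0n.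
rewrite c0 mulr0 big_pred0 // => p; by have := card0_eq c0 p.
Qed.

(** Averaging preserves the sum over each fibre, and a function of k is constant there. *)
Lemma sum_fib_avgM (K : finType) (k : P -> K) (g : K -> R) :
  \sum_p g (k p) * fib_avg k (k p) = \sum_p g (k p) * f p.
Proof.
rewrite [LHS](partition_big k xpredT) //= [RHS](partition_big k xpredT) //=.
apply: eq_bigr => a _; transitivity (g a * \sum_(p | k p == a) fib_avg k a).
  by rewrite mulr_sumr; apply: eq_bigr => p /eqP ->.
by rewrite sum_fib_avg mulr_sumr; apply: eq_bigr => p /eqP ->.
Qed.

Definition energy (K : finType) (k : P -> K) : R := \sum_p fib_avg k (k p) ^+ 2.

Lemma energy_ge0 (K : finType) (k : P -> K) : 0 <= energy k.
Proof. by apply: sumr_ge0 => p _; apply: sqr_ge0. Qed.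

Lemma energy_le (K : finType) (k : P -> K) :
  (forall p, 0 <= f p <= 1) -> energy k <= #|P|%:R.
Proof.
move=> f01; rewrite -[#|P|]sum1_card natr_sum; apply: ler_sum => p _.
have : 0 <= fib_avg k (k p) <= 1.
  rewrite divr_ge0 ?ler0n ?sumr_ge0 //=; last by move=> q _; case/andP: (f01 q).
  rewrite /fib_avg; set c := #|_|; have [c0|c0] := posnP c;
    first by rewrite c0 invr0 mulr0 ler01.
  rewrite ler_pdivrMr ?ltr0n // mul1r /c -sum1_card natr_sum.
  by apply: ler_sum => q _; case/andP: (f01 q).
by move=> /andP[? ?]; rewrite expr_le1.
Qed.

(** Since k factors through k', the k-averages are the orthogonal projection of the k'-averages, and
    the cross term equals [energy k]. *)
Lemma pythagoras (K K' : finType) (k : P -> K) (k' : P -> K') (h : K' -> K) :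
  (forall p, k p = h (k' p)) ->
  energy k' = energy k + \sum_p (fib_avg k' (k' p) - fib_avg k (k p)) ^+ 2.
Proof.
move=> kh; have E : \sum_p fib_avg k (k p) * fib_avg k' (k' p) = energy k.
  rewrite (eq_bigr (fun p => fib_avg k (h (k' p)) * fib_avg k' (k' p))) => [|p _];
    last by rewrite kh.
  rewrite (sum_fib_avgM k' (fun a => fib_avg k (h a))).
  rewrite /energy [RHS](eq_bigr (fun p => fib_avg k (k p) * fib_avg k (k p))) => [|p
    _]; last by rewrite expr2.
  by rewrite (sum_fib_avgM k (fib_avg k)); apply: eq_bigr => p _; rewrite kh.
rewrite [X in _ + X](eq_bigr (fun p => fib_avg k' (k' p) ^+ 2
   - 2 * (fib_avg k (k p) * fib_avg k' (k' p)) + fib_avg k (k p) ^+ 2)); last first.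
  by move=> p _; ring.
rewrite !big_split /= sumrN -mulr_sumr E -!/(energy _); ring.
Qed.

(** Cauchy-Schwarz for a mean of at most -e, read off from the expansion of the sum of (h p +
    e)^2. *)
Lemma sum_sqr_ge (S : pred P) (h : P -> R) (e : R) : 0 <= e ->
  \sum_(p | S p) h p <= - e * #|[pred p | S p]|%:R ->
  e ^+ 2 * #|[pred p | S p]|%:R <= \sum_(p | S p) h p ^+ 2.
Proof.
move=> e0 H; have : 0 <= \sum_(p | S p) (h p + e) ^+ 2 by apply: sumr_ge0 => p _;
  apply: sqr_ge0.
rewrite (eq_bigr (fun p => h p ^+ 2 + 2 * e * h p + e ^+ 2)); last by move=> p _; ring.
rewrite !big_split /= -mulr_sumr sumr_const -[_ *+ _]mulr_natr.
have : 2 * e * (\sum_(p | S p) h p) <= 2 * e * (- e * #|[pred p | S p]|%:R).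
  by rewrite ler_wpM2l // mulr_ge0.
set c := #|_|%:R; nra.
Qed.

End CondExp.

(** * A regularity lemma by energy increment *)

Section Regularity.
Variables (R : realFieldType) (T : finType) (e : rel T).
Implicit Types (A B S : {set T}).

Definition edge_count A B : R := \sum_(p in setX A B) (e p.1 p.2)%:R.

Definition density A B : R := edge_count A B / (#|A| * #|B|)%:R.

(* One-sided irregularity: only a deficit of edges is recorded. *)
Definition irregular_witness (eps : R) A B (q : {set T} * {set T}) :=
  [&& q.1 \subset A, q.2 \subset B, eps * #|A|%:R <= #|q.1|%:R,
      eps * #|B|%:R <= #|q.2|%:R &
      edge_count q.1 q.2 <= (density A B - eps) * (#|q.1| * #|q.2|)%:R].

Definition irregular (eps : R) A B := [exists q, irregular_witness eps A B q].

Section Refinement.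
Variables (K : finType) (c : T -> K) (eps : R).

Definition cell a := [set x | c x == a].

Definition witness a b : {set T} * {set T} :=
  odflt (set0, set0) [pick q | irregular_witness eps (cell a) (cell b) q].

(** The common refinement of the cells by all witness rectangles: besides its cell, x remembers in
    which left and right witness sets it lies. Regular pairs have the empty default witness and cut
    nothing. *)
Definition refinement x : K * {set K} * {set K} :=
  (c x, [set b | x \in (witness (c x) b).1], [set a | x \in (witness a (c x)).2]).

End Refinement.

Definition pair_colour (K : finType) (c : T -> K) (p : T * T) := (c p.1, c p.2).

Definition edge_ind (p : T * T) : R := (e p.1 p.2)%:R.

Definition cell_energy (K : finType) (c : T -> K) := energy edge_ind (pair_colour c).

Lemma pair_colour_cell (K : finType) (c : T -> K) q p :
  (pair_colour c p == q) = (p \in setX (cell c q.1) (cell c q.2)).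
Proof. by case: q => a b; rewrite !inE /= xpair_eqE. Qed.

Lemma fib_avg_density (K : finType) (c : T -> K) q :
  fib_avg edge_ind (pair_colour c) q = density (cell c q.1) (cell c q.2).
Proof.
rewrite /fib_avg /density /edge_count -cardsX; congr (_ / _%:R).
  by apply: eq_bigl => p; rewrite pair_colour_cell.
by apply: eq_card => p; rewrite inE pair_colour_cell.
Qed.

(* The density of the refined partition deviates from the old one by at least
   eps on average over each witness rectangle. *)
Lemma refinement_energy (K : finType) (c : T -> K) (eps : R) : 0 <= eps ->
  cell_energy c + eps ^+ 4 *
    \sum_(q : K * K | irregular eps (cell c q.1) (cell c q.2))
       (#|cell c q.1| * #|cell c q.2|)%:R
  <= cell_energy (refinement c eps).
Proof.
move=> e0; set k := pair_colour c; set k' := pair_colour (refinement c eps).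
rewrite /cell_energy (@pythagoras _ _ edge_ind _ _ k k' (fun u => (u.1.1.1, u.2.1.1)))
  //.
rewrite lerD2l [leRHS](partition_big k xpredT) //= mulr_sumr big_mkcond /=.
apply: ler_sum => -[a b] _ /=; case: ifP => [|_]; last first.
  by apply: sumr_ge0 => p _; apply: sqr_ge0.
move=> irr; pose q := witness c eps a b.
have : irregular_witness eps (cell c a) (cell c b) q.
  rewrite /q /witness; case: pickP => //= N.
  by case/existsP: irr => q'; rewrite N.
case/and5P=> S1 S2 s1 s2 def.
have Sk p : p \in setX q.1 q.2 -> k p = (a, b).
  move=> pq; apply/eqP; rewrite pair_colour_cell; apply: subsetP pq.
  by apply/subsetP => -[x y]; rewrite !in_setX => /andP[/(subsetP S1)-> /(subsetP
    S2)->].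
apply: (@le_trans _ _ (\sum_(p in setX q.1 q.2) (fib_avg edge_ind k' (k' p) - fib_avg
  edge_ind k (k p)) ^+ 2)).
  have H : eps ^+ 2 * #|[pred p in setX q.1 q.2]|%:R <=
      \sum_(p in setX q.1 q.2) (fib_avg edge_ind k' (k' p) - fib_avg edge_ind k (k p))
        ^+ 2.
    apply: (@sum_sqr_ge _ _ (mem (setX q.1 q.2))) => //.
    have Eq : #|[pred p | mem (setX q.1 q.2) p]| = (#|q.1| * #|q.2|)%N.
      by rewrite -cardsX; apply: eq_card.
    rewrite sumrB Eq.
    have -> : \sum_(p in setX q.1 q.2) fib_avg edge_ind k (k p) =
        density (cell c a) (cell c b) * (#|q.1| * #|q.2|)%:R.
      rewrite (eq_bigr (fun=> density (cell c a) (cell c b))) => [|p /Sk ->];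
        last first.
        by rewrite fib_avg_density.
      by rewrite sumr_const cardsX -[_ *+ _]mulr_natr.
    suff -> : \sum_(p in setX q.1 q.2) fib_avg edge_ind k' (k' p) = edge_count q.1 q.2.
      by move: def; set D := density _ _; lra.
    (* The indicator of the witness rectangle is a function of the refined colours, so
       [sum_fib_avgM] turns the sum of refined averages over it into its edge count. *)
    pose g (u : (K * {set K} * {set K}) * (K * {set K} * {set K})) : R :=
      [&& u.1.1.1 == a, b \in u.1.1.2, u.2.1.1 == b & a \in u.2.2]%:R.
    have gE p : g (k' p) = (p \in setX q.1 q.2)%:R.
      case: p => x y; rewrite /g /= in_setX !inE /=; congr (_%:R : R);
        congr nat_of_bool.
      have [xa|xa] := eqVneq (c x) a; last first.
        by case: (boolP (x \in q.1)) => // /(subsetP S1); rewrite inE (negPf xa).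
      have [yb|yb] := eqVneq (c y) b; last first.
        case: (boolP (y \in q.2)) => [/(subsetP S2)|]; first by rewrite inE (negPf yb).
        by rewrite !andbF.
      by rewrite xa yb.
    transitivity (\sum_p g (k' p) * fib_avg edge_ind k' (k' p)).
      by rewrite big_mkcond; apply: eq_bigr => p _; rewrite gE; case: ifP;
        rewrite ?mul1r ?mul0r.
    rewrite sum_fib_avgM /edge_count [RHS]big_mkcond; apply: eq_bigr => p _.
    by rewrite gE; case: ifP; rewrite ?mul1r ?mul0r.
  (* Each side of the rectangle takes up at least a proportion eps of its cell, which costs the
     other factor eps ^+ 2. *)
  apply: le_trans H; rewrite (exprD eps 2 2) -mulrA ler_wpM2l ?sqr_ge0 //.
  have -> : #|[pred p in setX q.1 q.2]| = (#|q.1| * #|q.2|)%N.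
    by rewrite -cardsX; apply: eq_card.
  rewrite !natrM; apply: (@le_trans _ _ ((eps * #|cell c a|%:R) * (eps * #|cell c
    b|%:R))).
    by rewrite expr2; lra.
  by apply: ler_pM => //; rewrite mulr_ge0.
rewrite big_mkcond [leRHS]big_mkcond; apply: ler_sum => p _.
case: ifP => [/Sk->|_]; first by rewrite eqxx.
by case: ifP => // _; apply: sqr_ge0.
Qed.

End Regularity.

(** While irregular pairs weigh more than eps * n^2, refining adds more than eps^5 * n^2 to an
    energy that never exceeds n^2. The cells may have any sizes, so a pair counts with the product
    of its sizes. *)
Lemma regularity (R : archiRealFieldType) (eps : R) : 0 < eps -> exists M : nat,
  forall (T : finType) (e : rel T), exists (K : finType) (c : T -> K),
    (#|K| <= M)%N /\
    \sum_(q : K * K | irregular e eps (cell c q.1) (cell c q.2))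
       (#|cell c q.1| * #|cell c q.2|)%:R <= eps * (#|T| * #|T|)%:R.
Proof.
move=> e0; pose d := eps ^+ 5; have d0 : 0 < d by rewrite exprn_gt0.
have [J] : exists J : nat, 1 < J%:R * d.
  exists (Num.bound (1 / d)); rewrite -ltr_pdivrMr //.
  by apply: archi_boundP; rewrite divr_ge0 // ltW.
move=> Jd; pose next M := (M * 2 ^ M * 2 ^ M)%N.
(* The energy is within j * d * n^2 of its upper bound n^2, so j bounds the number of refinements
   still possible; j = 0 is contradictory. *)
have step j : forall M, exists M', forall (T : finType) (e : rel T) (K : finType) (c :
  T -> K),
    (#|K| <= M)%N -> (0 < #|T|)%N ->
    (#|T| * #|T|)%:R < cell_energy R e c + j%:R * d * (#|T| * #|T|)%:R ->
    exists (K : finType) (c : T -> K),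
    (#|K| <= M')%N /\
    \sum_(q : K * K | irregular e eps (cell c q.1) (cell c q.2))
       (#|cell c q.1| * #|cell c q.2|)%:R <= eps * (#|T| * #|T|)%:R.
  have up (T : finType) (e : rel T) (K : finType) (c : T -> K) : cell_energy R e c <=
    (#|T| * #|T|)%:R.
    rewrite -card_prod; apply: energy_le => p; rewrite /edge_ind.
    by case: (e _ _); rewrite ?lexx ler01.
  elim: j => [|j IH] M.
    by exists 0%N => T e K c _ _; rewrite !mul0r addr0 ltNge up.
  have [M' HM'] := IH (next M); exists (maxn M M') => T e K c KM T0 H.
  have [good|bad] := lerP (\sum_(q : K * K | irregular e eps (cell c q.1) (cell c q.2))
       (#|cell c q.1| * #|cell c q.2|)%:R) (eps * (#|T| * #|T|)%:R).
    by exists K, c; rewrite leq_max KM.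
  have := HM' T e _ (refinement e c eps).
  case=> // [||K' [c' [KM' H']]].
  - have cset : #|{set K}| = (2 ^ #|K|)%N by have := card_powerset [set: K];
    rewrite powersetT !cardsT.
    rewrite !card_prod cset /next !leq_mul // leq_pexp2l //.
  - apply: lt_le_trans H _.
    have := refinement_energy e c (ltW e0).
    have : eps ^+ 4 * (eps * (#|T| * #|T|)%:R) <= eps ^+ 4 *
      \sum_(q | irregular e eps (cell c q.1) (cell c q.2)) (#|cell c q.1| * #|cell c
        q.2|)%:R.
      by apply: ler_wpM2l; rewrite ?exprn_ge0 // ltW.
    rewrite mulrA -exprSr -/d -natr1 !mulrDl mul1r.
    set S := \sum_(_ | _) _; set n := _%:R; lra.
  by exists K', c'; rewrite leq_max KM' orbT.
have [M HM] := step J 1%N; exists (maxn 1 M) => T e.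
have [T0|T0] := posnP #|T|.
  exists unit, (fun=> tt); rewrite card_unit leq_max leqnn; split=> //.
  rewrite T0 mul0n mulr0 big1 // => q _.
  by rewrite (_ : #|cell _ q.1| = 0%N) //; apply/eqP; rewrite -leqn0 -T0 max_card.
have [|//||K [c [KM Kc]]] := HM T e unit (fun=> tt); first by rewrite card_unit.
  have : 0 <= cell_energy R e (fun=> tt) by apply: energy_ge0.
  have : 0 < (#|T| * #|T|)%:R :> R by rewrite ltr0n muln_gt0 T0.
  move: Jd; set n := (_ * _)%:R; set E := cell_energy _ _ _; nra.
by exists K, c; rewrite leq_max KM orbT.
Qed.

(** What a regular pair of density well above g provides. Empty S or S' are excluded because the
    strict inequality fails for them. *)
Definition dense_pair (R : realFieldType) (T : finType) (e : rel T) (g eps : R)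
    (A B : {set T}) :=
  forall S S' : {set T}, S \subset A -> S' \subset B ->
    0 < #|S|%:R :> R -> 0 < #|S'|%:R :> R ->
    eps * #|A|%:R <= #|S|%:R -> eps * #|B|%:R <= #|S'|%:R ->
    g * (#|S| * #|S'|)%:R < edge_count R e S S'.

Lemma edge_countE (R : realFieldType) (T : finType) (e : rel T) (A B : {set T}) :
  edge_count R e A B = \sum_(x in A) #|[set y in B | e x y]|%:R.
Proof.
rewrite /edge_count (eq_bigl (fun p => (p.1 \in A) && (p.2 \in B))) => [|p];
  last by rewrite inE.
rewrite -(pair_big (mem A) (mem B) (fun x y => (e x y)%:R)) /=.
apply: eq_bigr => x _; rewrite -sum1_card natr_sum big_mkcond [RHS]big_mkcond.
by apply: eq_bigr => y _; rewrite inE; case: (y \in B); case: (e x y).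
Qed.

(** Greedy embedding: W i holds the remaining candidates in V i, and eta bounds their proportion.
    For each later part, fewer than eps * #|V 0| vertices of W 0 see less than a proportion g of its
    candidates, so some vertex suits all parts, and choosing it multiplies eta by g. No vertex is
    taken from the last part: what is left of it consists of common neighbours. *)
Lemma embedding (R : realFieldType) (T : finType) (e : rel T) (g eps : R) k :
  0 < g <= 1 -> 0 < eps -> forall (V W : nat -> {set T}) (eta : R),
  (forall i, (i <= k)%N -> [/\ W i \subset V i, 0 < #|V i|%:R :> R & eta * #|V i|%:R
    <= #|W i|%:R]) ->
  (forall i j, (i < j)%N -> (j <= k)%N -> dense_pair e g eps (V i) (V j)) ->
  k.+1%:R * eps <= eta * g ^+ k ->
  exists s : seq T, [/\ size s = k, pairwise e s,
    (forall x, x \in s -> exists2 i, (i <= k)%N & x \in W i) &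
    eta * g ^+ k * #|V k|%:R <= #|[set x in W k | all (e^~ x) s]|%:R].
Proof.
case/andP=> g0 g1 e0; elim: k => [|k IH] V W eta VW dens le_eps.
  have [_ _ H] := VW 0%N isT; exists [::]; split=> //; rewrite expr0 mulr1.
  by rewrite (_ : [set x in W 0%N | _] = W 0%N) //; apply/setP => x; rewrite !inE andbT.
have eta0 : 0 < eta.
  rewrite -(pmulr_lgt0 _ (exprn_gt0 k.+1 g0)); apply: lt_le_trans le_eps.
  by rewrite mulr_gt0 // ltr0n.
have le_eta : k.+2%:R * eps <= eta.
  by apply: le_trans le_eps _; rewrite ler_piMr ?(ltW eta0) // exprn_ile1 // ltW.
have eps_eta : eps <= eta.
  by apply: le_trans le_eta; rewrite ler_peMl ?(ltW e0) // ler1n.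
have W0 i : (i <= k.+1)%N -> 0 < #|W i|%:R :> R.
  by move=> /VW[_ V0]; apply: lt_le_trans; rewrite mulr_gt0.
pose bad j := [set v in W 0%N | #|[set x in W j | e v x]|%:R < g * #|W j|%:R].
have badP (j : 'I_k.+1) : #|bad j.+1|%:R < eps * #|V 0%N|%:R.
  rewrite ltNge; apply/negP => H; have jk : (j.+1 <= k.+1)%N by [].
  have [_ V00 _] := VW 0%N isT; have [WV Vj0 etaj] := VW _ jk.
  have bW : bad j.+1 \subset W 0%N by apply/subsetP => x; rewrite inE => /andP[].
  have b0 : 0 < #|bad j.+1|%:R :> R by apply: lt_le_trans H; rewrite mulr_gt0.
  have : g * (#|bad j.+1| * #|W j.+1|)%:R < edge_count R e (bad j.+1) (W j.+1).
    apply: (dens 0%N j.+1) => //; rewrite ?W0 //; last by apply: le_trans etaj;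
      rewrite ler_pM2r.
    by apply: subset_trans bW _; case: (VW 0%N isT).
  rewrite ltNge edge_countE; case/negP.
  apply: (@le_trans _ _ (\sum_(x in bad j.+1) g * #|W j.+1|%:R)).
    by apply: ler_sum => x; rewrite inE => /andP[_ /ltW].
  by rewrite sumr_const -[_ *+ _]mulr_natr natrM le_eqVlt; apply/orP; left; apply/eqP;
    ring.
have [v vW vb] : exists2 v, v \in W 0%N & forall j : 'I_k.+1, v \notin bad j.+1.
  have : ~~ (W 0%N \subset \bigcup_(j < k.+1) bad j.+1).
    apply/negP => /subset_leq_card; rewrite leqNgt -(ltr_nat R) => /negP[].
    have [_ V00 etaW] := VW 0%N isT; apply: lt_le_trans etaW.
    apply: (@lt_le_trans _ _ (k.+2%:R * eps * #|V 0%N|%:R)); last by rewrite ler_pM2r.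
    apply: (@le_lt_trans _ _ (\sum_(j < k.+1) eps * #|V 0%N|%:R)); last first.
      by rewrite sumr_const card_ord -[_ *+ _]mulr_natl mulrA ltr_pM2r // ltr_pM2r //
        ltr_nat.
    apply: (@le_trans _ _ (\sum_(j < k.+1) #|bad j.+1|%:R)); last first.
      by apply: ler_sum => j _; apply/ltW/badP.
    rewrite -natr_sum ler_nat; elim/big_rec2: _ => [|j n U _ Hn];
      first by rewrite cards0.
    by rewrite (leq_trans (leq_card_setU _ _)) ?leq_add2l.
  case/subsetPn=> v vW vb; exists v => // j; apply: contra vb => vb.
  by apply/bigcupP; exists j.
have [i ik|i j ij jk||s [ss ps sW sc]] :=
    IH (fun i => V i.+1) (fun i => [set x in W i.+1 | e v x]) (eta * g).
- have [WV Vi etai] := VW i.+1 ik; split=> //.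
    by apply: subset_trans WV; apply/subsetP => x; rewrite inE => /andP[].
  have := vb (Ordinal (ik : (i < k.+1)%N)); rewrite inE vW /= -leNgt; apply: le_trans.
  by rewrite [eta * g]mulrC -mulrA ler_pM2l.
- exact: dens.
- rewrite -mulrA -exprS; apply: le_trans le_eps; by rewrite ler_pM2r // ler_nat.
exists (v :: s); split=> [||x|]; rewrite /= ?ss //.
- by rewrite ps andbT; apply/allP => x /sW[i _]; rewrite inE => /andP[].
- rewrite inE => /predU1P[->|/sW[i ik]]; first by exists 0%N.
  by rewrite inE => /andP[xW _]; exists i.+1.
rewrite exprS mulrA; apply: le_trans sc _; rewrite ler_nat; apply: subset_leq_card.
by apply/subsetP => x; rewrite !inE => /andP[/andP[-> ->] ->].
Qed.

(** The usual hypothesis of few (k + 1)-cliques is replaced by a constant bound on the common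
    neighbours of a k-clique. A single surviving (k + 1)-clique then contradicts [embedding],
    without a count of cliques. *)
Lemma clique_removal k K j : (0 < k)%N -> (0 < j)%N -> exists N : nat,
  forall (T : finType) (e : rel T), (N <= #|T|)%N ->
    (forall s : seq T, size s = k -> pairwise e s ->
       (#|[set x | all (e^~ x) s]| <= K)%N) ->
    exists E : {set T * T}, [/\ (forall p, p \in E -> e p.1 p.2),
      (j * #|E| <= #|T| * #|T|)%N &
      forall s : seq T, size s = k.+1 -> pairwise e s ->
        ~~ pairwise [rel x y | (x, y) \notin E] s].
Proof.
move=> k0 j0.
(* Pairs of density below a are dropped. As eps <= g = a / 2, large subsets of a kept regular pair
   still have density above g. The deleted edges number at most (eps + a + 2 * g) * n^2 <= 4 * a *
   n^2. *)
have [a [a0 aj a1]] : exists a : rat, [/\ 0 < a, a * 4 * j%:R = 1 & a <= 1].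
  exists (4 * j%:R)^-1; rewrite invr_gt0 mulr_gt0 ?ltr0n //; split=> //.
    by rewrite -mulrA mulVf // mulf_neq0 // pnatr_eq0 -lt0n.
  rewrite invf_le1 ?mulr_gt0 ?ltr0n //; apply: (@le_trans _ _ (4 * 1)) => //.
  by rewrite ler_pM2l // ler1n.
have [g gE] : exists g : rat, g = a / 2 by exists (a / 2).
have g0 : 0 < g by rewrite gE divr_gt0.
have g1 : g <= 1 by lra.
have [eps [eps0 epsE]] : exists eps : rat, 0 < eps /\ k.+1%:R * eps = g ^+ k.+1.
  exists (g ^+ k.+1 / k.+1%:R); rewrite divr_gt0 ?exprn_gt0 ?ltr0n //.
  by rewrite mulrC divfK // pnatr_eq0.
have g01 : 0 < g <= 1 by rewrite g0.
have epsg : eps <= g.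
  apply: (@le_trans _ _ (k.+1%:R * eps)); first by rewrite ler_peMl ?ler1n // ltW.
  by rewrite epsE exprS ler_piMr ?(ltW g0) // exprn_ile1 // ltW.
have [M0 HM] := regularity eps0; pose M := M0.+1.
(* A cell that is not small has at least g * n / M vertices, and the embedding leaves a proportion g
   ^+ k of them; beyond N this exceeds K. *)
pose N := (Num.bound (K.+1%:R * M%:R / (g ^+ k * g))).+1.
exists N => T e NT noK; have [K0 [c [KM irr]]] := HM T e.
have T0 : 0 < #|T|%:R :> rat by rewrite ltr0n; apply: leq_trans NT.
pose small x := #|cell c x|%:R * M%:R < g * #|T|%:R :> rat.
pose sparse x y := density rat e (cell c x) (cell c y) < a.
pose bad x y := [|| irregular e eps (cell c x) (cell c y), sparse x y, small x | small
  y].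
exists [set p | e p.1 p.2 && bad (c p.1) (c p.2)]; split.
- by move=> p; rewrite inE => /andP[].
- rewrite -(ler_nat rat) !natrM; set E := finset _.
  pose n : rat := #|T|%:R; pose kc := pair_colour c.
  have sum_cells F : \sum_(p : T * T) F (kc p) = \sum_q F q * (#|cell c q.1| * #|cell
    c q.2|)%:R :> rat.
    rewrite (partition_big kc xpredT) //; apply: eq_bigr => q _.
    rewrite (eq_bigr (fun=> F q)) => [|p /eqP->//].
    rewrite (eq_bigl (fun p => p \in setX (cell c q.1) (cell c q.2))) => [|p];
      last first.
      by rewrite /kc pair_colour_cell.
    by rewrite sumr_const cardsX -[_ *+ _]mulr_natr.
  have n2 (x : rat) : \sum_(p : T * T) x = x * (n * n).
    by rewrite sumr_const card_prod -[_ *+ _]mulr_natr natrM.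
  have S1 : \sum_(p : T * T) (irregular e eps (cell c (c p.1)) (cell c (c p.2)))%:R <=
    eps * (n * n).
    rewrite (sum_cells (fun q => (irregular e eps (cell c q.1) (cell c q.2))%:R)).
    rewrite /n -natrM; apply: le_trans irr; rewrite [leRHS]big_mkcond /=;
      apply: ler_sum => q _.
    by case: ifP; rewrite ?mul1r ?mul0r.
  (* Sparseness depends on the cells only, so edges may be replaced by densities, which are below a
     there. *)
  have S2 : \sum_(p : T * T) (e p.1 p.2 && sparse (c p.1) (c p.2))%:R <= a * (n * n).
    rewrite -n2 (eq_bigr (fun p => (sparse (kc p).1 (kc p).2)%:R * edge_ind rat e p))
      => [|p _]; last first.
      by rewrite /edge_ind -natrM mulnb andbC.
    rewrite -(sum_fib_avgM _ kc (fun q => (sparse q.1 q.2)%:R)); apply: ler_sum => p _.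
    rewrite fib_avg_density /sparse; case: ltP => [/ltW|]; rewrite ?mul1r //.
    by move=> _; rewrite mul0r ltW.
  have S3 : \sum_x (small (c x))%:R <= g * n.
    rewrite (partition_big c xpredT) //=;
      apply: (@le_trans _ _ (\sum_(q : K0) g * n / M%:R)).
      apply: ler_sum => q _; rewrite (eq_bigr (fun=> (small q)%:R)) => [|p /eqP->//].
      rewrite sumr_const -[_ *+ _]mulr_natr.
      have -> : #|[pred i | c i == q]| = #|cell c q| by apply: eq_card => x;
        rewrite !inE.
      rewrite ler_pdivlMr ?ltr0n // -mulrA; rewrite /small; case: ltP => [/ltW|];
        rewrite ?mul1r //.
      by move=> _; rewrite !mul0r mulr_ge0  // ltW.
    rewrite sumr_const -[_ *+ _]mulr_natr mulrAC ler_pdivrMr ?ltr0n // ler_pM2l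
      ?mulr_gt0  //.
    by rewrite ler_nat leqW.
  have S4 : \sum_(p : T * T) (small (c p.1))%:R <= g * (n * n).
    rewrite -(pair_big xpredT xpredT (fun x y : T => (small (c x))%:R)) /=.
    rewrite exchange_big /= sumr_const -[_ *+ _]mulr_natr mulrA ler_pM2r //.
  have S5 : \sum_(p : T * T) (small (c p.2))%:R <= g * (n * n).
    rewrite -(pair_big xpredT xpredT (fun x y : T => (small (c y))%:R)) /=.
    rewrite sumr_const -[_ *+ _]mulr_natr mulrA ler_pM2r //.
  have leE : #|E|%:R <= \sum_(p : T * T) (irregular e eps (cell c (c p.1)) (cell c (c
    p.2)))%:R +
     \sum_(p : T * T) (e p.1 p.2 && sparse (c p.1) (c p.2))%:R +
     \sum_(p : T * T) (small (c p.1))%:R + \sum_(p : T * T) (small (c p.2))%:R :> rat.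
    rewrite -!big_split -sum1_card natr_sum big_mkcond /=; apply: ler_sum => p _.
    rewrite inE /bad; case: (e _ _) => /=; last by rewrite !addr_ge0 ?ler0n.
    case: (irregular _ _ _ _); case: (sparse _ _); case: (small _);
      case: (small _) => //=.
  have : #|E|%:R <= (a * 4) * (n * n) :> rat.
    apply: (@le_trans _ _ ((eps + a + g + g) * (n * n))).
      by move: leE S1 S2 S4 S5; rewrite !mulrDl; clear; lra.
    by rewrite ler_pM2r ?mulr_gt0 //; move: epsg gE a0; clear; lra.
  move=> leE4; apply: (@le_trans _ _ (j%:R * (a * 4 * (n * n)))).
    by rewrite ler_pM2l ?ltr0n.
  by rewrite mulrA [j%:R * _]mulrC aj mul1r.
move=> [//|x0 s0]; set s := x0 :: s0 => ss ps; apply/negP => nbad.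
pose V i := cell c (c (nth x0 s i)).
have good i l : (i < l)%N -> (l <= k)%N -> ~~ bad (c (nth x0 s i)) (c (nth x0 s l)).
  move=> il lk; have [is_ ls] : (i < size s)%N /\ (l < size s)%N by rewrite ss;
    move: il lk; clear; lia.
  have /(pairwiseP x0)/(_ i l is_ ls il) := nbad.
  have /(pairwiseP x0)/(_ i l is_ ls il) := ps.
  by rewrite /= inE /= => ->.
have Vb i : (i <= k)%N -> g * #|T|%:R <= #|V i|%:R * M%:R.
  move=> ik; have [ik'|ki] := ltnP i k.
    by have := good i k ik' (leqnn _); rewrite !negb_or -!leNgt => /and4P[].
  (* The last vertex occurs only as the second one of a pair; (0, k) is such a pair because 0 <
     k. *)
  have -> : i = k by apply/eqP; rewrite eqn_leq ik.
  by have := good 0%N k k0 (leqnn _); rewrite !negb_or -!leNgt => /and4P[].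
have M0' : 0 < M%:R :> rat by rewrite ltr0n.
have V0 i : (i <= k)%N -> 0 < #|V i|%:R :> rat.
  by move=> /Vb; rewrite -(pmulr_lgt0 _ M0'); apply: lt_le_trans; rewrite mulr_gt0 .
have [i ik|i l il lk||s' [ss' ps' _]] := @embedding _ T e g eps k g01 eps0 V V 1.
- by split; rewrite ?subxx ?V0 ?mul1r.
- move=> S S' SV SV' S0 S'0 eS eS'; have := good i l il lk; rewrite !negb_or.
  move=> /and4P[/existsPn/(_ (S, S')) + + _ _];
    rewrite /irregular_witness /= SV SV' eS eS' /=.
  rewrite -!ltNge /sparse -leNgt => H da; apply: le_lt_trans H.
  by rewrite ler_pM2r ?natrM ?mulr_gt0 // /V; move: da epsg gE; clear; lra.
- by rewrite mul1r epsE exprS ler_piMl ?exprn_ge0 // ltW.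
rewrite mul1r leNgt => /negP; apply.
apply: (@le_lt_trans _ _ K%:R).
  rewrite ler_nat; apply: leq_trans (noK _ ss' ps'); apply: subset_leq_card.
  by apply/subsetP => x; rewrite !inE => /andP[].
rewrite -(ltr_pM2r M0') -mulrA; apply: (@lt_le_trans _ _ (g ^+ k * (g * #|T|%:R)));
  last first.
  by rewrite ler_pM2l ?exprn_gt0 // Vb.
rewrite mulrA -ltr_pdivrMl ?mulr_gt0 ?exprn_gt0  //.
apply: (@lt_le_trans _ _ (N%:R)); last by rewrite ler_nat.
rewrite /N -natr1; apply: ltr_wpDr => //; apply: le_lt_trans (archi_boundP _);
  last first.
  by rewrite divr_ge0 ?mulr_ge0 ?exprn_ge0  // ltW.
rewrite mulrC ler_pM2r ?invr_gt0 ?mulr_gt0 ?exprn_gt0  //.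
by rewrite ler_pM2r // ler_nat.
Qed.

End Removal.

(** * Zykov's theorem *)

(* The factors are the sizes of the parts of T(m, s). *)
Definition turan_number s m := \prod_(i < s) ((m + i) %/ s).

Definition balanced s (f : 'I_s -> nat) := forall i j, f i <= (f j).+1.

Lemma sum_parts s m : 0 < s -> \sum_(i < s) ((m + i) %/ s) = m.
Proof.
move=> s0; elim: m => [|m IH].
  by rewrite big1 // => i _; rewrite add0n divn_small.
case: s s0 IH => // s _ IH; rewrite big_ord_recr /=.
rewrite addSnnS divnDr // divnn /= addnC -[in RHS]IH.
rewrite [in RHS]big_ord_recl /= addn0 -addnA add1n addnC addSn; congr _.+1.
rewrite addnC; congr (_ + _).
by apply: eq_bigr => i _; rewrite /bump /= addnS addSn.
Qed.

Lemma balanced_parts s m : 0 < s -> balanced (fun i : 'I_s => (m + i) %/ s).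
Proof.
move=> s0 i j; have -> : ((m + j) %/ s).+1 = (m + j + s) %/ s by rewrite [in
  RHS]divnDr // divnn s0 addn1.
by apply: leq_div2r; rewrite -addnA leq_add2l (leq_trans (ltnW (ltn_ord i))) ?leq_addl.
Qed.

(** Exactly m %% s of the values are m %/ s + 1, the others m %/ s. With an arbitrary predicate [a]
    this determines the multiset of values. *)
Lemma balanced_count s (f : 'I_s -> nat) (a : pred nat) : 0 < s -> balanced f ->
  let m := \sum_i f i in
  count a [seq f i | i <- enum 'I_s] =
    (m %% s) * a (m %/ s).+1 + (s - m %% s) * a (m %/ s).
Proof.
move=> s0 bf m; pose i0 := [arg min_(i < Ordinal s0) f i].
have fi0 i : f i0 <= f i by rewrite /i0; case: arg_minnP => // i1 _ /(_ i isT).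
set q := f i0 in fi0; pose c := #|[pred i | f i == q.+1]|.
have fE i : f i = q + (f i == q.+1).
  have := fi0 i; have := bf i i0; rewrite -/q; case: eqP; lia.
have mE : m = q * s + c.
  rewrite /m (eq_bigr (fun i => q + (f i == q.+1))) => [|i _]; last exact: fE.
  by rewrite big_split /= sum_nat_const card_ord mulnC /c -sum1_card [in RHS]big_mkcond.
have cs : c < s.
  rewrite /c -[X in _ < X]card_ord; apply: proper_card; apply/properP; split;
    first exact/subsetP.
  by exists i0; rewrite // inE /= -/q; lia.
have -> : m %/ s = q by rewrite mE divnMDl // divn_small // addn0.
have -> : m %% s = c by rewrite mE modnMDl modn_small.
rewrite count_map -sum1_count big_mkcond /= big_enum /=.
rewrite (bigID (fun i => f i == q.+1)) /=; congr (_ + _).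
  rewrite /c -sum_nat_const; apply: eq_bigr => i /= /eqP->; by case: (a _).
have -> : s - c = #|[pred i | f i != q.+1]|.
  have := cardC [pred i | f i == q.+1]; rewrite card_ord -/c => cE.
  by rewrite -[X in X - _]cE addKn; apply: eq_card.
rewrite -sum_nat_const; apply: eq_bigr => i /= ni.
by rewrite fE (negPf ni) addn0; case: (a _).
Qed.

Lemma balanced_perm s (f g : 'I_s -> nat) : balanced f -> balanced g ->
  \sum_i f i = \sum_i g i ->
  perm_eq [seq f i | i <- enum 'I_s] [seq g i | i <- enum 'I_s].
Proof.
case: s f g => [|s] f g bf bg fg.
  have -> : enum 'I_0 = [::] by apply: size0nil; rewrite size_enum_ord.
  by [].
by apply/permP => a; rewrite !balanced_count //= fg.
Qed.

Lemma balanced_prod s (f : 'I_s -> nat) : 0 < s -> balanced f ->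
  \prod_i f i = turan_number s (\sum_i f i).
Proof.
move=> s0 bf; set m := \sum_i f i.
have := balanced_perm bf (balanced_parts m s0); rewrite sum_parts // => /(_ erefl) H.
rewrite /turan_number; transitivity (\prod_(x <- [seq f i | i <- enum 'I_s]) x).
  by rewrite big_map big_enum.
by rewrite (perm_big _ H) big_map big_enum.
Qed.

(** Moving a unit from f i to f j when f i > f j + 1 lowers the sum of squares and does not lower
    the product. The gain is strict only if the other factors are positive, hence the condition for
    equality. *)
Lemma leq_prod_turan s (f : 'I_s -> nat) : 0 < s ->
  \prod_i f i <= turan_number s (\sum_i f i) /\
  (\prod_i f i = turan_number s (\sum_i f i) -> 0 < \prod_i f i -> balanced f).
Proof.
move=> s0; have [k] := ubnP (\sum_i f i ^ 2); elim: k f => // k IH f fk.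
have [/'forall_forallP bf|] := boolP [forall i, forall j, f i <= (f j).+1].
  by split=> [|_ _]; rewrite ?balanced_prod.
rewrite negb_forall => /existsP[i]; rewrite negb_forall => /existsP[j];
  rewrite -ltnNge => fij.
have ij : j != i by apply: contraTneq fij => ->; lia.
pose g := [fun x => f x with i |-> (f i).-1, j |-> (f j).+1].
have gi : g i = (f i).-1 by rewrite /= eqxx.
have gj : g j = (f j).+1 by rewrite /= (negPf ij) eqxx.
have gx x : (x != i) && (x != j) -> g x = f x by move=> /andP[/negPf xi /negPf xj];
  rewrite /= xi xj.
have dec (F : nat -> nat) : \sum_x F (f x) = F (f i) + (F (f j) + \sum_(x | (x != i)
  && (x != j)) F (f x)).
  by rewrite (bigD1 i) //= (bigD1 j).
have decg (F : nat -> nat) : \sum_x F (g x) = F (f i).-1 + (F (f j).+1 + \sum_(x | (x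
  != i) && (x != j)) F (f x)).
  rewrite (bigD1 i) // (bigD1 j) //= -/(g i) -/(g j) gi gj; do 2!congr (_ + _).
  by apply: eq_bigr => x /gx /= ->.
have [|le_g _] := IH g.
  move: fk; rewrite (dec (fun x => x ^ 2)) (decg (fun x => x ^ 2)); nia.
have sg : \sum_x g x = \sum_x f x by rewrite (dec id) (decg id); lia.
have pf : \prod_x f x = f i * (f j * \prod_(x | (x != i) && (x != j)) f x).
  by rewrite (bigD1 i) //= (bigD1 j).
have pg : \prod_x g x = (f i).-1 * ((f j).+1 * \prod_(x | (x != i) && (x != j)) f x).
  rewrite (bigD1 i) // (bigD1 j) //= -/(g i) -/(g j) gi gj; do 2!congr (_ * _).
  by apply: eq_bigr => x /gx /= ->.
move: le_g; rewrite sg pf pg; set P := \prod_(x | _) _; rewrite !mulnA.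
have key : f i * f j < (f i).-1 * (f j).+1.
  by move: fij; case: (f i) => [|a] //=; rewrite mulSn mulnS; lia.
move=> le_g; split; first by apply: leq_trans le_g; rewrite leq_mul2r ltnW ?orbT.
move=> E P0; exfalso; move: le_g; rewrite -E leqNgt ltn_mul2r key andbT.
by move: P0; rewrite muln_gt0 => /andP[_ ->].
Qed.

Lemma turan_number_ge s m : (m %/ s) ^ s <= turan_number s m.
Proof.
rewrite /turan_number -[X in _ ^ X]card_ord -prod_nat_const.
by apply: leq_prod => i _; apply: leq_div2r; apply: leq_addr.
Qed.

Lemma turan_number_le s m : turan_number s m <= (m %/ s).+1 ^ s.
Proof.
rewrite /turan_number -[X in _ <= _ ^ X]card_ord -prod_nat_const.
apply: leq_prod => i _; have s0 : 0 < s by case: s i => [[]|].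
apply: (@leq_trans ((m + s) %/ s)); first by apply: leq_div2r; rewrite leq_add2l ltnW.
by rewrite divnDr // divnn s0 addn1.
Qed.

(** The new vertex enlarges a smallest part, whose size is m %/ s. *)
Lemma turan_numberS s m : 0 < s ->
  turan_number s m.+1 * (m %/ s) = turan_number s m * (m %/ s).+1.
Proof.
case: s => // s _; rewrite /turan_number [in LHS]big_ord_recr [in RHS]big_ord_recl /=.
rewrite addn0 addSnnS divnDr // divnn /= addn1 -mulnA mulnC [RHS]mulnAC.
rewrite [_.+1 * _]mulnC; congr (_ * _).
by apply: eq_bigr => i _; rewrite /bump /= addnS addSn.
Qed.

Lemma turan_number_eq0 s m : 0 < s -> m %/ s = 0 -> turan_number s m = 0.
Proof.
by case: s => // s _ m0; rewrite /turan_number big_ord_recl /= addn0 m0.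
Qed.

(** With q = m %/ s, one more vertex multiplies the number by (q + 1) / q, which is at least (m + 1)
    / m because q <= m. *)
Lemma turan_number_ratio s p m : 0 < s -> p <= m ->
  turan_number s p * m <= turan_number s m * p.
Proof.
move=> s0; elim: m => [|m IH]; first by rewrite leqn0 => /eqP->.
rewrite leq_eqVlt => /predU1P[->//|pm]; have {}IH := IH pm.
have [q0|q0] := posnP (m %/ s).
  by rewrite turan_number_eq0 //; apply/eqP; rewrite -leqn0 -q0 leq_div2r.
have := turan_numberS m s0; have := leq_trunc_div m s.
set q := m %/ s in q0 *; move: IH; set a := turan_number s p;
  set b := turan_number s m; set c := turan_number s m.+1.
move=> IH qm E.
have qm' : q <= m by apply: leq_trans qm; rewrite leq_pmulr.
have m0 : 0 < m by apply: leq_trans qm'.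
rewrite -(leq_pmul2r q0) -(leq_pmul2r m0).
apply: (@leq_trans (b * p * m.+1 * q)).
  by rewrite mulnAC [a * m.+1 * m]mulnAC; do 2!apply: leq_mul => //.
rewrite [c * p * q]mulnAC E.
rewrite -!mulnA leq_mul2l; apply/orP; right; rewrite [leqRHS]mulnCA leq_mul2l;
  apply/orP; right.
by rewrite !mulSn [m * q]mulnC leq_add2r.
Qed.

(** * Counting cliques of a given size *)

Section Cliques.
Variables (T : finType) (e : rel T).
Hypotheses (e_sym : symmetric e) (e_irr : irreflexive e).
Implicit Types (V W S : {set T}).

Definition clique S := [forall x in S, forall y in S, (x != y) ==> e x y].

Definition ksets k V := [set S : {set T} | [&& S \subset V, #|S| == k & clique S]].

Definition nbhd V w := [set x in V | e w x].

Lemma cliqueP S : reflect {in S &, forall x y, x != y -> e x y} (clique S).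
Proof.
apply: (iffP forall_inP) => [H x y xS yS|H x xS].
  by have /forall_inP/(_ _ yS)/implyP := H x xS.
by apply/forall_inP => y yS; apply/implyP; apply: H.
Qed.

Lemma cliqueS S S' : S' \subset S -> clique S -> clique S'.
Proof.
by move=> /subsetP s /cliqueP c; apply/cliqueP => x y /s xS /s yS; apply: c.
Qed.

Lemma ksetsP k V S : reflect [/\ S \subset V, #|S| = k & clique S] (S \in ksets k V).
Proof. by rewrite inE; apply: (iffP and3P) => -[? /eqP ? ?]. Qed.

Lemma clique_setU1 S w : clique S -> {in S, forall x, e w x} -> clique (w |: S).
Proof.
move=> /cliqueP c wS; apply/cliqueP => x y /setU1P[->|xS] /setU1P[->|yS] xy.
- by rewrite eqxx in xy.
- exact: wS.
- by rewrite e_sym wS.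
- exact: c.
Qed.

Lemma ksets_setU1 k V S w : w \in V -> S \in ksets k (nbhd V w) -> w |: S \in ksets
  k.+1 V.
Proof.
move=> wV /ksetsP[SN Sk Sc]; have NV : nbhd V w \subset V by apply/subsetP => x;
  rewrite inE => /andP[].
have wS : w \notin S by apply/negP => /(subsetP SN); rewrite inE e_irr andbF.
apply/ksetsP; rewrite subUset sub1set wV (subset_trans SN) // cardsU1 wS Sk; split=> //.
by apply: clique_setU1 => // x /(subsetP SN); rewrite inE => /andP[].
Qed.

Lemma card_ksets_mem k V w : w \in V ->
  #|[set S in ksets k.+1 V | w \in S]| = #|ksets k (nbhd V w)|.
Proof.
move=> wV; have NW S : S \in ksets k (nbhd V w) -> w \notin S.
  by move=> /ksetsP[SN _ _]; apply/negP => /(subsetP SN); rewrite inE e_irr andbF.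
have <- : #|(fun S => w |: S) @: ksets k (nbhd V w)| = #|ksets k (nbhd V w)|.
  apply: card_in_imset => S S' SK S'K /(congr1 (fun A => A :\ w)).
  by rewrite !setU1K ?NW.
congr #|pred_of_set _|; apply/setP => S; apply/idP/imsetP => [|[S' S'K ->]].
  rewrite inE => /andP[/ksetsP[SV Sk Sc] wS]; exists (S :\ w); last by rewrite setD1K.
  apply/ksetsP; split.
  - apply/subsetP => x; rewrite !inE => /andP[xw xS].
    by rewrite (subsetP SV) //= (cliqueP _ Sc) // eq_sym.
  - by apply/eqP; rewrite -eqSS -Sk (cardsD1 w S) wS.
  - by apply: cliqueS Sc; apply: subD1set.
by rewrite inE ksets_setU1 // setU11.
Qed.

Lemma sum_ksets_nbhd k V W : W \subset V ->
  \sum_(w in W) #|ksets k (nbhd V w)| = \sum_(S in ksets k.+1 V) #|S :&: W|.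
Proof.
move=> WV; rewrite (eq_bigr (fun w => \sum_(S in ksets k.+1 V | w \in S) 1)) => [|w
  wW]; last first.
  rewrite -card_ksets_mem ?(subsetP WV) // -sum1_card.
  by apply: eq_bigl => S; rewrite inE.
rewrite (exchange_big_dep (mem (ksets k.+1 V))) /=; last by move=> w S _ /andP[].
apply: eq_bigr => S SK; rewrite -sum1_card; apply: eq_bigl => w.
by rewrite in_setI SK /= andbC.
Qed.

Lemma clique_colour_onto k V S (c : T -> nat) : {in V, forall x, c x < k} ->
  {in V &, forall x y, e x y = (c x != c y)} -> S \in ksets k V ->
  forall i, i < k -> exists2 y, y \in S & c y = i.
Proof.
move=> ck cE /ksetsP[SV Sk /cliqueP Sc] i ik.
have u : uniq [seq c x | x <- enum S].
  rewrite map_inj_in_uniq ?enum_uniq // => x y; rewrite !mem_enum => xS yS cxy.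
  by apply/eqP; apply: contraT => /(Sc _ _ xS yS); rewrite cE ?(subsetP SV) // cxy eqxx.
have sub : {subset [seq c x | x <- enum S] <= iota 0 k}.
  by move=> j /mapP[x]; rewrite mem_enum mem_iota => /(subsetP SV) xV ->; apply: ck.
have [|_ E] := uniq_min_size u sub; first by rewrite size_map -cardE size_iota Sk.
have : i \in [seq c x | x <- enum S] by rewrite E mem_iota.
by case/mapP => y; rewrite mem_enum => yS ->; exists y.
Qed.

(** A clique with as many vertices as there are colours has exactly one vertex in the last class W,
    and V :\: W is the neighbourhood of each vertex of W. *)
Lemma card_ksets_multipartite k V (c : T -> nat) : {in V, forall x, c x < k} ->
  {in V &, forall x y, e x y = (c x != c y)} ->
  #|ksets k V| = \prod_(i < k) #|[set x in V | c x == i]|.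
Proof.
elim: k V => [|k IH] V ck cE.
  rewrite big_ord0 -(cards1 (set0 : {set T})); congr #|pred_of_set _|; apply/setP => S.
  rewrite !inE; apply/and3P/eqP => [[_ /eqP/cards0_eq]|->] //.
  by rewrite sub0set cards0; split=> //; apply/cliqueP => x y; rewrite inE.
pose W := [set x in V | c x == k]; have WV : W \subset V by apply/subsetP => x;
  rewrite inE => /andP[].
have nbE w : w \in W -> nbhd V w = V :\: W.
  rewrite inE => /andP[wV /eqP cw]; apply/setP => x; rewrite !inE.
  by case: (boolP (x \in V)) => //= xV; rewrite cE // cw eq_sym andbT.
have VW : V :\: W \subset V by apply: subsetDl.
rewrite big_ord_recr /= mulnC -/W -sum_nat_const.
transitivity (\sum_(w in W) #|ksets k (nbhd V w)|).
  rewrite sum_ksets_nbhd // -sum1_card; apply: eq_bigr => S SK.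
  have [y yS cy] := clique_colour_onto ck cE SK (ltnSn k).
  apply/esym/eqP/cards1P; exists y; apply/setP => x; rewrite !inE.
  have [SV _ /cliqueP Sc] := ksetsP _ _ _ SK.
  apply/andP/eqP => [[xS /andP[xV /eqP cx]]|->];
    last by rewrite yS (subsetP SV) // cy eqxx.
  by apply/eqP; apply: contraT => /(Sc _ _ xS yS);
    rewrite cE ?(subsetP SV) // cx cy eqxx.
apply: eq_bigr => w wW; rewrite nbE // IH => [|x|x y].
- apply: eq_bigr => i _; congr #|pred_of_set _|; apply/setP => x; rewrite !inE.
  case: (boolP (x \in V)) => //= xV; rewrite ?andbF //= andbT.
  by have [->|_] := eqVneq (c x) i; rewrite ?andbF ?(ltn_eqF (ltn_ord i)).
- rewrite !inE => /andP[+ xV]; rewrite xV /= => ck'.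
  by have := ck _ xV; rewrite ltnS leq_eqVlt (negPf ck').
by move=> /(subsetP VW) xV /(subsetP VW) yV; apply: cE.
Qed.

End Cliques.

Section Zykov.
Variables (T : finType) (e : rel T).
Hypotheses (e_sym : symmetric e) (e_irr : irreflexive e).
Implicit Types (V W S : {set T}).

Lemma ksets1_eq0 V : ksets e 1 V = set0 -> V = set0.
Proof.
move=> K0; apply/setP => x; rewrite inE; apply/negP => xV.
have : [set x] \in ksets e 1 V.
  apply/ksetsP; rewrite sub1set xV cards1; split=> //; apply/cliqueP => y z.
  by rewrite !inE => /eqP-> /eqP->; rewrite eqxx.
by rewrite K0 inE.
Qed.

(** A part of size a is put in front of the parts of T(m, k); for k = 0 there is no part to hold m
    vertices. *)
Lemma turan_number_split k (a m : nat) : (k = 0 -> m = 0) ->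
  a * turan_number k m <= turan_number k.+1 (a + m).
Proof.
move=> km; pose f (i : 'I_k.+1) := if unlift ord0 i is Some j then (m + j) %/ k else a.
have [+ _] := leq_prod_turan f isT.
rewrite !big_ord_recl {1 3}/f unlift_none.
have E (j : 'I_k) : f (lift ord0 j) = (m + j) %/ k by rewrite /f liftK.
rewrite (eq_bigr (fun j : 'I_k => (m + j) %/ k)) => [|j _]; last exact: E.
rewrite [in X in _ <= X](eq_bigr (fun j : 'I_k => (m + j) %/ k)) => [|j _];
  last exact: E.
suff -> : \sum_(j < k) (m + j) %/ k = m by [].
by case: k km {f E} => [/(_ erefl)->|k _]; rewrite ?big_ord0 // sum_parts.
Qed.

(* Take v in the largest number of s-cliques with its neighbours N. Every
   (s + 1)-clique meets V :\: N, so there are at most |V :\: N| times as many of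
   them as s-cliques in N. If equality holds, V :\: N is an independent set whose
   vertices are all joined to N. *)
Lemma zykov s V : ksets e s.+1 V = set0 ->
  #|ksets e s V| <= turan_number s #|V| /\
  (#|ksets e s V| = turan_number s #|V| -> 0 < turan_number s #|V| ->
   exists2 c : T -> nat, {in V, forall x, c x < s} &
     {in V &, forall x y, e x y = (c x != c y)}).
Proof.
elim: s V => [|s IH] V K0.
  rewrite (ksets1_eq0 K0); split=> [|_ _]; last by exists (fun=> 0) => [x|x y];
    rewrite inE.
  rewrite /turan_number big_ord0 -(cards1 (set0 : {set T})).
  by apply: subset_leq_card; apply/subsetP => S /ksetsP[]; rewrite subset0 !inE.
have [V0|[v0 v0V]] := set_0Vmem V.
  rewrite V0 cards0 /turan_number [X in _ <= X]big_ord_recl [X in _ = X ->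
    _]big_ord_recl.
  rewrite [X in 0 < X]big_ord_recl /= add0n div0n !mul0n; split=> //.
  rewrite leqn0 cards_eq0; apply/eqP/setP => S; rewrite [RHS]inE;
    apply/negP => /ksetsP[].
  by rewrite subset0 => /eqP->; rewrite cards0.
pose d w := #|ksets e s (nbhd e V w)|.
have [v vV dmax] : exists2 v, v \in V & forall w, w \in V -> d w <= d v.
  pose v := [arg max_(w > v0 | w \in V) d w].
  by exists v; rewrite /v; case: arg_maxnP.
set N := nbhd e V v in vV *; have NV : N \subset V by apply/subsetP => x;
  rewrite inE => /andP[].
have KN0 : ksets e s.+1 N = set0.
  apply/setP => S; rewrite [RHS]inE; apply/negP => SK.
  by have := ksets_setU1 e_sym e_irr vV SK; rewrite K0 inE.
have vN : v \notin N by rewrite inE e_irr andbF.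
pose W := V :\: N; have WV : W \subset V by apply: subsetDl.
have vW : v \in W by rewrite in_setD vN.
have cVWN : #|V| = #|W| + #|N| by rewrite cardsD (setIidPr NV) subnK // subset_leq_card.
have meet S : S \in ksets e s.+1 V -> 0 < #|S :&: W|.
  move=> SK; rewrite card_gt0; apply/set0Pn; have [SV Sk Sc] := ksetsP _ _ _ _ SK.
  have /subsetPn[x xS xN] : ~~ (S \subset N).
    apply/negP => SN; have : S \in ksets e s.+1 N by apply/ksetsP.
    by rewrite KN0 inE.
  by exists x; rewrite in_setI in_setD xS xN (subsetP SV).
have [dN IHeq] := IH N KN0.
have le1 : #|ksets e s.+1 V| <= \sum_(w in W) d w.
  rewrite (sum_ksets_nbhd e_sym e_irr) // -sum1_card; apply: leq_sum => S; exact: meet.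
have le2 : \sum_(w in W) d w <= #|W| * d v.
  by rewrite -sum_nat_const; apply: leq_sum => w /(subsetP WV)/dmax.
have le3 : #|W| * d v <= #|W| * turan_number s #|N| by rewrite leq_mul2l dN orbT.
have le4 : #|W| * turan_number s #|N| <= turan_number s.+1 #|V|.
  rewrite cVWN; apply: turan_number_split => s0; apply/eqP; rewrite cards_eq0;
    apply/eqP.
  by apply: ksets1_eq0; rewrite -s0.
split=> [|E t0]; first exact: leq_trans le1 (leq_trans le2 (leq_trans le3 le4)).
have e34 : #|W| * d v = #|W| * turan_number s #|N|.
  by apply/eqP; rewrite eqn_leq le3 (leq_trans le4) // -E (leq_trans le1).
have W0 : 0 < #|W| by rewrite card_gt0; apply/set0Pn; exists v.
have {e34}dvE : d v = turan_number s #|N|.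
  by apply/eqP; rewrite -(eqn_pmul2l W0) e34.
have tN0 : 0 < turan_number s #|N|.
  rewrite lt0n; apply: contraTneq t0 => tN; rewrite -E -leqNgt.
  by apply: leq_trans le1 (leq_trans le2 _); rewrite dvE tN muln0.
have [c cs cE] := IHeq dvE tN0.
have s12 : \sum_(S in ksets e s.+1 V) #|S :&: W| = #|ksets e s.+1 V|.
  rewrite -(sum_ksets_nbhd e_sym e_irr s WV); apply/eqP; rewrite eqn_leq le1 andbT.
  by rewrite E (leq_trans le2) // (leq_trans le3).
have one S : S \in ksets e s.+1 V -> #|S :&: W| = 1.
  move=> SK; apply/eqP; rewrite eqn_leq meet // andbT leqNgt; apply/negP => gt1.
  suff : #|ksets e s.+1 V| < \sum_(S in ksets e s.+1 V) #|S :&: W| by rewrite s12 ltnn.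
  rewrite -sum1_card (bigD1 S) //= [X in _ < X](bigD1 S) //= -addSn leq_add //.
  by apply: leq_sum => S' /andP[/meet].
have dE w : w \in W -> d w = d v.
  move=> wW; apply/eqP; rewrite eqn_leq dmax ?(subsetP WV) //= leqNgt;
    apply/negP => lt_d.
  have : \sum_(w in W) d w < #|W| * d v.
    rewrite -sum_nat_const (bigD1 w) //= [X in _ < X](bigD1 w) //= -addSn leq_add //.
    by apply: leq_sum => w' /andP[/(subsetP WV)/dmax].
  by apply/negP; rewrite -leqNgt dvE (leq_trans le4) // -E.
(* The two families have equal size. A vertex of S outside N would, besides w, be a second vertex of
   W in the clique w |: S, against [one]. *)
have KE w : w \in W -> ksets e s (nbhd e V w) = ksets e s N.
  move=> wW; apply/eqP; rewrite eqEcard -/(d w) dE // leqnn andbT.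
  have wV := subsetP WV _ wW.
  apply/subsetP => S SK; have [Sw Sk Sc] := ksetsP _ _ _ _ SK.
  apply/ksetsP; split=> //; apply/subsetP => x xS; apply: contraT => xN.
  have := one _ (ksets_setU1 e_sym e_irr wV SK).
  have := subsetP Sw _ xS; rewrite inE => /andP[xV ewx] /eqP/cards1P[z zE].
  have : x \in [set z] by rewrite -zE in_setI setU1r // in_setD xN xV.
  have : w \in [set z] by rewrite -zE in_setI setU11 wW.
  by rewrite !inE => /eqP wz /eqP xz; rewrite wz xz e_irr in ewx.
have [S0 S0K] : exists S0, S0 \in ksets e s N.
  by apply/set0Pn; rewrite -card_gt0 -/(d v) dvE.
(* Exchanging in S0 the vertex y of the colour of x for x gives an s-clique of N, which by [KE] lies
   in the neighbourhood of w. *)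
have eWN w x : w \in W -> x \in N -> e w x.
  move=> wW xN; have [y yS cyx] := clique_colour_onto cs cE S0K (cs _ xN).
  have [S0N S0k /cliqueP S0c] := ksetsP _ _ _ _ S0K.
  have : x |: (S0 :\ y) \in ksets e s N.
    have xS : x \notin S0 :\ y.
      rewrite !inE negb_and negbK; case: (boolP (x \in S0)) => [xS|];
        rewrite ?orbT // orbF.
      by apply: contraT => /(S0c _ _ xS yS); rewrite cE ?(subsetP S0N _ yS) // cyx eqxx.
    apply/ksetsP; split.
    - by rewrite subUset sub1set xN (subset_trans (subD1set _ _)).
    - by rewrite cardsU1 xS -S0k (cardsD1 y S0) yS.
    apply: (clique_setU1 e_sym); first by apply: (cliqueS (subD1set _ y));
      apply/cliqueP.
    move=> z; rewrite !inE => /andP[zy zS]; have zN := subsetP S0N _ zS.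
    have yN := subsetP S0N _ yS.
    by have := S0c _ _ zS yS zy; rewrite !cE // cyx eq_sym.
  rewrite -(KE w wW) => /ksetsP[/subsetP/(_ x)];
    rewrite setU11 inE => /(_ isT)/andP[_ ->] //.
(* Two adjacent vertices of W would extend S0 to a clique with s + 2 vertices. *)
have eWW w w' : w \in W -> w' \in W -> e w w' = false.
  move=> wW w'W; apply/negP => eww'.
  have S0w : S0 \in ksets e s (nbhd e (nbhd e V w) w').
    have [S0N S0k S0c] := ksetsP _ _ _ _ S0K; apply/ksetsP; split=> //.
    apply/subsetP => x /(subsetP S0N) xN; rewrite !inE (subsetP NV) //.
    by rewrite !eWN.
  have w'V : w' \in nbhd e V w by rewrite inE (subsetP WV).
  have := ksets_setU1 e_sym e_irr (subsetP WV _ wW) (ksets_setU1 e_sym e_irr w'V S0w).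
  by rewrite K0 inE.
exists (fun x => if x \in N then c x else s) => [x xV|x y xV yV].
  by case: ifP => // /cs /ltnW.
have inW z : z \in V -> z \notin N -> z \in W by move=> zV zN; rewrite in_setD zN.
case: (boolP (x \in N)) (boolP (y \in N)) => [xN|xN] [yN|yN].
- exact: cE.
- by rewrite e_sym eWN ?inW // ltn_eqF // cs.
- by rewrite eWN ?inW // gtn_eqF // cs.
- by rewrite eWW ?inW // eqxx.
Qed.

End Zykov.

(** * Sizes not in arithmetic progression *)

Section Atoms.
Variables (T : finType) (e : rel T).
Hypotheses (e_sym : symmetric e).
Variables (r l1 l2 : nat) (L : seq nat) (F : {set {set T}}) (C : {set T}).
Hypotheses (sL : sorted ltn (rcons [:: l1, l2 & L] r)).
Hypotheses (F_uni : uniform r F) (F_int : set_intersecting [:: l1, l2 & L] F).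
Hypotheses (F_clique : {in F, forall A, clique e A}).
Hypotheses (fC : flat r F C) (Cl : #|C| = l1).
Implicit Types (A X Y : {set T}) (s : seq T).

Definition is_atom X := flat r F X && (#|X| == l2).

Definition atom_of x := odflt set0 [pick X | is_atom X && (x \in X)].

(** Points of C are excluded because they lie in every atom. *)
Definition has_atom x := [&& x \notin C, is_atom (atom_of x) & x \in atom_of x].

Lemma sizes_lt : [/\ l1 < l2, l2 < r & forall l, l \in L -> l2 < l].
Proof.
move: sL => /= /andP[-> /(order_path_min ltn_trans)/allP H]; split=> // [|l lL];
  apply: H.
  by rewrite mem_rcons mem_head.
by rewrite mem_rcons inE lL orbT.
Qed.

Lemma sizesP l : l \in r :: [:: l1, l2 & L] -> l1 <= l /\ (l1 < l -> l2 <= l).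
Proof.
have [l12 l2r H] := sizes_lt; rewrite !inE => /or4P[/eqP->|/eqP->|/eqP->|/H];
  split=> //; lia.
Qed.

Lemma core_sub X : flat r F X -> C \subset X.
Proof.
move=> fX; apply: (flat_subset F_uni F_int fC fX (sub0set _) (sub0set _)) => l
  /sizesP[].
by rewrite Cl.
Qed.

Lemma core_subF A : A \in F -> C \subset A.
Proof. by move=> AF; apply: core_sub; apply: mem_flat. Qed.

Lemma atom_min X Y x : is_atom X -> flat r F Y -> x \in X -> x \in Y -> x \notin C ->
  X \subset Y.
Proof.
move=> /andP[fX /eqP Xl] fY xX xY xC.
apply: (@flat_subset _ _ _ _ _ _ (x |: C) F_uni F_int fX fY);
  rewrite ?subUset ?sub1set ?xX ?xY ?core_sub //.
by move=> l /sizesP[_ H]; rewrite cardsU1 xC Cl Xl; apply: H.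
Qed.

Lemma atom_uniq X Y x : is_atom X -> is_atom Y -> x \in X -> x \in Y -> x \notin C ->
  X = Y.
Proof.
move=> aX aY xX xY xC; have [/andP[fX _] /andP[fY _]] := (aX, aY).
by apply/eqP; rewrite eqEsubset !(atom_min (x := x)).
Qed.

Lemma atom_ofE X x : is_atom X -> x \in X -> x \notin C -> atom_of x = X.
Proof.
move=> aX xX xC; rewrite /atom_of; case: pickP => [Y /andP[aY xY]|/(_ X)];
  last by rewrite aX xX.
exact: atom_uniq xC.
Qed.

Lemma has_atomI X x : is_atom X -> x \in X -> x \notin C -> has_atom x.
Proof. by move=> aX xX xC; rewrite /has_atom (atom_ofE aX) ?xC ?aX. Qed.

Lemma atom_cap X Y : is_atom X -> is_atom Y -> X != Y -> X :&: Y = C.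
Proof.
move=> aX aY XY; have [/andP[fX _] /andP[fY _]] := (aX, aY).
apply/eqP; rewrite eqEsubset subsetI !core_sub // !andbT.
apply: contraR XY => H; have [x] := subsetPn H.
by rewrite inE => /andP[xX xY] xC; rewrite (atom_uniq aX aY xX xY xC).
Qed.

Lemma atom_clique X : is_atom X -> clique e X.
Proof. by move=> /andP[/flat_sub[A AF XA] _]; apply: cliqueS XA (F_clique AF). Qed.

Lemma cliqueU X Y : clique e X -> clique e Y ->
  {in X & Y, forall x y, x != y -> e x y} -> clique e (X :|: Y).
Proof.
move=> /cliqueP cX /cliqueP cY cXY; apply/cliqueP => x y /setUP[xX|xY] /setUP[yX|yY] xy.
- exact: cX.
- exact: cXY.
- by rewrite e_sym cXY // eq_sym.
- exact: cY.
Qed.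

(** A relation between vertices rather than atoms, so that the removal lemma measures the deleted
    pairs against #|T|^2. *)
Definition atom_rel x y := [&& has_atom x, has_atom y, atom_of x != atom_of y &
  clique e (atom_of x :|: atom_of y)].

Lemma atom_rel_sym : symmetric atom_rel.
Proof. by move=> x y; rewrite /atom_rel eq_sym setUC andbCA. Qed.

Definition atom_span s := foldr (fun x X => atom_of x :|: X) C s.

Lemma mem_span s x : x \in s -> atom_of x \subset atom_span s.
Proof.
elim: s => //= y s IH; rewrite inE => /predU1P[->|/IH H]; first exact: subsetUl.
by apply: subset_trans H _; apply: subsetUr.
Qed.

Lemma core_span s : C \subset atom_span s.
Proof. by elim: s => //= y s IH; apply: subset_trans IH _; apply: subsetUr. Qed.

Lemma spanP s v : v \in atom_span s -> (v \in C) || has (fun x => v \in atom_of x) s.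
Proof.
by elim: s => [|x s IH] /=; rewrite ?orbF // inE => /orP[->|/IH/orP[]->]; rewrite ?orbT.
Qed.

Lemma span_sub s A : A \in F -> all has_atom s -> all (mem A) s -> atom_span s \subset
  A.
Proof.
move=> AF; elim: s => [|x s IH] /=; first by rewrite core_subF.
move=> /andP[/and3P[xC ax xx] sa] /andP[xA sA]; rewrite subUset IH // andbT.
by apply: (atom_min ax (mem_flat r AF) xx).
Qed.

(** Distinct atoms meet exactly in C, so each atom adds l2 - l1 new vertices. *)
Lemma span_card s : all has_atom s -> pairwise atom_rel s ->
  #|atom_span s| = l1 + size s * (l2 - l1) /\ clique e (atom_span s).
Proof.
elim: s => [|x s IH] /=.
  by rewrite Cl addn0; have [A AF CA] := flat_sub fC; rewrite (cliqueS CA) // F_clique.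
move=> /andP[xa sa] /andP[xs ps]; have [cs ks] := IH sa ps.
have [xC ax xx] := and3P xa; have /andP[fx /eqP xl] := ax.
have capE : atom_of x :&: atom_span s = C.
  apply/eqP; rewrite eqEsubset subsetI core_sub // core_span /= andbT.
  apply/subsetP => v /setIP[vx /spanP/orP[//|/hasP[y ys vy]]].
  have /and4P[_ /and3P[_ ay _] xy _] := allP xs _ ys.
  by rewrite -(atom_cap ax ay xy) inE vx.
have [l12 _ _] := sizes_lt; split.
  rewrite cardsU capE xl cs Cl mulSn; move: (size s * _) => m.
  by rewrite addnCA addKn addnA subnKC // ltnW.
apply: cliqueU => // [|u v ux /spanP/orP[vC|/hasP[y ys vy]] uv];
  first exact: atom_clique.
  by apply: (cliqueP _ _ (atom_clique ax)) => //; apply: subsetP vC; apply: core_sub.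
have /and4P[_ _ _ /cliqueP kxy] := allP xs _ ys.
by apply: kxy; rewrite // inE ?ux ?vy ?orbT.
Qed.

Definition atomic A := (A \in F) && [forall x in A :\: C, has_atom x].

Lemma atomicP A x : atomic A -> x \in A -> x \notin C ->
  has_atom x /\ atom_of x \subset A.
Proof.
move=> /andP[AF /forall_inP H] xA xC; have xa : has_atom x by apply: H; rewrite inE xC.
split=> //; have /and3P[_ ax xx] := xa; exact: atom_min ax (mem_flat r AF) xx xA xC.
Qed.

Lemma atomic_seq_step A s : atomic A -> all has_atom s -> all (mem A) s ->
  pairwise atom_rel s -> #|atom_span s| < r ->
  exists x, [/\ has_atom x, x \in A, all (atom_rel x) s & x \notin atom_span s].
Proof.
move=> aA sa sA ps sr; have AF : A \in F by case/andP: aA.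
have /subsetPn[x xA xs] : ~~ (A \subset atom_span s).
  by apply: contraL sr => /subset_leq_card; rewrite (uniformP _ _ F_uni) // -leqNgt.
have xC : x \notin C by apply: contra xs => /(subsetP (core_span s)).
have [xa xsA] := atomicP aA xA xC; have /and3P[_ ax xx] := xa.
exists x; split=> //; apply/allP => y ys; have ya := allP sa _ ys.
have /and3P[yC ay yy] := ya; rewrite /atom_rel xa ya /=; apply/andP; split.
  by apply: contra xs => /eqP E; apply: (subsetP (mem_span ys)); rewrite -E.
apply: cliqueS (F_clique AF); rewrite subUset xsA /=.
by have [] := atomicP aA (allP sA _ ys) yC.
Qed.

Lemma atomic_seq A n : atomic A -> l1 + n * (l2 - l1) <= r ->
  exists s, [/\ size s = n, all has_atom s, all (mem A) s & pairwise atom_rel s].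
Proof.
move=> aA; have [l12 _ _] := sizes_lt; elim: n => [|n IH] nr; first by exists [::].
have [|s [ss sa sA ps]] := IH; first by apply: leq_trans nr;
  rewrite leq_add2l mulSn leq_addl.
have [cs _] := span_card sa ps.
have [|x [xa xA xs _]] := atomic_seq_step aA sa sA ps.
  by rewrite cs ss; move: nr; rewrite mulSn; move: (n * _) => m nr; clear -l12 nr; lia.
by exists (x :: s); rewrite /= ss xa sa xA sA xs ps.
Qed.

(** As many atoms as fit by size exhaust A: the atom of an uncovered vertex would be one more atom
    inside A. *)
Lemma atomic_dvd A : atomic A -> r = l1 + (r - l1) %/ (l2 - l1) * (l2 - l1).
Proof.
move=> aA; have [l12 l2r _] := sizes_lt; set a := l2 - l1; set k := (r - l1) %/ a.
have a0 : 0 < a by rewrite subn_gt0.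
have kr : l1 + k * a <= r.
  by rewrite -(subnKC (ltnW (ltn_trans l12 l2r))) leq_add2l leq_trunc_div.
have [s [ss sa sA ps]] := atomic_seq aA kr.
have [cs _] := span_card sa ps; rewrite ss -/a in cs.
apply/eqP; rewrite eqn_leq kr andbT -cs leqNgt; apply/negP => lt.
have [x [xa xA xs xns]] := atomic_seq_step aA sa sA ps lt.
have : #|atom_span (x :: s)| <= r.
  rewrite -(uniformP _ _ F_uni A) ?subset_leq_card //; last by case/andP: aA.
  by apply: span_sub; rewrite /= ?xa ?xA //; case/andP: aA.
have xsa : all has_atom (x :: s) by rewrite /= xa.
have xsp : pairwise atom_rel (x :: s) by rewrite /= xs.
have [-> _] := span_card xsa xsp; rewrite /= ss -/a => H.
have := ltn_ceil (r - l1) a0; rewrite -/k ltnNge => /negP; apply.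
by rewrite -(leq_add2l l1) subnKC // (leq_trans (leq_addr _ _) H).
Qed.

End Atoms.

Lemma ksets_uniform (T : finType) (e : rel T) r V : uniform r (ksets e r V).
Proof. by apply/uniformP => A /ksetsP[]. Qed.

Lemma star_ksets_clique (T : finType) (e : rel T) r V Z :
  {in star (ksets e r V) Z, forall A, clique e A}.
Proof. by move=> A; rewrite mem_star => /andP[/ksetsP[]]. Qed.

(* Almost every member A is the union of the core and of k >= 3 atoms, and two
   of these atoms determine A. So the graph atom_rel has no (k - 1)-clique with
   many common neighbours, and its k-cliques can be destroyed by deleting few
   edges, each of which destroys a single member. *)
Lemma two_sizes_little r l1 l2 j : l1 < l2 -> l2 < r -> r - l2 != l2 - l1 -> 0 < j ->
  exists N : nat, forall (T : finType) (e : rel T) (Z : {set T}),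
    symmetric e ->
    set_intersecting [:: l1; l2] (star (ksets e r setT) Z) -> N <= #|T| ->
    j * #|star (ksets e r setT) Z| <= #|T| ^ 2.
Proof.
move=> l12 l2r nAP j0; have sL : sorted ltn (rcons [:: l1; l2] r) by rewrite /= l12 l2r.
have [C0 H0] := flat_or_small sL.
have s1 : sorted ltn (rcons [:: l2] r) by rewrite /= l2r.
have [C1 H1] := card_unspanned s1.
pose a := l2 - l1; pose k := (r - l1) %/ a.
(* The threshold must be fixed before the graph, while r = l1 + k * a is only learnt from an atomic
   member; hence the implication. The factor 2 leaves half of the budget for the exceptional members
   in [F1]. *)
have [N1 HN1] : exists N, r = l1 + k * a -> forall (T : finType) (e : rel T), N <=
  #|T| ->
    (forall s : seq T, size s = k.-1 -> pairwise e s -> #|[set x | all (e^~ x) s]| <=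
      r) ->
    exists E : {set T * T}, [/\ (forall p, p \in E -> e p.1 p.2),
      2 * j * #|E| <= #|T| * #|T| &
      forall s : seq T, size s = k.-1.+1 -> pairwise e s ->
        ~~ pairwise [rel x y | (x, y) \notin E] s].
  have [k1|k1] := ltnP 1 k; last first.
    by exists 0 => rE; exfalso; move: rE; rewrite /a; case: k k1 => [|[]] //; nat_lia.
  have k1' : 0 < k.-1 by rewrite -subn1 subn_gt0.
  have j2 : 0 < 2 * j by rewrite muln_gt0.
  by have [N HN] := @clique_removal k.-1 r (2 * j) k1' j2; exists N.
exists (N1 + (j * C0 + (2 * (j * C1) + 1))) => T e Z e_sym; set F := star _ Z => I NT.
have u : uniform r F := uniformS (starS _ _) (ksets_uniform e r setT).
have kF := @star_ksets_clique _ e r setT Z; rewrite -/F in kF.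
have [NT1 NT0 NTC T0] : [/\ N1 <= #|T|, j * C0 <= #|T|, 2 * (j * C1) <= #|T| & 0 <
  #|T|].
  by split; apply: leq_trans NT; move: (j * C0) (j * C1) => x y; lia.
have [_ [[C fC /= Cl]|small]] := H0 T F u I; last first.
  have leF : #|F| <= C0 * #|T| by rewrite -(leq_pmul2r T0) -mulnA.
  apply: (@leq_trans (j * (C0 * #|T|))); first by rewrite leq_mul2l leF orbT.
  rewrite mulnA expnS expn1 leq_mul2r; apply/orP; right; exact: NT0.
have {}H1 := H1 T T F (fun x => [set x]) [pred x | unspanned r [:: l2] F [set x]] u
  (fun x => id).
set F1 := finset _ in H1.
have leF1 : #|F1| <= C1 * #|T|.
  rewrite -(leq_pmul2r T0); apply: leq_trans H1 _; rewrite expn1 mulnC.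
  by rewrite leq_mul2l max_card orbT.
have F_atomic A : A \in F :\: F1 -> atomic r l2 F C A.
  rewrite in_setD => /andP[AF1 AF]; rewrite /atomic AF; apply/forall_inP => x.
  rewrite inE => /andP[xC xA].
  have : ~~ unspanned r [:: l2] F [set x].
    by apply: contra AF1 => ux; rewrite inE AF; apply/exists_inP; exists x;
      rewrite ?inE ?sub1set.
  move=> /unspannedPn [|X [fX /= Xl]].
    apply: (intersectingS _ (star_intersecting (Y := x |: C) I _));
      last by rewrite cardsU1 xC Cl.
    apply/subsetP => B; rewrite !(mem_star F) => /andP[BF xB].
    by rewrite BF subUset xB (core_subF sL u I fC Cl).
  rewrite sub1set => xX; apply: (@has_atomI _ _ _ _ _ _ _ sL u I fC Cl X x _ xX xC).
  by rewrite /is_atom fX Xl eqxx.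
have [F0|[A0 A0F]] := set_0Vmem (F :\: F1).
  have leF : #|F| <= C1 * #|T|.
    apply: leq_trans leF1; apply: subset_leq_card; apply/subsetP => A AF.
    by apply: contraT => AF1; have : A \in F :\: F1;
      [rewrite in_setD AF1|rewrite F0 inE].
  apply: (@leq_trans (j * (C1 * #|T|))); first by rewrite leq_mul2l leF orbT.
  rewrite mulnA expnS expn1 leq_mul2r; apply/orP; right.
  by apply: leq_trans NTC; rewrite leq_pmull.
have rE := atomic_dvd e_sym sL u I kF fC Cl (F_atomic _ A0F).
rewrite -/a -/k in rE.
have k2 : 2 < k.
  move: nAP; rewrite rE -/a; case: (k) rE => [|[|[|k']]] //=; rewrite /a; nat_lia.
pose er := atom_rel e r l2 F C.
have er_sym : symmetric er := atom_rel_sym e r l2 F C.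
have ZC : Z \subset C.
  have [A AF CA] := flat_sub fC.
  apply: flat_star fC; rewrite -(uniformP _ _ u _ AF) subset_leq_card //.
  by move: AF; rewrite mem_star => /andP[].
have has_all s x : pairwise er (x :: s) -> 0 < size s -> all (has_atom r l2 F C) (x ::
  s).
  case: s => [|y s] //= /andP[/andP[/and4P[-> -> _ _] xs] _] _ /=.
  by apply/allP => z /(allP xs)/and4P[].
have spanF s : pairwise er s -> size s = k -> atom_span r l2 F C s \in F.
  move=> ps ss; have sa : all (has_atom r l2 F C) s.
    case: s ps ss => [|x s] // ps /= ss; apply: has_all => //; nat_lia.
  have [cs ks] := span_card e_sym sL u I kF fC Cl sa ps.
  rewrite mem_star (subset_trans ZC (core_span _ _ _ _ _)) andbT; apply/ksetsP.
  by rewrite subsetT cs ss -/a -rE.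
(* Two atoms cover 2 * l2 - l1 > l2 vertices, more than distinct members can share. *)
have uniqF x y A B : er x y -> A \in F -> B \in F -> atom_of r l2 F x \subset A ->
    atom_of r l2 F y \subset A -> atom_of r l2 F x \subset B -> atom_of r l2 F y
      \subset B -> A = B.
  move=> /and4P[/and3P[xC ax _] /and3P[_ ay _] xy _] AF BF xA yA xB yB.
  apply/eqP; apply: contraT => AB.
  have := intersectingP _ _ I _ _ AF BF AB.
  have : #|atom_of r l2 F x :|: atom_of r l2 F y| <= #|A :&: B|.
    by rewrite subset_leq_card // subsetI !subUset xA yA xB yB.
  rewrite cardsU (atom_cap sL u I fC Cl ax ay xy) Cl.
  have /andP[_ /eqP->] := ax; have /andP[_ /eqP->] := ay.
  by rewrite !inE => H /orP[] /eqP E; rewrite E in H; nat_lia.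
(* Since k - 1 >= 2, the first two entries of s already determine a member, and all common
   neighbours of s lie in its r vertices. *)
have [s ss ps|E [Ee Ej Ehit]] := HN1 rE T er NT1.
  case: s ss ps => [|y1 [|y2 s]] ss ps; try by move: ss => /=; nat_lia.
  have [->|[x0 x0s]] := set_0Vmem [set x | all (er^~ x) [:: y1, y2 & s]];
    first by rewrite cards0.
  have sP x : x \in [set x | all (er^~ x) [:: y1, y2 & s]] ->
      exists D, [/\ D \in F, x \in D, atom_of r l2 F y1 \subset D & atom_of r l2 F y2
        \subset D].
    rewrite inE => xs; have psx : pairwise er [:: x, y1, y2 & s].
      rewrite pairwise_cons ps andbT; apply/allP => y /(allP xs); by rewrite er_sym.
    have /= /andP[xa _] := has_all _ _ psx isT.
    exists (atom_span r l2 F C [:: x, y1, y2 & s]); split.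
    - apply: (spanF _ psx); move: ss => /=; nat_lia.
    - have /and3P[_ _ xx] := xa; apply: subsetP xx.
      by apply: mem_span; rewrite !inE eqxx.
    - by apply: mem_span; rewrite !inE eqxx orbT.
    - by apply: mem_span; rewrite !inE eqxx !orbT.
  have [D0 [D0F _ y1D y2D]] := sP _ x0s.
  rewrite -(uniformP _ _ u _ D0F); apply: subset_leq_card; apply/subsetP => x xs.
  have [D [DF xD y1D' y2D']] := sP _ xs.
  have ey : er y1 y2 by move: ps => /= /andP[/andP[]].
  by rewrite (uniqF _ _ _ _ ey D0F DF y1D y2D).
have leF2 : #|F :\: F1| <= #|E|.
  rewrite -[X in _ <= X]muln1.
  apply: (@card_le_covered _ _ _ _ (fun p => star F (atom_of r l2 F p.1 :|: atom_of r
    l2 F p.2))).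
    move=> A AF2; have aA := F_atomic _ AF2.
    have AF : A \in F by case/andP: aA.
    have [|s [ss sa sA ps]] := @atomic_seq _ _ e_sym _ _ _ _ _ _ sL u I kF fC Cl A k aA.
      by rewrite -/a -rE.
    have [/exists_inP[p pE /andP[p1 p2]]|none] := boolP [exists p in E, (p.1 \in s) &&
      (p.2 \in s)].
      exists p => //; rewrite mem_star AF subUset;
        have sub x : x \in s -> atom_of r l2 F x \subset A.
        move=> xs; have /and3P[xC _ _] := allP sa _ xs.
        by have [] := atomicP sL u I fC Cl aA (allP sA _ xs) xC.
      by rewrite !sub.
    have sk : size s = k.-1.+1 by rewrite ss prednK // ltnW // ltnW.
    case/negP: (Ehit s sk ps).
    case: s {ss sk sa sA ps} none => // x0 s0; set s := _ :: _ => none.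
    apply/(pairwiseP x0) => i l il ll _ /=; apply: contra none => pE.
    by apply/exists_inP; exists (nth x0 s i, nth x0 s l); rewrite //= !mem_nth.
  move=> p pE; rewrite leqNgt; apply/negP => /card_gt1P[A [B []]].
  rewrite !(mem_star F) !subUset => /and3P[AF A1 A2] /and3P[BF B1 B2] /eqP; apply.
  exact: (uniqF _ _ _ _ (Ee _ pE)).
have leF : #|F| <= #|F1| + #|E|.
  apply: (@leq_trans (#|F1| + #|F :\: F1|)); last by rewrite leq_add2l.
  apply: leq_trans (leq_card_setU _ _); apply: subset_leq_card.
  by apply/subsetP => A AF; rewrite in_setU in_setD AF andbT orbN.
have le1 : 2 * (j * #|F1|) <= #|T| ^ 2.
  apply: (@leq_trans (2 * (j * (C1 * #|T|)))); first by rewrite !leq_mul2l leF1 !orbT.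
  by rewrite !mulnA expnS expn1 leq_mul2r -!mulnA NTC orbT.
rewrite -(leq_pmul2l (isT : 0 < 2)); apply: (@leq_trans (2 * (j * (#|F1| + #|E|)))).
  by rewrite !leq_mul2l leF !orbT.
rewrite mulnA mulnDr -mulnA [X in _ <= X]mul2n -addnn.
by apply: leq_add; rewrite // expnS expn1.
Qed.

Lemma little_of_bound j C f n k : 0 < n -> f * n <= C * n ^ k -> j * C <= n ->
  j * f <= n ^ k.
Proof.
move=> n0 fn jC; rewrite -(leq_pmul2r n0) -mulnA.
apply: (@leq_trans (j * (C * n ^ k))); first by rewrite leq_mul2l fn orbT.
by rewrite mulnA mulnC leq_mul2l jC orbT.
Qed.

(** The induction of [non_arith_bound] with one more base case, two sizes. It is stated for stars
    because the links it passes to are stars of the same clique family. *)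
Lemma non_arith_little r L : sorted ltn (rcons L r) -> 1 < size L ->
  ~ (exists d, arith_prog d (rcons L r)) -> forall j, 0 < j ->
  exists N : nat, forall (T : finType) (e : rel T) (Z : {set T}),
    symmetric e ->
    set_intersecting L (star (ksets e r setT) Z) -> N <= #|T| ->
    j * #|star (ksets e r setT) Z| <= #|T| ^ size L.
Proof.
elim: L => [//|l1 [//|l2 [_ sL _ nAP j j0|l3 L IH sL _ nAP j j0]]].
  apply: two_sizes_little => //.
  - by move: sL => /= /andP[].
  - by move: sL => /= /and3P[].
  - apply/eqP => E; apply: nAP; exists (r - l2).
    by move: sL E; rewrite /= /arith_prog /=; lia.
have sL1 : sorted ltn (rcons [:: l2, l3 & L] r) := path_sorted sL.
have uF (T : finType) (e : rel T) Z : uniform r (star (ksets e r setT) Z).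
  exact: uniformS (starS _ _) (ksets_uniform e r setT).
have [/= AP|nAP'] := boolP (arith_prog (l3 - l2) (rcons [:: l2, l3 & L] r)).
  have [||C HC] := rank3_bound sL.
  - by move: AP sL1; case: L {IH sL nAP} => [|l4 L] /=; rewrite /arith_prog /=; lia.
  - apply/eqP => E'; apply: nAP; exists (l3 - l2).
    by move: AP sL; rewrite /arith_prog /= => -> ; lia.
  exists (j * C + 1) => T e Z _ I NT.
  by apply: (little_of_bound (n := #|T|) _ (HC _ _ (uF _ _ _) I));
    apply: leq_trans NT; rewrite addn1.
have nAP2 : ~ exists d, arith_prog d (rcons [:: l2, l3 & L] r).
  move=> [d dAP]; case/negP: nAP'; suff -> : l3 - l2 = d by [].
  by move: dAP => /arith_progP/andP[/eqP-> _]; rewrite addKn.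
have [N HN] := IH sL1 isT nAP2 j j0; have [C0 H0] := flat_or_small sL.
exists (N + (j * C0 + 1)) => T e Z e_sym I NT; set F := star _ Z in I *.
have [_ [[C fC /= Cl]|small]] := H0 T F (uF _ _ _) I; last first.
  apply: (little_of_bound (n := #|T|) _ small); apply: leq_trans NT.
    by rewrite addnA addn1.
  by rewrite addnCA leq_addr.
pose m := #|T| ^ size [:: l2, l3 & L] %/ j.
have leF : #|F| <= #|T| * m.
  have uFF : uniform r F by apply: uF.
  apply: (@card_le_link _ r l1 [:: l2, l3 & L] _ _ m sL uFF I fC Cl) => x xC.
  rewrite leq_divRL // mulnC star_star HN //; last exact: leq_trans (leq_addr _ _) NT.
  by rewrite -star_star; apply: star_intersecting I _; rewrite cardsU1 xC Cl.
apply: (@leq_trans (j * (#|T| * m))); first by rewrite leq_mul2l leF orbT.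
by rewrite mulnCA expnS leq_mul2l mulnC leq_trunc_div orbT.
Qed.

(** * From clique families to [Psi] *)

Section SGraph.
Variables (T : finType) (G : sgraph T).

Lemma adj_sym : symmetric (adj G).
Proof. by move=> x y; rewrite /adj setUC. Qed.

Lemma adj_irr : irreflexive (adj G).
Proof.
move=> x; apply/negP => H; have /forall_inP/(_ _ H) := edges_card2 G.
by rewrite setUid cards1.
Qed.

Lemma cliquesE r : cliques r G = ksets (adj G) r setT.
Proof. by apply/setP => S; rewrite !inE subsetT. Qed.

End SGraph.

Lemma star0 (T : finType) (F : {set {set T}}) : star F set0 = F.
Proof. by apply/setP => A; rewrite inE sub0set andbT. Qed.

Lemma Psi_leP r n L b :
  (forall G : sgraph 'I_n, clique_intersecting r L G -> nb_cliques r G <= b) ->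
  Psi r n L <= b.
Proof. by move=> H; apply/bigmax_leqP => G; apply: H. Qed.

Lemma Psi_little r L : sorted ltn (rcons L r) -> 1 < size L ->
  ~ (exists d, arith_prog d (rcons L r)) -> forall j, 0 < j ->
  exists N : nat, forall n, N <= n -> j * Psi r n L <= n ^ size L.
Proof.
move=> sL L1 nAP j j0; have [N HN] := non_arith_little sL L1 nAP j0.
exists N => n Nn; rewrite mulnC -leq_divRL //; apply: Psi_leP => G.
rewrite /clique_intersecting /nb_cliques cliquesE -(star0 (ksets _ _ _)) leq_divRL //
  mulnC => I.
have := HN _ _ _ (@adj_sym _ G) I.
by rewrite card_ord; apply.
Qed.

Lemma Psi_big_O r L : sorted ltn (rcons L r) -> 1 < size L ->
  ~ (exists d, arith_prog d (rcons L r)) ->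
  r - nth 0 L (size L - 1) = nth 0 L (size L - 1) - nth 0 L (size L - 2) ->
  exists C : nat, forall n, 0 < n -> Psi r n L <= C * n ^ (size L - 1).
Proof.
move=> sL L1 nAP E; have [C HC] := non_arith_bound sL L1 nAP E.
exists C => n n0; apply: Psi_leP => G I; rewrite -(leq_pmul2r n0) -mulnA -expnSr.
rewrite subn1 prednK; last exact: ltnW.
have := HC _ (cliques r G); rewrite card_ord; apply=> //.
by rewrite cliquesE ksets_uniform.
Qed.

(** * Sizes in arithmetic progression *)

(** Elements with the same index in the enumerations of their fibres are matched. This reduces the
    isomorphism of blow-ups and the matching of colour classes to counting. *)
Lemma fibre_bij (U V K : finType) (c : U -> K) (c' : V -> K) :
  (forall k, #|[set x | c x == k]| = #|[set y | c' y == k]|) ->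
  exists2 f : U -> V, bijective f & forall x, c' (f x) = c x.
Proof.
move=> E; have card (W : finType) (g : W -> K) : #|W| = \sum_k #|[set x | g x == k]|.
  rewrite -sum1_card (partition_big g xpredT) //=; apply: eq_bigr => k _.
  by rewrite -sum1_card; apply: eq_bigl => x; rewrite inE.
have UV : #|U| = #|V| by rewrite (card U c) (card V c'); apply: eq_bigr.
have [y0 _|V0] := pickP (mem V); last first.
  have U0 : #|U| = 0 by rewrite UV; apply: eq_card0.
  have no (x : U) : False by have := card0_eq U0 x; rewrite inE.
  exists (fun x => False_rect V (no x)) => [|x]; last by case: (no x).
  have inj : injective (fun x : U => False_rect V (no x)) by move=> x; case: (no x).
  by apply: inj_card_bij inj _; rewrite UV.
pose A x := enum [set z | c z == c x]; pose B x := enum [set y | c' y == c x].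
pose f x := nth y0 (B x) (index x (A x)).
have sAB x : size (A x) = size (B x) by rewrite -!cardE.
have xA x : x \in A x by rewrite mem_enum inE.
have fE x : c' (f x) = c x.
  have : f x \in B x by rewrite mem_nth // -sAB index_mem.
  by rewrite mem_enum inE => /eqP.
exists f => //; apply: inj_card_bij; last by rewrite UV.
move=> x y fxy; have cxy : c x = c y by rewrite -!fE fxy.
have BE : B x = B y by rewrite /B cxy.
have AE : A x = A y by rewrite /A cxy.
have yAx : y \in A x by rewrite AE.
have : index x (A x) == index y (A x).
  rewrite -(nth_uniq y0 _ _ (enum_uniq [set y | c' y == c x])) -/(B x) -?sAB
    ?index_mem //.
  by move: fxy; rewrite /f -BE -AE => ->.
by move=> /eqP/(congr1 (nth x (A x))); rewrite !nth_index.
Qed.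

Lemma card_residue m s i : i < s ->
  #|[set j : 'I_m | j %% s == i]| = (m + (s.-1 - i)) %/ s.
Proof.
move=> is_; rewrite -sum1dep_card; elim: m => [|m IH].
  by rewrite big_ord0 divn_small //; lia.
rewrite big_mkcond big_ord_recr -big_mkcond /= IH addSn divnS; last by lia.
rewrite addnC; congr (_ + _).
have -> : (m + (s.-1 - i)).+1 = m + (s - i) by lia.
have -> : (s %| m + (s - i)) = (m %% s == i); last by case: eqP.
rewrite {1}(divn_eq m s) -addnA dvdn_addr ?dvdn_mull //.
have ms : m %% s < s by rewrite ltn_mod; lia.
move: (m %% s) ms => a as_; have [ai|ia|->] := ltngtP a i.
- by rewrite gtnNdvd //; lia.
- have -> : a + (s - i) = (a - i) + s by lia.
  by rewrite dvdn_addl // gtnNdvd //; lia.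
- by rewrite subnKC ?dvdnn // ltnW.
Qed.

Section TuranGraph.
Variables (m s : nat).

Lemma adj_turan (i j : 'I_m) : adj (turan_graph m s) i j = (i %% s != j %% s).
Proof.
rewrite adj_graph_of_rel /= (eq_sym (j %% s)) orbb.
by case: eqVneq => [->|//]; rewrite eqxx.
Qed.

Lemma residue_balanced : 0 < s ->
  balanced (fun i : 'I_s => #|[set j : 'I_m | j %% s == i]|) /\
  \sum_(i < s) #|[set j : 'I_m | j %% s == i]| = m.
Proof.
(* The residue classes shrink with i while the factors of [turan_number] grow, hence the
   reversal. *)
move=> s0; have E (i : 'I_s) : #|[set j : 'I_m | j %% s == i]| = (m + rev_ord i) %/ s.
  by rewrite card_residue // /= subnS -predn_sub.
split=> [i j|]; first by rewrite !E; apply: balanced_parts.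
rewrite (eq_bigr _ (fun i _ => E i)) -[RHS](sum_parts m s0) [RHS](reindex_inj
  rev_ord_inj).
by apply: eq_bigr.
Qed.

Lemma nb_cliques_turan : 0 < s ->
  nb_cliques s (turan_graph m s) = turan_number s m.
Proof.
move=> s0; rewrite /nb_cliques cliquesE.
rewrite (@card_ksets_multipartite _ _ (@adj_sym _ _) (@adj_irr _ _) s _ (fun j : 'I_m
  => j %% s)).
- have [b sm] := residue_balanced s0; rewrite -[in RHS]sm -(balanced_prod s0 b).
  by apply: eq_bigr => i _; apply: eq_card => x; rewrite !inE.
- by move=> i _; rewrite ltn_mod.
- by move=> i j _ _; apply: adj_turan.
Qed.

End TuranGraph.

(** * Graphs with the same r-cliques *)

Section Transfer.
Variables (T U : finType) (G : sgraph T) (H : sgraph U) (f : T -> U) (r : nat).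
Hypotheses (f_inj : injective f).
Hypothesis cliques_f : cliques r H = [set f @: S | S : {set T} in cliques r G].

Lemma nb_cliques_transfer : nb_cliques r H = nb_cliques r G.
Proof. by rewrite /nb_cliques cliques_f card_imset //; apply: imset_inj. Qed.

Lemma clique_intersecting_transfer L :
  clique_intersecting r L H = clique_intersecting r L G.
Proof.
have capE (A B : {set T}) : #|f @: A :&: f @: B| = #|A :&: B|.
  by rewrite -imsetI ?card_imset //; move=> x y _ _; apply: f_inj.
rewrite /clique_intersecting cliques_f; apply/intersectingP/intersectingP => I A B.
  move=> AF BF AB; rewrite -capE I ?imset_f //.
  by apply: contra AB => /eqP/(imset_inj f_inj)->.
move=> /imsetP[A' A'F ->] /imsetP[B' B'F ->] AB; rewrite capE I //.
by apply: contra AB => /eqP->.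
Qed.

End Transfer.

Lemma cliques_iso (T U : finType) (G : sgraph T) (H : sgraph U) (f : T -> U) r :
  bijective f -> (forall x y, adj H (f x) (f y) = adj G x y) ->
  cliques r H = [set f @: S | S : {set T} in cliques r G].
Proof.
move=> bf fE; have f_inj := bij_inj bf; case: (bf) => g fK gK.
have cl (S : {set T}) : (f @: S \in cliques r H) = (S \in cliques r G).
  rewrite !inE card_imset //; congr (_ && _); apply/cliqueP/cliqueP => c x y.
    by move=> xS yS xy; rewrite -fE c ?imset_f // inj_eq.
  by move=> /imsetP[x' xS ->] /imsetP[y' yS ->]; rewrite inj_eq // fE; apply: c.
apply/setP => S; apply/idP/imsetP => [SH|[S' S'G ->]]; last by rewrite cl.
have SE : S = f @: (g @: S) by rewrite -imset_comp (eq_imset _ (gK : f \o g =1 id))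
  imset_id.
by exists (g @: S); rewrite // -cl -SE.
Qed.

Lemma cliques_clique_part (T : finType) (G : sgraph T) r :
  cliques r G = [set val @: S | S : {set {x : T | x \in cover (cliques r G)}} in
    cliques r (clique_part r G)].
Proof.
pose U := {x : T | x \in cover (cliques r G)}.
have adjE (x y : U) : adj (clique_part r G) x y = (x != y) && [exists S in cliques r
  G, (val x \in S) && (val y \in S)].
  rewrite adj_graph_of_rel; congr (_ && _).
  suff -> : [exists S in cliques r G, (val y \in S) && (val x \in S)] = [exists S in
    cliques r G, (val x \in S) && (val y \in S)] by rewrite orbb.
  by apply: eq_existsb => S; rewrite [X in _ && X]andbC.
apply/setP => S; apply/idP/imsetP => [SG|[S' S'G ->]].
  have SE : S = val @: (val @^-1: S : {set U}).
    apply/setP => x; apply/idP/imsetP => [xS|[y + ->]]; last by rewrite inE.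
    have xc : x \in cover (cliques r G) by apply/bigcupP; exists S.
    by exists (Sub x xc : U); rewrite ?inE SubK.
  exists (val @^-1: S) => //; have := SG; rewrite {1}SE !inE card_imset;
    last exact: val_inj.
  move=> /andP[-> _]; apply/cliqueP => x y; rewrite !inE => xS yS xy.
  by rewrite adjE xy; apply/exists_inP; exists S; rewrite ?xS.
move: S'G; rewrite !inE card_imset; last exact: val_inj.
move=> /andP[-> /cliqueP c]; apply/cliqueP => _ _ /imsetP[x xS ->] /imsetP[y yS ->] xy.
have := c x y xS yS; rewrite adjE (contraNneq _ xy) => [|->//] /(_ isT)/exists_inP[A].
by rewrite inE => /andP[_ /cliqueP cA] /andP[xA yA]; apply: cA.
Qed.

(** Places the extremal graph, which may have fewer than n vertices, inside 'I_n. For r > 1 each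
    vertex of an r-clique has a neighbour and so lies in the image of f. *)
Lemma embed_cliques (T U : finType) (H : sgraph T) r : 1 < r -> #|T| <= #|U| ->
  exists (G : sgraph U) (f : T -> U),
    injective f /\ cliques r G = [set f @: S | S : {set T} in cliques r H].
Proof.
move=> r1 TU; pose f x : U := enum_val (widen_ord TU (enum_rank x)).
have f_inj : injective f by move=> x y /enum_val_inj/(congr1 val)/=
  /val_inj/enum_rank_inj.
pose G := graph_of_rel (fun a b : U => [exists x, exists y, [&& a == f x, b == f y &
  adj H x y]]).
have adjG a b : adj G a b -> exists x y, [/\ a = f x, b = f y & adj H x y].
  rewrite adj_graph_of_rel => /andP[_ /orP[]] /existsP[x /existsP[y /and3P[/eqP->
    /eqP-> xy]]].
    by exists x, y.
  by exists y, x; rewrite adj_sym.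
have adjf x y : adj G (f x) (f y) = adj H x y.
  apply/idP/idP => [/adjG[x' [y' [/f_inj-> /f_inj->]]]//|xy].
  rewrite adj_graph_of_rel inj_eq //; apply/andP; split.
    by apply: contraTneq xy => ->; rewrite adj_irr.
  by apply/orP; left; apply/existsP; exists x; apply/existsP; exists y; rewrite !eqxx.
exists G, f; split=> //.
have cl (S : {set T}) : (f @: S \in cliques r G) = (S \in cliques r H).
  rewrite !inE card_imset //; congr (_ && _); apply/cliqueP/cliqueP => c x y.
    by move=> xS yS xy; rewrite -adjf c ?imset_f // inj_eq.
  by move=> /imsetP[x' xS ->] /imsetP[y' yS ->]; rewrite inj_eq // adjf; apply: c.
apply/setP => S; apply/idP/imsetP => [SG|[S' S'G ->]]; last by rewrite cl.
suff SE : S = f @: (f @^-1: S) by exists (f @^-1: S); rewrite // -cl -SE.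
apply/setP => a; apply/idP/imsetP => [aS|[x + ->]]; last by rewrite inE.
move: SG; rewrite inE => /andP[/eqP Sr /cliqueP cS].
have [b bS ba] : exists2 b, b \in S & a != b.
  have : 0 < #|S :\ a| by move: (cardsD1 a S); rewrite aS Sr; lia.
  by rewrite card_gt0 => /set0Pn[b]; rewrite !inE eq_sym => /andP[ab bS]; exists b.
have [x [_ [ax _ _]]] := adjG _ _ (cS _ _ aS bS ba).
by exists x; rewrite // inE -ax.
Qed.

(* [G] is isomorphic to K_l1 + \hat T(m, s, d): [k x] is [None] on K_l1, and
   the index of the block of [x] elsewhere. *)
Definition blowup_model (U : finType) (m s d l1 : nat) (k : U -> option 'I_m)
    (G : sgraph U) :=
  [/\ #|[set x | k x == None]| = l1,
      forall j, #|[set x | k x == Some j]| = d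
    & forall x y, adj G x y = (x != y) &&
        match k x, k y with
        | Some i, Some j => (i == j) || (i %% s != j %% s)
        | _, _ => true
        end].

Lemma blowup_model_iso (U V : finType) m s d l1 (k : U -> option 'I_m)
    (k' : V -> option 'I_m) (G : sgraph U) (H : sgraph V) :
  blowup_model s d l1 k G -> blowup_model s d l1 k' H -> graph_iso G H.
Proof.
move=> [k0 kj adjG] [k0' kj' adjH].
have [[j|]|f bf fE] := @fibre_bij U V _ k k'; rewrite ?k0 ?kj ?k0' ?kj' //.
exists f => // x y; rewrite adjG adjH !fE; congr (~~ _ && _).
exact: (inj_eq (bij_inj bf)).
Qed.

Lemma extremal_graph_model n l1 s d :
  blowup_model s d l1
    (fun x : 'I_l1 + 'I_((n - l1) %/ d) * 'I_d => if x is inr p then Some p.1 else None)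
    (extremal_graph n l1 s d).
Proof.
set m := (n - l1) %/ d; split.
- have E : #|[set (inl i : 'I_l1 + 'I_m * 'I_d)%type | i : 'I_l1]| = l1.
    by rewrite card_imset ?card_ord // => i j [].
  rewrite -[RHS]E; apply: eq_card => -[i|p]; rewrite !inE /=;
    first by apply/esym/imsetP; exists i.
  by apply/esym/imsetP => -[].
- move=> j; have E : #|[set (inr (j, i) : 'I_l1 + 'I_m * 'I_d)%type | i : 'I_d]| = d.
    by rewrite card_imset ?card_ord // => i i' [].
  rewrite -[RHS]E; apply: eq_card => -[i|[j' i]]; rewrite !inE /=;
    first by apply/esym/imsetP => -[].
  apply/eqP/imsetP => [[->]|[i' _ [-> _]] //]; by exists i.
- move=> [i|[i i']] [j|[j j']]; rewrite adj_graph_of_rel //=.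
    by rewrite !adj_graph_of_rel /= !andbT (inj_eq (@inl_inj _ _)) (eq_sym j) orbb
      andbb.
  rewrite !adj_graph_of_rel /= (eq_sym j) (eq_sym (j %% s)).
  rewrite (inj_eq (@inr_inj _ _)) !xpair_eqE (eq_sym j) (eq_sym j').
  by case: (i == j); case: (i' == j'); case: (i %% s == j %% s).
Qed.

(** * Cliques of the blow-up *)

Section Model.
Variables (U : finType) (m s d l1 : nat) (k : U -> option 'I_m) (G : sgraph U).
Hypotheses (Gk : blowup_model s d l1 k G) (s0 : 0 < s) (d0 : 0 < d).

Definition blocks (J : {set 'I_m}) := [set x | if k x is Some j then j \in J else true].

Lemma card_blocks J : #|blocks J| = l1 + #|J| * d.
Proof.
have [k0 kj _] := Gk; rewrite -sum1_card (partition_big k xpredT) //= (bigD1 None) //=.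
congr (_ + _).
  by rewrite -[RHS]k0 -sum1_card; apply: eq_bigl => x; rewrite !inE;
    case: (k x) => [j|] //=; rewrite andbF.
rewrite -sum_nat_const.
rewrite (reindex_omap (@Some 'I_m) id) /=; last by case.
rewrite [RHS]big_mkcond; apply: eq_big => [j|j _]; first by rewrite eqxx.
rewrite -(kj j); case: ifP => jJ.
  rewrite -sum1_card; apply: eq_bigl => x; rewrite !inE; case: eqP => [->|];
    by rewrite ?jJ ?andbF.
by rewrite big_pred0 // => x; rewrite inE; case: eqP => [->|]; rewrite ?jJ ?andbF.
Qed.

(** The blocks met by a clique have distinct residues modulo s, so there are at most s of them, and
    l1 + s * d vertices must fill K_l1 and s whole blocks. *)
Lemma cliques_blowup : cliques (l1 + s * d) G = [set blocks J | J in cliques s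
  (turan_graph m s)].
Proof.
have [_ _ adjG] := Gk; apply/setP => S; apply/idP/imsetP => [|[J + ->]]; last first.
  rewrite !inE card_blocks => /andP[/eqP-> /cliqueP cJ]; rewrite eqxx /=.
  apply/cliqueP => x y; rewrite !inE adjG => xJ yJ ->; move: xJ yJ.
  case: (k x) => // i; case: (k y) => // j iJ jJ; have [//|ij] := eqVneq i j.
  by have := cJ _ _ iJ jJ ij; rewrite adj_turan.
rewrite inE => /andP[/eqP Sr /cliqueP cS].
pose J := [set j | [exists x in S, k x == Some j]].
have SJ : S \subset blocks J.
  apply/subsetP => x xS; rewrite inE; case kx : (k x) => [j|//].
  by rewrite inE; apply/exists_inP; exists x; rewrite ?kx.
have res : {in J &, injective (fun j : 'I_m => Ordinal (ltn_pmod j s0))}.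
  move=> i j; rewrite !inE => /exists_inP[x xS /eqP kx] /exists_inP[y yS /eqP ky] [] E.
  have [xy|xy] := eqVneq x y; first by move: ky; rewrite -xy kx => -[].
  by have := cS _ _ xS yS xy; rewrite adjG kx ky E eqxx orbF => /andP[_ /eqP].
have Js : #|J| <= s.
  by rewrite -(card_in_imset res) -[X in _ <= X]card_ord max_card.
have SE : S = blocks J.
  by apply/eqP; rewrite eqEcard SJ card_blocks Sr leq_add2l leq_mul2r Js orbT.
exists J => //; rewrite inE; apply/andP; split.
  by move: Sr; rewrite {1}SE card_blocks => /eqP; rewrite eqn_add2l eqn_pmul2r.
apply/cliqueP => i j iJ jJ ij; rewrite adj_turan; apply: contra ij => /eqP E.
apply/eqP; apply: res => //; exact: val_inj.
Qed.

Lemma blocks_inj : injective blocks.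
Proof.
move=> J J' E; apply/setP => j; have [_ kj _] := Gk.
have /set0Pn[x] : [set x | k x == Some j] != set0 by rewrite -card_gt0 kj.
by rewrite inE => /eqP kx; have /setP/(_ x) := E; rewrite !inE kx.
Qed.

Lemma nb_cliques_blowup : nb_cliques (l1 + s * d) G = turan_number s m.
Proof.
rewrite /nb_cliques cliques_blowup card_imset; last exact: blocks_inj.
exact: nb_cliques_turan.
Qed.

Lemma clique_intersecting_blowup L : (forall i, i < s -> l1 + i * d \in L) ->
  clique_intersecting (l1 + s * d) L G.
Proof.
move=> inL; rewrite /clique_intersecting cliques_blowup; apply/intersectingP => A B.
move=> /imsetP[J /[1!inE] /andP[/eqP Js _] ->] /imsetP[J' /[1!inE] /andP[/eqP Js' _]
  ->] JJ'.
have -> : blocks J :&: blocks J' = blocks (J :&: J').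
  by apply/setP => x; rewrite !inE; case: (k x) => // j; rewrite inE.
rewrite card_blocks; apply: inL;
  rewrite -[X in _ < X]Js ltn_neqAle subset_leq_card ?subsetIl // andbT.
apply: contra JJ' => /eqP E; apply/eqP; congr blocks.
have JJ : J \subset J' by apply/setIidPl/eqP; rewrite eqEcard subsetIl E leqnn.
by apply/eqP; rewrite eqEcard JJ Js Js' leqnn.
Qed.

End Model.

(** * The graph of atoms *)

Section Quotient.
Variables (T : finType) (e : rel T).
Variables (r l1 d s : nat) (L : seq nat) (C : {set T}).
Hypotheses (sL : sorted ltn (rcons [:: l1, l1 + d & L] r)).
Hypotheses (rE : r = l1 + s * d) (d0 : 0 < d).
Hypotheses (L_ap : forall l, l \in [:: l1, l1 + d & L] -> exists2 i, i < s & l = l1 +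
  i * d).
Hypotheses (not_all : 1 < d \/ 0 < l1).
Notation F := (ksets e r [set: T]).
Notation is_atom := (is_atom r (l1 + d) F).
Hypotheses (F_int : set_intersecting [:: l1, l1 + d & L] F).
Hypotheses (fC : flat r F C) (Cl : #|C| = l1).
Implicit Types (A X Y : {set T}) (Q : {set {set T}}).

Let F_uni : uniform r F := ksets_uniform e r setT.

Let F_clique : {in F, forall A, clique e A}.
Proof. by move=> A /ksetsP[]. Qed.

Definition atoms : {set {set T}} := [set X | is_atom X].

(** Unlike for [atom_rel], the atoms themselves are the vertices, because the exact number of copies
    of K_s matters. *)
Definition atom_adj X Y := [&& X != Y, is_atom X, is_atom Y & clique e (X :|: Y)].

Definition hull Q := C :|: cover Q.

Lemma atom_adj_sym : symmetric atom_adj.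
Proof. by move=> X Y; rewrite /atom_adj eq_sym setUC [is_atom X && _]andbCA. Qed.

Lemma atom_adj_irr : irreflexive atom_adj.
Proof. by move=> X; rewrite /atom_adj eqxx. Qed.

Lemma atomsP X : X \in atoms -> is_atom X.
Proof. by rewrite inE. Qed.

Lemma core_atom X : X \in atoms -> C \subset X.
Proof. by move=> /atomsP/andP[fX _]; apply: (core_sub sL F_uni F_int fC Cl fX). Qed.

Lemma card_hull Q : Q \subset atoms -> #|hull Q| = l1 + #|Q| * d.
Proof.
have [k] := ubnP #|Q|; elim: k Q => // k IH Q Qk QP.
have [->|[X XQ]] := set_0Vmem Q.
  by rewrite /hull /cover big_set0 setU0 cards0 Cl mul0n addn0.
have XP := subsetP QP _ XQ; have QE : #|Q| = #|Q :\ X|.+1 by rewrite (cardsD1 X) XQ.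
have QX : Q :\ X \subset atoms by apply: subset_trans (subD1set _ _) QP.
have HE : hull Q = X :|: hull (Q :\ X).
  by rewrite /hull /cover (big_setD1 X XQ) /= setUCA.
have cap : X :&: hull (Q :\ X) = C.
  apply/eqP; rewrite eqEsubset subsetI core_atom // subsetUl !andbT.
  apply/subsetP => x /setIP[xX /setUP[//|/bigcupP[Y + xY]]].
  rewrite in_setD1 => /andP[YX YQ]; have YP := subsetP QP _ YQ.
  by rewrite -(atom_cap sL F_uni F_int fC Cl (atomsP XP) (atomsP YP) _) 1?eq_sym //
    inE xX.
rewrite HE cardsU cap (IH _ _ QX); last by rewrite -ltnS -QE.
have /andP[_ /eqP->] := atomsP XP.
by rewrite Cl QE mulSn addnCA addKn addnA.
Qed.

Lemma hull_clique k Q : Q \in ksets atom_adj k atoms -> clique e (hull Q).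
Proof.
move=> /ksetsP[QP _ /cliqueP cQ].
have kC : clique e C.
  by have [A AF CA] := flat_sub fC; apply: cliqueS CA (F_clique AF).
have kX X : X \in Q -> clique e X.
  by move=> XQ; apply: (atom_clique F_clique (atomsP (subsetP QP _ XQ))).
have CX X x : X \in Q -> x \in C -> x \in X by move=> /(subsetP QP)/core_atom/subsetP;
  apply.
apply/cliqueP => x y /setUP[xC|/bigcupP[X XQ xX]] /setUP[yC|/bigcupP[Y YQ yY]] xy.
- exact: (cliqueP _ _ kC).
- exact: (cliqueP _ _ (kX _ YQ) _ _ (CX _ _ YQ xC)).
- exact: (cliqueP _ _ (kX _ XQ) _ _ xX (CX _ _ XQ yC)).
have [XY|XY] := eqVneq X Y; first by apply: (cliqueP _ _ (kX _ YQ)) => //; rewrite -XY.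
have /and4P[_ _ _ /cliqueP] := cQ _ _ XQ YQ XY.
by apply; rewrite // inE ?xX ?yY ?orbT.
Qed.

Lemma hull_mem Q : Q \in ksets atom_adj s atoms -> hull Q \in F.
Proof.
move=> QK; have [QP Qs _] := ksetsP _ _ _ _ QK; apply/ksetsP.
by rewrite subsetT card_hull // Qs (hull_clique QK).
Qed.

(* The union of s + 1 pairwise adjacent atoms and the core would contain two
   r-cliques sharing r - 1 vertices, or an r-clique missing a core vertex. *)
Lemma atoms_free : ksets atom_adj s.+1 atoms = set0.
Proof.
apply/setP => Q; rewrite [RHS]inE; apply/negP => QK.
have [QP Qs _] := ksetsP _ _ _ _ QK.
have cD := card_hull QP; have kD := hull_clique QK; rewrite Qs mulSn addnCA -rE in cD.
have inF A : A \subset hull Q -> #|A| = r -> A \in F.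
  by move=> AD Ar; apply/ksetsP; rewrite subsetT; split=> //; apply: cliqueS kD.
have [B BD Br] : exists2 B : {set T}, B \subset hull Q & #|B| = r.+1.
  have : 0 < #|[set A : {set T} | A \subset hull Q & #|A| == r.+1]|.
    by rewrite cards_draws bin_gt0 cD -add1n leq_add2r.
  by rewrite card_gt0 => /set0Pn[B]; rewrite inE => /andP[BD /eqP]; exists B.
have BF x : x \in B -> B :\ x \in F.
  move=> xB; apply: inF; first exact: subset_trans (subD1set _ _) BD.
  by move: Br; rewrite (cardsD1 x) xB => -[].
have CB x : x \in B -> x \notin C.
  move=> xB; apply/negP => xC; have := core_subF sL F_uni F_int fC Cl (BF _ xB).
  by move=> /subsetP/(_ _ xC); rewrite !inE eqxx.
have [x xB] : exists x, x \in B by apply/set0Pn; rewrite -card_gt0 Br.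
have [y] : exists y, y \in B :\ x.
  apply/set0Pn; rewrite -card_gt0 (uniformP _ _ F_uni) ?BF // rE.
  by have [_ l2r _] := sizes_lt sL; rewrite -rE; apply: leq_trans l2r.
rewrite in_setD1 => /andP[yx yB].
have ne : B :\ x != B :\ y.
  by apply/eqP => /setP/(_ y); rewrite !inE eqxx yx yB.
have := intersectingP _ _ F_int _ _ (BF _ xB) (BF _ yB) ne.
have -> : #|(B :\ x) :&: (B :\ y)| = r.-1.
  have -> : (B :\ x) :&: (B :\ y) = (B :\ x) :\ y.
    by apply/setP => z; rewrite !inE; case: (z == x) => //=; case: (z == y);
      rewrite ?andbF ?andbb.
  have := uniformP _ _ F_uni _ (BF _ xB); rewrite (cardsD1 y) in_setD1 yx yB => <-.
  by [].
move=> /L_ap[i is_ rE1].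
(* The form l1 + i * d of r - 1 with i < s leaves only d = 1. Then B is the whole hull and contains
   C, which is nonempty by [not_all], although [CB] keeps B away from C. *)
have d1 : d = 1.
  have : i.+1 * d <= s * d by rewrite leq_mul2r is_ orbT.
  by move: rE1; rewrite rE mulSn; move: (i * d) (s * d) d0 => u v; clear; lia.
have l10 : 0 < l1 by case: not_all => //; rewrite d1.
have [c cC] : exists c, c \in C by apply/set0Pn; rewrite -card_gt0 Cl.
have cB : c \in B.
  suff <- : hull Q = B by rewrite inE cC.
  by apply/esym/eqP; rewrite eqEcard BD cD Br d1 add1n leqnn.
by have := CB _ cB; rewrite cC.
Qed.

Definition atoms_in A := [set X in atoms | X \subset A].

Lemma atoms_in_ksets A : A \in F -> atoms_in A \in ksets atom_adj #|atoms_in A| atoms.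
Proof.
move=> AF; apply/ksetsP; split=> //; first by apply/subsetP => X;
  rewrite inE => /andP[].
apply/cliqueP => X Y; rewrite !inE => /andP[XP XA] /andP[YP YA] XY.
rewrite /atom_adj XY XP YP /=; apply: cliqueS (F_clique AF).
by rewrite subUset XA.
Qed.

Definition outside := ~: hull atoms.

Lemma card_outside : #|outside| + (l1 + #|atoms| * d) = #|T|.
Proof. by rewrite -card_hull // addnC cardsC. Qed.

Lemma hull_atoms_in A : A \in F -> hull (atoms_in A) = A :\: outside.
Proof.
move=> AF; rewrite /outside setDE setCK; apply/setP => x; rewrite in_setI.
have CA := core_subF sL F_uni F_int fC Cl AF.
apply/setUP/andP => [[xC|/bigcupP[X + xX]]|[xA /setUP[xC|/bigcupP[X XP xX]]]].
- by rewrite (subsetP CA) // inE xC.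
- rewrite inE => /andP[XP XA]; rewrite (subsetP XA) //; split=> //.
  by apply/setUP; right; apply/bigcupP; exists X.
- by left.
case: (boolP (x \in C)) => xC; [by left|right].
apply/bigcupP; exists X => //; rewrite inE XP.
exact: (atom_min sL F_uni F_int fC Cl (atomsP XP) (mem_flat r AF) xX xA xC).
Qed.

(** So a member meets [outside] in a multiple of d vertices, hence in none once fewer than d
    vertices are outside. *)
Lemma card_outside_cap A : A \in F -> #|A :&: outside| + #|atoms_in A| * d = s * d.
Proof.
move=> AF; have [QP _ _] := ksetsP _ _ _ _ (atoms_in_ksets AF).
have := card_hull QP; rewrite hull_atoms_in //.
have := cardsID outside A; rewrite (uniformP _ _ F_uni _ AF) rE.
move: (#|A :&: _|) (#|A :\: _|) (_ * d) (s * d) => a b c c'; clear; lia.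
Qed.

Definition inside := [set A in F | [disjoint A & outside]].

Lemma atoms_in_inside A : A \in inside ->
  atoms_in A \in ksets atom_adj s atoms /\ A = hull (atoms_in A).
Proof.
rewrite inE => /andP[AF dA]; have A0 : A :&: outside = set0 by apply/eqP;
  rewrite setI_eq0.
have := card_outside_cap AF; rewrite A0 cards0 add0n => /eqP;
  rewrite eqn_pmul2r // => /eqP As.
split; first by rewrite -{1}As atoms_in_ksets.
by rewrite hull_atoms_in // setDE -[RHS]set0U -A0 -setIUr setUCr setIT.
Qed.

Lemma card_inside : #|inside| <= #|ksets atom_adj s atoms|.
Proof.
have inj : {in inside &, injective atoms_in}.
  by move=> A B /atoms_in_inside[_ {2}->] /atoms_in_inside[_ {2}->] ->.
rewrite -(card_in_imset inj); apply: subset_leq_card;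
  apply/subsetP => Q /imsetP[A AI ->].
by have [] := atoms_in_inside AI.
Qed.

Definition bad_vertices := [set x in outside | unspanned r [:: l1 + d & L] F [set x]].

(** A spanned vertex not in C lies in an atom, so every vertex of [outside] is unspanned. *)
Lemma inside_or_bad A : A \in F ->
  (A \in inside) || [exists x in bad_vertices, [set x] \subset A].
Proof.
move=> AF; case: (boolP (A \in inside)) => //=;
  rewrite inE AF /= => /pred0Pn[x /= /andP[xA xO]].
apply/exists_inP; exists x; rewrite ?sub1set // in_set xO /=; apply: contraT => H.
have xC : x \notin C by apply: contraL xO => xC; rewrite !inE xC.
have [|X [fX /= Xl]] := unspannedPn H.
  apply: (intersectingS _ (star_intersecting (Y := x |: C) F_int _));
    last by rewrite cardsU1 xC Cl.
  apply/subsetP => B; rewrite !(mem_star F) => /andP[BF xB].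
  by rewrite BF subUset xB (core_subF sL F_uni F_int fC Cl).
rewrite sub1set => xX; move: xO; rewrite in_setC in_setU (negPf xC) /= => /negP[].
by apply/bigcupP; exists X; rewrite ?inE // /is_atom fX Xl eqxx.
Qed.

End Quotient.

(** With q = (n - l1) %/ (d * s), the number is at least q ^ s while n <= K * q, so q > B * K ^ (s -
    1) suffices. *)
Lemma turan_number_growth s d l1 B : 0 < s -> 0 < d -> exists n0 : nat,
  forall n, n0 < n -> B * n ^ s.-1 < turan_number s ((n - l1) %/ d).
Proof.
move=> s0 d0; have ds0 : 0 < d * s by rewrite muln_gt0 d0.
pose K := l1 + 2 * (d * s); pose M := B * K ^ s.-1.
exists (l1 + M.+2 * (d * s)) => n n0; apply: leq_trans (turan_number_ge _ _).
rewrite -divnMA; set q := _ %/ (d * s).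
have Mq : M < q.
  rewrite /q leq_divRL // leq_subRL; last by apply: leq_trans (ltnW n0);
    apply: leq_addr.
  by apply: leq_trans (ltnW n0); rewrite leq_add2l leq_mul2r leqnSn orbT.
have nq : n <= K * q.
  have := ltn_ceil (n - l1) ds0; rewrite -/q ltn_subLR;
    last by apply: leq_trans (ltnW n0); apply: leq_addr.
  move=> /ltnW H; apply: leq_trans H _; rewrite /K mulnDl leq_add //.
    by rewrite leq_pmulr //; apply: leq_trans Mq.
  rewrite mulnAC leq_mul2r; apply/orP; right.
  by rewrite mul2n -addnn -[q.+1]addn1 leq_add2l; apply: leq_trans Mq.
apply: (@leq_ltn_trans (B * (K * q) ^ s.-1)); first by rewrite leq_mul2l;
  case: (s.-1) => [|k]; rewrite ?expn0 ?leq_exp2r ?nq ?orbT.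
rewrite expnMn mulnA -/M -[in ltnRHS](prednK s0) expnS ltn_mul2r Mq andbT expn_gt0.
by rewrite (leq_trans _ Mq).
Qed.

(* The w vertices outside the p < m atoms lie in at most w * C1 * N / n members,
   less than what is lost since turan_number s p / p is nondecreasing in p. *)
Lemma few_atoms_strict s p m n w d C1 N f t : p < m -> m <= n ->
  turan_number s p * m <= turan_number s m * p ->
  w <= 2 * (m - p) * d -> 2 * d * C1 * N < turan_number s m ->
  f * n <= w * (C1 * N) -> t <= turan_number s p -> f + t < turan_number s m.
Proof.
move=> pm mn rat w_le grow fn tp.
have m0 : 0 < m by apply: leq_ltn_trans pm.
have n0 : 0 < n by apply: leq_trans mn.
set a := turan_number s p in rat tp; set b := turan_number s m in rat grow *.
rewrite -(ltn_pmul2r (_ : 0 < n * m)) ?muln_gt0 ?n0 // mulnDl.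
have ft : f * (n * m) <= (m - p) * m * (2 * d * C1 * N).
  rewrite mulnA; apply: (@leq_trans (2 * (m - p) * d * (C1 * N) * m)).
    by rewrite leq_mul2r (leq_trans fn) ?orbT // leq_mul2r w_le orbT.
  by rewrite eq_leq //; move: (m - p) => k; lia.
have ft' : f * (n * m) < (m - p) * n * b.
  apply: (leq_ltn_trans ft); apply: (@leq_ltn_trans ((m - p) * n * (2 * d * C1 * N))).
    by rewrite !leq_mul2r leq_mul2l mn !orbT.
  by rewrite ltn_mul2l grow andbT muln_gt0 subn_gt0 pm.
apply: (@leq_trans ((m - p) * n * b + n * (b * p))).
  rewrite -addSn leq_add //; apply: (@leq_trans (a * (n * m)));
    first by rewrite leq_mul2r tp orbT.
  by rewrite mulnCA leq_mul2l rat orbT.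
rewrite eq_leq //; rewrite -{2}(subnK (ltnW pm)); move: (m - p) => k; lia.
Qed.

(** Without a core the family has lower order. With m atoms, fewer than d vertices are left over;
    members avoid them by [card_outside_cap], and Zykov's bound is exact. With fewer atoms, members
    through unspanned vertices cannot make up for the loss. *)
Lemma arith_prog_bound r l1 d s L :
  sorted ltn (rcons [:: l1, l1 + d & L] r) -> r = l1 + s * d -> 0 < d ->
  size [:: l1, l1 + d & L] = s ->
  (forall l, l \in [:: l1, l1 + d & L] -> exists2 i, i < s & l = l1 + i * d) ->
  1 < d \/ 0 < l1 ->
  exists n0 : nat, forall (T : finType) (e : rel T),
    n0 < #|T| ->
    let F := ksets e r setT in let m := (#|T| - l1) %/ d in
    set_intersecting [:: l1, l1 + d & L] F ->
    #|F| <= turan_number s m /\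
    (#|F| = turan_number s m -> exists C : {set T},
      [/\ flat r F C, #|C| = l1, #|atoms e r l1 d| = m,
          F \subset inside e r l1 d C
        & #|ksets (atom_adj e r l1 d) s (atoms e r l1 d)| = turan_number s m]).
Proof.
move=> sL rE d0 Ls L_ap not_all.
have sL1 : sorted ltn (rcons [:: l1 + d & L] r) := path_sorted sL.
have s0 : 0 < s by rewrite -Ls.
have [C0 H0] := flat_or_small sL; have [C1 H1] := card_unspanned sL1.
(* C0 serves the case without a core, 2 * d * C1 the hypothesis of [few_atoms_strict]. *)
have [n0 Hn0] := turan_number_growth l1 (C0 + 2 * d * C1) s0 d0.
exists n0 => T e n0T F m I; have grow := Hn0 _ n0T; rewrite -/m in grow.
have T0 : 0 < #|T| by apply: leq_trans n0T.
have u : uniform r F := ksets_uniform e r setT.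
have [_ [[C fC /= Cl]|small]] := H0 T F u I; last first.
  suff lt : #|F| < turan_number s m by split=> [|E];
    [exact: ltnW | rewrite E ltnn in lt].
  apply: leq_ltn_trans grow; rewrite -(leq_pmul2r T0) -mulnA -expnSr prednK //.
  by rewrite Ls in small; rewrite (leq_trans small) // leq_mul2r leq_addr orbT.
pose P := atoms e r l1 d; pose W := outside e r l1 d C; pose p := #|P|.
have cW : #|W| + (l1 + p * d) = #|T| := card_outside sL I fC Cl.
have pm : p <= m.
  rewrite leq_divRL // -cW; move: (p * d) => x; lia.
have K0 := atoms_free sL rE d0 L_ap not_all I fC Cl.
have [zle zeq] := zykov (@atom_adj_sym _ e r l1 d) (@atom_adj_irr _ e r l1 d) K0.
have le_in := leq_trans (card_inside sL rE d0 I fC Cl) zle.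
move: pm; rewrite leq_eqVlt => /predU1P[pE|pm].
  have Wd : #|W| < d.
    have := ltn_ceil (#|T| - l1) d0; rewrite -/m -pE -cW mulSn; move: (p * d) => x; lia.
  have FI : F \subset inside e r l1 d C.
    apply/subsetP => A AF; rewrite inE AF /= -setI_eq0 -cards_eq0;
      apply: contraTT Wd => A0.
    have := card_outside_cap sL rE I fC Cl AF.
    have := subset_leq_card (subsetIr A W); rewrite -/W; move: A0; rewrite -/W.
    move: #|A :&: W| => a; set b := #|atoms_in _ _ _ _ _|; move=> a0 aW E;
      rewrite -leqNgt (leq_trans _ aW) //.
    have : b < s by rewrite -(ltn_pmul2r d0) -E -{1}[b * d]add0n ltn_add2r lt0n.
    move=> bs; rewrite -(leq_add2r (b * d)) E -mulSn leq_mul2r bs orbT //.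
  have FE : #|F| <= #|inside e r l1 d C| by apply: subset_leq_card.
  rewrite -/p pE in zle zeq le_in *.
  split=> [|E]; first exact: leq_trans FE le_in.
  exists C; split=> //; apply/eqP; rewrite eqn_leq zle -E (leq_trans FE) //.
  exact: card_inside sL rE d0 I fC Cl.
pose F1 := [set A in F | [exists x in bad_vertices e r l1 d L C, [set x] \subset A]].
have lt : #|F1| + #|inside e r l1 d C| < turan_number s m.
  have H := H1 T T F (fun x => [set x]) (mem (bad_vertices e r l1 d L C)) u.
  apply: (@few_atoms_strict s p m #|T| #|W| d C1 (#|T| ^ s.-1)) => //.
  - exact: leq_trans (leq_div _ _) (leq_subr _ _).
  - by apply: turan_number_ratio => //; apply: ltnW.
  - have := ltn_ceil (#|T| - l1) d0; rewrite -/m -cW => wm.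
    (* The rounding in m leaves less than d vertices besides the missing atoms; m - p + 1 <= 2 * (m
       - p) as p < m. *)
    have : #|W| <= (m - p).+1 * d.
      rewrite -subSn ?mulnBl; last exact: ltnW.
      by rewrite leq_subRL; [move: wm; move: (p * d) (m.+1 * d) => x y;
        lia | rewrite leq_mul2r ltnW ?orbT // ltnS ltnW].
    move=> H'; apply: leq_trans H' _; rewrite leq_mul2r; apply/orP; right.
    by rewrite mul2n -addnn -[_.+1]addn1 leq_add2l subn_gt0.
  - apply: leq_ltn_trans grow; by rewrite leq_mul2r leq_addl orbT.
  apply: leq_trans (H _) _ => [x|]; first by rewrite inE => /andP[].
  rewrite -Ls /= leq_mul2r; apply/orP; right.
  by apply: subset_leq_card; apply/subsetP => x; rewrite inE => /andP[].
have {}lt : #|F| < turan_number s m.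
  apply: leq_ltn_trans lt; apply: leq_trans (leq_card_setU _ _); apply: subset_leq_card.
  apply/subsetP => A AF; rewrite in_setU.
  have /orP[->|H] := inside_or_bad sL I fC Cl AF; first by rewrite orbT.
  by rewrite in_set AF H.
by split=> [|E]; [exact: ltnW | rewrite E ltnn in lt].
Qed.

Lemma balanced_reindex s (f g : 'I_s -> nat) : balanced f -> balanced g ->
  \sum_i f i = \sum_i g i ->
  exists2 p : 'I_s -> 'I_s, bijective p & forall i, g (p i) = f i.
Proof.
move=> bf bg E; pose m := \sum_i f i.
have le (h : 'I_s -> nat) i : h i <= \sum_j h j by rewrite (bigD1 i) //= leq_addr.
have cnt (h : 'I_s -> nat) (a : pred nat) : #|[set i | a (h i)]| = count a [seq h i |
  i <- enum 'I_s].
  by rewrite count_map -sum1_count big_enum_cond -sum1_card; apply: eq_bigl => i;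
    rewrite inE.
(* No value exceeds the sum m, so the values fit into the finite type of colours that [fibre_bij]
   needs. *)
have [k|p bp pE] := @fibre_bij _ _ _ (fun i => inord (f i) : 'I_m.+1) (fun i => inord
  (g i)).
  rewrite (cnt f (fun x => inord x == k)) (cnt g (fun x => inord x == k)).
  by apply/permP; apply: balanced_perm.
exists p => // i; have /(congr1 val) := pE i.
by rewrite /= !inordK // ltnS ?le // /m E le.
Qed.

(** Equality in [leq_prod_turan] makes the colour classes balanced, so up to a permutation of the
    colours they have the sizes of the residue classes modulo s. *)
Lemma multipartite_numbering (U : finType) (e : rel U) (P : {set U}) (c : U -> nat) s
  m :
  symmetric e -> irreflexive e -> 0 < s -> #|P| = m -> 0 < turan_number s m ->
  {in P, forall x, c x < s} -> {in P &, forall x y, e x y = (c x != c y)} ->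
  #|ksets e s P| = turan_number s m ->
  exists2 f : {x | x \in P} -> 'I_m, bijective f &
    forall x y, (f x %% s != f y %% s) = e (val x) (val y).
Proof.
move=> e_sym e_irr s0 Pm t0 cs cE Kt.
pose h (i : 'I_s) := #|[set x in P | c x == i]|.
have hs : \sum_i h i = m.
  rewrite -Pm -sum1_card (partition_big (fun x => insubd (Ordinal s0) (c x)) xpredT)
    //=.
  apply: eq_bigr => i _; rewrite /h -sum1_card.
  apply: eq_bigl => x; rewrite inE; case: (boolP (x \in P)) => //= xP.
  by rewrite -(inj_eq val_inj) val_insubd cs.
have hb : balanced h.
  have hp : \prod_i h i = turan_number s m by rewrite -Kt (card_ksets_multipartite
    e_sym e_irr cs cE).
  by have [_] := leq_prod_turan h s0; rewrite hs hp; apply.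
have [gb gs] := residue_balanced m s0.
have [p bp pE] := balanced_reindex hb gb (etrans hs (esym gs)).
pose col (x : {x | x \in P}) : 'I_s := Ordinal (cs _ (valP x)).
have [p' pK p'K] := bp.
have [k|f bf fE] := @fibre_bij _ _ _ (fun x => p (col x)) (fun j : 'I_m => Ordinal
  (ltn_pmod j s0)).
  rewrite -{1}[k]p'K; transitivity (h (p' k)).
    rewrite -(card_imset _ val_inj); apply: eq_card => x; rewrite inE;
      apply/imsetP/andP.
      by move=> [y + ->]; rewrite inE (inj_eq (bij_inj bp)) => /eqP <-; split;
        [exact: valP|].
    move=> [xP /eqP cx]; exists (Sub x xP); rewrite ?SubK // inE (inj_eq (bij_inj bp)).
    by apply/eqP/val_inj; rewrite /= cx.
  by rewrite -pE p'K; apply: eq_card => j; rewrite !inE.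
exists f => // x y; rewrite (cE _ _ (valP x) (valP y)); congr (~~ _).
have E z : f z %% s = p (col z) by rewrite -fE.
by rewrite !E (inj_eq val_inj) (inj_eq (bij_inj bp)).
Qed.

(** * Recovering the extremal graph from equality *)

Section Structure.
Variables (T : finType) (G : sgraph T) (r l1 d s m : nat) (L : seq nat) (C : {set T}).
Hypotheses (sL : sorted ltn (rcons [:: l1, l1 + d & L] r)).
Hypotheses (rE : r = l1 + s * d) (d0 : 0 < d) (s0 : 0 < s).
Hypotheses (L_ap : forall l, l \in [:: l1, l1 + d & L] -> exists2 i, i < s & l = l1 +
  i * d).
Hypotheses (not_all : 1 < d \/ 0 < l1).
Notation e := (adj G).
Notation F := (ksets e r [set: T]).
Notation P := (atoms e r l1 d).
Hypotheses (F_int : set_intersecting [:: l1, l1 + d & L] F).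
Hypotheses (fC : flat r F C) (Cl : #|C| = l1).
Hypotheses (Pm : #|P| = m) (F_in : F \subset inside e r l1 d C) (t0 : 0 < turan_number
  s m).
Hypotheses (Kt : #|ksets (atom_adj e r l1 d) s P| = turan_number s m).

(** Equality in [zykov] makes the graph of atoms complete s-partite. A vertex outside C is sent to
    the number of its atom, which is unique because atoms meet only in C. *)
Lemma clique_part_model :
  exists k : {x : T | x \in cover (cliques r G)} -> option 'I_m,
    blowup_model s d l1 k (clique_part r G).
Proof.
pose q := atom_adj e r l1 d.
have q_sym : symmetric q := @atom_adj_sym _ _ _ _ _.
have q_irr : irreflexive q := @atom_adj_irr _ _ _ _ _.
have [_] := zykov q_sym q_irr (atoms_free sL rE d0 L_ap not_all F_int fC Cl).
rewrite Pm => /(_ Kt t0)[c cs cE].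
have [f bf fE] := multipartite_numbering q_sym q_irr s0 Pm t0 cs cE Kt.
have u : uniform r F := ksets_uniform e r setT.
have FE : cliques r G = F := cliquesE G r.
have hullE A : A \in F -> A = hull C (atoms_in e r l1 d A).
  by move=> AF; have [] := atoms_in_inside sL rE d0 F_int fC Cl (subsetP F_in _ AF).
have atom_uniqE X Y x : X \in P -> Y \in P -> x \in X -> x \in Y -> x \notin C -> X = Y.
  by move=> /atomsP XP /atomsP YP; apply: (atom_uniq sL u F_int fC Cl XP YP).
have CP X : X \in P -> C \subset X by apply: (core_atom sL F_int fC Cl).
have atomF X : X \in P -> exists2 A, A \in F & X \subset A.
  by move=> /atomsP/andP[/flat_sub].
have has x : x \in cover F -> x \notin C -> exists2 X, X \in P & x \in X.
  move=> /bigcupP[A AF]; rewrite {1}(hullE A AF) => /setUP[->//|/bigcupP[X + xX] _].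
  by rewrite inE => /andP[XP _]; exists X.
pose k x : option 'I_m := if x \in C then None else omap f [pick X : {X | X \in P} | x
  \in val X].
have kE (X : {X | X \in P}) x : x \in val X -> x \notin C -> k x = Some (f X).
  move=> xX xC; rewrite /k (negPf xC); case: pickP => [Y xY|/(_ X)]; last by rewrite xX.
  by congr (Some (f _)); apply: val_inj; apply: (atom_uniqE _ _ x) => //; apply: valP.
have kNone x : x \in cover F -> (k x == None) = (x \in C).
  move=> xF; case: (boolP (x \in C)) => xC; first by rewrite /k xC.
  by have [X XP xX] := has x xF xC; rewrite (kE (Sub X XP)) ?SubK.
have kSome x (X : {X | X \in P}) : x \in cover F -> (k x == Some (f X)) = (x \in val X
  :\: C).
  move=> xF; rewrite inE; case: (boolP (x \in C)) => xC; first by rewrite /k xC.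
  have [Y YP xY] := has x xF xC; rewrite (kE (Sub Y YP)) ?SubK //.
  apply/eqP/idP => [[/(bij_inj bf) <-]|xX]; first by rewrite SubK.
  by congr (Some (f _)); apply: val_inj; rewrite SubK;
    apply: (atom_uniqE _ _ x) => //; apply: valP.
have card_val (A : {set T}) (B : {set {x : T | x \in cover (cliques r G)}}) :
    A \subset cover F -> (forall x, (x \in B) = (val x \in A)) -> #|B| = #|A|.
  move=> AF BA; rewrite -(card_imset _ val_inj); apply: eq_card => x; apply/imsetP/idP.
    by move=> [y + ->]; rewrite BA.
  move=> xA; have xF : x \in cover (cliques r G) by rewrite FE; apply: subsetP xA.
  by exists (Sub x xF); rewrite ?BA SubK.
have inF (x : {x : T | x \in cover (cliques r G)}) : val x \in cover F by rewrite -FE;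
  apply: valP.
have coverS A : A \in F -> A \subset cover F by move=> AF; apply: bigcup_sup.
exists (fun x => k (val x)); split.
- rewrite -[RHS]Cl; apply: card_val => [|x]; last by rewrite inE kNone.
  by have [A AF CA] := flat_sub fC; apply: subset_trans CA (coverS _ AF).
- have [f' fK f'K] := bf; move=> j; rewrite -(f'K j); set X := f' j.
  have -> : d = #|val X :\: C|.
    rewrite cardsD (setIidPr (CP _ (valP X))) Cl.
    by have /atomsP/andP[_ /eqP->] := valP X; rewrite addKn.
  apply: card_val => [|x]; last by rewrite inE kSome.
  have [A AF XA] := atomF _ (valP X).
  by apply: subset_trans (coverS _ AF); apply: subset_trans XA; apply: subsetDl.
move=> x y; rewrite adj_graph_of_rel; congr (_ && _).
have -> : [exists S in cliques r G, (val y \in S) && (val x \in S)] = [exists S in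
  cliques r G, (val x \in S) && (val y \in S)].
  by apply: eq_existsb => S; rewrite [X in _ && X]andbC.
rewrite orbb; have [xF yF] := (inF x, inF y);
  move: (val x) (val y) xF yF => {}x {}y xF yF; rewrite FE.
have [xC|xC] := boolP (x \in C).
  rewrite {1}/k xC; apply/exists_inP; have /bigcupP[A AF yA] := yF.
  by exists A; rewrite // yA (subsetP (core_subF sL u F_int fC Cl AF)).
have [X XP xX] := has x xF xC; rewrite (kE (Sub X XP)) ?SubK //.
have [yC|yC] := boolP (y \in C).
  rewrite {1}/k yC; apply/exists_inP; have [A AF XA] := atomF _ XP.
  by exists A; rewrite // (subsetP XA) // (subsetP (core_subF sL u F_int fC Cl AF)).
have [Y YP yY] := has y yF yC; rewrite (kE (Sub Y YP)) ?SubK //.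
rewrite (inj_eq (bij_inj bf)) -(inj_eq val_inj) fE !SubK.
apply/exists_inP/orP => [[A AF /andP[xA yA]]|[/eqP XY|qXY]].
- have sub Z z : Z \in P -> z \in Z -> z \in A -> z \notin C -> Z \subset A.
    by move=> /atomsP ZP zZ zA zC; apply: (atom_min sL u F_int fC Cl ZP (mem_flat r
      AF) zZ zA zC).
  have [|XY] := eqVneq X Y; [by left|right].
  rewrite /q /atom_adj XY !atomsP //= (cliqueS _ (_ : clique e A)) //.
    by rewrite subUset (sub X x) ?(sub Y y).
  by case/ksetsP: AF.
- have [A AF XA] := atomF _ XP; exists A => //.
  by rewrite !(subsetP XA) // XY.
(* Adjacent atoms X and Y must be shown to lie in a common r-clique: the hull of one atom from each
   colour class, with X and Y among them. The s-clique Q0 shows that no class is empty. *)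
have [Q0 Q0K] : exists Q, Q \in ksets q s P by apply/set0Pn; rewrite -card_gt0 Kt.
have [X' X'Q cX'] := clique_colour_onto cs cE Q0K (cs _ XP).
have [Y' Y'Q cY'] := clique_colour_onto cs cE Q0K (cs _ YP).
have pick_col i : i < s -> exists2 Z, Z \in P & c Z = i.
  move=> /(clique_colour_onto cs cE Q0K)[Z ZQ cZ]; exists Z => //.
  by have [QP _ _] := ksetsP _ _ _ _ Q0K; apply: subsetP ZQ.
have cXY : c X != c Y by rewrite -cE.
pose g (i : 'I_s) := if c X == i then X else if c Y == i then Y else odflt X [pick Z
  in P | c Z == i].
have gP (i : 'I_s) : g i \in P /\ c (g i) = i.
  rewrite /g; case: eqP => // _; case: eqP => // _.
  case: pickP => [Z /andP[ZP /eqP]|N] //=.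
  by have [Z ZP cZ] := pick_col _ (ltn_ord i); have := N Z; rewrite /= ZP cZ eqxx.
have g_inj : injective g by move=> i j gij; apply: val_inj;
  rewrite /= -(gP i).2 -(gP j).2 gij.
have QK : [set g i | i : 'I_s] \in ksets q s P.
  apply/ksetsP; rewrite card_imset // card_ord; split=> //.
    by apply/subsetP => _ /imsetP[i _ ->]; have [] := gP i.
  apply/cliqueP => _ _ /imsetP[i _ ->] /imsetP[j _ ->] ij.
  rewrite cE ?(gP _).1 // !(gP _).2; apply: contra ij => /eqP E.
  by apply/eqP; congr g; apply: val_inj.
exists (hull C [set g i | i : 'I_s]); first exact: (hull_mem sL rE F_int fC Cl QK).
have XQ : X \in [set g i | i : 'I_s].
  by apply/imsetP; exists (Ordinal (cs _ XP)); rewrite // /g eqxx.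
have YQ : Y \in [set g i | i : 'I_s].
  by apply/imsetP; exists (Ordinal (cs _ YP)); rewrite // /g /= (negPf cXY) eqxx.
by apply/andP; split; apply/setUP; right; apply/bigcupP; [exists X | exists Y].
Qed.

End Structure.

Lemma arith_prog_nth d x K i : arith_prog d (x :: K) -> i <= size K ->
  nth 0 (x :: K) i = x + i * d.
Proof.
elim: K x i => [|y K IH] x [|i] //= xK iK; rewrite ?addn0 //.
have /andP[/eqP yE yK] := arith_progP xK.
by have := IH y i yK iK; rewrite /= => ->; rewrite yE mulSn addnA.
Qed.

Lemma arith_prog_sizes d r L (s := size L) (l1 := nth 0 L 0) :
  sorted ltn (rcons L r) -> 1 < s -> arith_prog d (rcons L r) ->
  [/\ r = l1 + s * d, 0 < d, forall i, i < s -> l1 + i * d \in L,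
      forall l, l \in L -> exists2 i, i < s & l = l1 + i * d
    & exists L', L = [:: l1, l1 + d & L']].
Proof.
rewrite {}/s {}/l1; case: L => [//|x [//|y L]] /= xr _ ap.
have yE : y = x + d by have /andP[/eqP] := arith_progP ap.
pose K := y :: L; have apK : arith_prog d (x :: rcons K r) := ap.
have nthE i : i <= size K -> nth 0 (x :: K) i = x + i * d.
  move=> iK; rewrite -(arith_prog_nth apK); last by rewrite size_rcons ltnW.
  by rewrite -rcons_cons nth_rcons ltnS iK.
split.
- have := arith_prog_nth apK (leqnn _); rewrite -rcons_cons nth_rcons size_rcons /=.
  by rewrite ltnn eqxx.
- by move: xr => /andP[]; rewrite yE -{1}[x]addn0 ltn_add2l.
- by move=> i iK; rewrite -nthE // mem_nth.
- move=> l lL; exists (index l (x :: K)); first by rewrite index_mem.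
  by rewrite -nthE ?nth_index // -ltnS index_mem.
- by exists L; rewrite yE.
Qed.

(** Conversely, any G whose clique part is the extremal graph is extremal, since the intersection
    sizes and the count depend only on the family of r-cliques. *)
Lemma Psi_arith_prog d r L (s := size L) (l1 := nth 0 L 0) :
  sorted ltn (rcons L r) -> 1 < s -> s != r -> arith_prog d (rcons L r) ->
  exists n0 : nat, forall n, n0 < n ->
    [/\ Psi r n L = turan_number s ((n - l1) %/ d),
        clique_intersecting r L (extremal_graph n l1 s d),
        nb_cliques r (extremal_graph n l1 s d) = Psi r n L
      & forall G : sgraph 'I_n, extremal r L G <->
          graph_iso (clique_part r G) (extremal_graph n l1 s d)].
Proof.
move=> sL s1 sr ap; have [rE d0 inL L_ap [L' LE]] := arith_prog_sizes sL s1 ap.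
rewrite -/s -/l1 in rE inL L_ap LE; have s0 : 0 < s := ltnW s1.
have not_all : 1 < d \/ 0 < l1.
  case: (posnP l1) => [l10|]; [left|by right]; rewrite ltn_neqAle d0 andbT eq_sym.
  by apply: contra sr => /eqP d1; rewrite rE l10 d1 muln1.
have sL' : sorted ltn (rcons [:: l1, l1 + d & L'] r) by rewrite -LE.
have sz' : size [:: l1, l1 + d & L'] = s by rewrite -LE.
have L_ap' l : l \in [:: l1, l1 + d & L'] -> exists2 i, i < s & l = l1 + i * d by
  rewrite -LE; apply: L_ap.
have [N1 H1] := arith_prog_bound sL' rE d0 sz' L_ap' not_all.
have [N2 H2] := turan_number_growth l1 0 s0 d0.
exists (maxn l1 (maxn N1 N2)) => n; rewrite !gtn_max => /and3P[nl1 nN1 nN2].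
set m := (n - l1) %/ d; have t0 : 0 < turan_number s m := H2 n nN2.
have Gm := extremal_graph_model n l1 s d.
have ext_int : clique_intersecting r L (extremal_graph n l1 s d).
  by rewrite {1}rE; apply: (clique_intersecting_blowup Gm).
have ext_nb : nb_cliques r (extremal_graph n l1 s d) = turan_number s m.
  by rewrite rE; apply: (nb_cliques_blowup Gm).
have up (G : sgraph 'I_n) : clique_intersecting r L G ->
    nb_cliques r G <= turan_number s m /\
    (nb_cliques r G = turan_number s m -> graph_iso (clique_part r G) (extremal_graph
      n l1 s d)).
  move=> I; have KE := cliquesE G r.
  have {}I : set_intersecting [:: l1, l1 + d & L'] (ksets (adj G) r setT) by rewrite
    -KE -LE.
  have nbE : nb_cliques r G = #|ksets (adj G) r [set: 'I_n]| by rewrite /nb_cliques KE.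
  have := H1 _ (adj G); rewrite card_ord => /(_ nN1 I)[le eq].
  rewrite nbE.
  split=> // /eq[C [fC Cl Pm F_in Kt]].
  have [k km] := clique_part_model sL' rE d0 s0 L_ap' not_all I fC Cl Pm F_in t0 Kt.
  exact: blowup_model_iso km Gm.
have PsiE : Psi r n L = turan_number s m.
  apply/eqP; rewrite eqn_leq; apply/andP; split; first by apply: Psi_leP => G /up[].
  have r1 : 1 < r by rewrite rE (leq_trans s1) // (leq_trans (leq_pmulr _ d0)) //
    leq_addl.
  have le_card : #|{: 'I_l1 + 'I_m * 'I_d}| <= #|'I_n|.
    rewrite card_sum card_prod !card_ord -leq_subRL; last exact: ltnW.
    exact: leq_trunc_div.
  have [G [f [f_inj fE]]] := embed_cliques (extremal_graph n l1 s d) r1 le_card.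
  rewrite -ext_nb -(nb_cliques_transfer f_inj fE); apply: leq_bigmax_cond.
  by rewrite (clique_intersecting_transfer f_inj fE).
split=> //; first by rewrite PsiE.
move=> G; split=> [[I]|[f bf fE]]; first by rewrite PsiE; have [_] := up G I.
have cE := cliques_iso r bf fE; have f_inj := bij_inj bf.
have vE := cliques_clique_part G r;
  have v_inj : injective (val : {x : 'I_n | x \in cover (cliques r G)} -> 'I_n) by
  apply: val_inj.
rewrite /extremal (clique_intersecting_transfer v_inj vE) (nb_cliques_transfer v_inj
  vE).
by rewrite -(clique_intersecting_transfer f_inj cE) -(nb_cliques_transfer f_inj cE)
  ext_nb PsiE.
Qed.

(** The bound [key] is (1 + 1/q)^k <= 1 + (2^k - 1)/q, by induction on k. *)
Lemma expn_diff_little s j q : 0 < q -> j * 2 ^ s <= q -> j * (q.+1 ^ s - q ^ s) <= q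
  ^ s.
Proof.
move=> q0 jq; have key k : q.+1 ^ k * q <= q ^ k * (q + (2 ^ k).-1).
  elim: k => [|k IH]; first by rewrite !expn0 !mul1n addn0.
  set c := (2 ^ k).-1 in IH *; have -> : (2 ^ k.+1).-1 = c + c.+1.
    by rewrite -addSnnS /c prednK ?expn_gt0 // expnS mul2n -addnn -{2}[2 ^ k]prednK
      ?expn_gt0 //; lia.
  rewrite !expnS -mulnA (leq_trans (leq_mul (leqnn _) IH)) // mulnCA [leqRHS]mulnAC
    mulnC.
  by rewrite leq_mul2r; apply/orP; right; nia.
rewrite -(leq_pmul2r q0); have H : (q.+1 ^ s - q ^ s) * q <= q ^ s * 2 ^ s.
  rewrite mulnBl leq_subLR -mulnDr (leq_trans (key s)) // leq_mul2l leq_add2l leq_pred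
    orbT //.
rewrite -mulnA (leq_trans (leq_mul (leqnn j) H)) // mulnCA leq_mul2l jq orbT //.
Qed.

(** * Asymptotics *)

From mathcomp Require Import all_classical all_reals all_analysis.
Import Order.TTheory GRing.Theory Num.Theory.
Import numFieldNormedType.Exports.
Local Open Scope classical_set_scope.
Local Open Scope ring_scope.

Lemma littleo_nat (R : realType) (f : nat -> nat) (s : nat) :
  (forall j, (0 < j)%N -> exists N, forall n, (N <= n)%N -> (j * f n <= n ^ s)%N) ->
  (fun n : nat => (f n)%:R : R) =o_\oo (fun n : nat => n%:R ^+ s : R).
Proof.
move=> H; apply/eqoP => eps eps0; pose j := (Num.bound eps^-1).+1.
have [N HN] := H j isT; near=> n.
have nN : (N <= n)%N by near: n; exists N.
rewrite [`|n%:R ^+ s|]ger0_norm ?exprn_ge0 // ger0_norm //.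
have := HN n nN; rewrite -(ler_nat R) natrM natrX => le_jf.
rewrite mulrC -ler_pdivrMr //; apply: le_trans le_jf; rewrite mulrC ler_wpM2r //.
apply: ltW; apply: lt_le_trans (archi_boundP _) _; first by rewrite invr_ge0 ltW.
by rewrite ler_nat /j leqnSn.
Unshelve. all: end_near. Qed.

Lemma bigO_nat (R : realType) (f : nat -> nat) (s C : nat) :
  (forall n, (0 < n)%N -> (f n <= C * n ^ s)%N) ->
  (fun n : nat => (f n)%:R : R) =O_\oo (fun n : nat => n%:R ^+ s : R).
Proof.
move=> H; apply/eqO_exP; exists C.+1%:R; first by rewrite /= ltr0n.
near=> n; have n0 : (0 < n)%N by near: n; exists 1%N.
rewrite !ger0_norm ?exprn_ge0 // -natrX -natrM ler_nat (leq_trans (H _ n0)) //.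
by rewrite leq_mul2r leqnSn orbT.
Unshelve. all: end_near. Qed.

(** Both quantities lie between q ^ s and (q + 1) ^ s for q = (n - l1) %/ (d * s), and
    [expn_diff_little] makes this interval relatively short. *)
Lemma turan_number_equiv (R : realType) (s d l1 : nat) (f : nat -> nat) :
  (0 < s)%N -> (0 < d)%N ->
  (exists n0, forall n, (n0 < n)%N -> f n = turan_number s ((n - l1) %/ d)) ->
  (fun n : nat => (f n)%:R : R) ~_\oo
    (fun n : nat => ((n%:R - l1%:R) / (s * d)%:R) ^+ s : R).
Proof.
move=> s0 d0 [n0 fE]; apply/eqaddoP => eps eps0.
pose j := (Num.bound eps^-1).+1; pose q0 := (j * 2 ^ s)%N.
have ds0 : (0 < d * s)%N by rewrite muln_gt0 d0.
near=> n; have nn0 : (n0 < n)%N by near: n; exists n0.+1.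
have nq0 : (l1 + q0.+1 * (d * s) <= n)%N by near: n; exists (l1 + q0.+1 * (d * s))%N.
have nl1 : (l1 <= n)%N by apply: leq_trans nq0; apply: leq_addr.
rewrite !fctE fE //; set m := ((n - l1) %/ d)%N; pose q := (m %/ s)%N;
  pose x : R := (n%:R - l1%:R) / (s * d)%:R.
have qE : q = ((n - l1) %/ (d * s))%N by rewrite divnMA.
have q0q : (q0 < q)%N by rewrite qE leq_divRL // leq_subRL.
have jq : (j * (q.+1 ^ s - q ^ s) <= q ^ s)%N.
  by apply: expn_diff_little; [apply: leq_trans q0q | apply: ltnW].
have sd0 : 0 < (s * d)%:R :> R by rewrite ltr0n mulnC.
have qx : q%:R <= x.
  by rewrite ler_pdivlMr // -natrB // -natrM ler_nat mulnC [(s * d)%N]mulnC qE mulnC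
    leq_trunc_div.
have xq : x <= q.+1%:R.
  by rewrite ler_pdivrMr // -natrB // -natrM ler_nat [(s * d)%N]mulnC qE ltnW //
    ltn_ceil.
have x0 : 0 <= x by apply: le_trans qx; rewrite ler0n.
have [lo hi] : (q ^ s)%:R <= x ^+ s /\ x ^+ s <= (q.+1 ^ s)%:R :> R.
  by rewrite !natrX; split; apply: lerXn2r; rewrite ?nnegrE ?ler0n.
have [tlo thi] : (q ^ s)%:R <= (turan_number s m)%:R :> R /\ (turan_number s m)%:R <=
  (q.+1 ^ s)%:R :> R.
  by rewrite !ler_nat turan_number_ge turan_number_le.
rewrite [`|_ ^+ s|]ger0_norm ?exprn_ge0 // -/x.
have j0 : 0 < j%:R :> R by rewrite ltr0n.
have jeps : 1 <= eps * j%:R.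
  rewrite -ler_pdivrMl // mulr1; apply/ltW/(lt_le_trans (archi_boundP _));
    first by rewrite invr_ge0 ltW.
  by rewrite ler_nat leqnSn.
have D : (q.+1 ^ s)%:R - (q ^ s)%:R <= eps * x ^+ s.
  have : j%:R * ((q.+1 ^ s)%:R - (q ^ s)%:R) <= x ^+ s :> R.
    apply: le_trans lo; rewrite -natrB; last by case: (s) s0 => // k _;
      rewrite leq_exp2r.
    by rewrite -natrM ler_nat.
  move=> H; rewrite -(ler_pM2l j0); apply: le_trans H _.
  by rewrite mulrA [j%:R * eps]mulrC ler_peMl ?exprn_ge0.
rewrite ler_norml; apply/andP; split; lra.
Unshelve. all: end_near. Qed.

Lemma sorted_rcons_lt (r : nat) (L : seq nat) :
  sorted ltn L -> all (fun l => (l < r)%N) L -> sorted ltn (rcons L r).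
Proof.
case: L => // x K /= xK Lr; rewrite rcons_path xK.
exact: (allP (Lr : all _ (x :: K)) _ (mem_last x K)).
Qed.

Theorem theorem1p3 (R : realType) (r : nat) (L : seq nat)
    (s := size L) (l1 := nth 0%N L 0) (ls := nth 0%N L (s - 1)) :
  (3 <= r)%N ->
  sorted ltn L -> all (fun l => (l < r)%N) L ->
  (0 < s)%N -> s \notin [:: 1%N; r] ->
  (~ (exists d : nat, arith_prog d (rcons L r)) ->
     (fun n : nat => (Psi r n L)%:R : R) =o_\oo (fun n : nat => n%:R ^+ s : R) /\
     ((r - ls = ls - nth 0 L (s - 2))%N ->
        (fun n : nat => (Psi r n L)%:R : R) =O_\oo
          (fun n : nat => n%:R ^+ (s - 1)%N : R))) /\
  (forall d : nat, arith_prog d (rcons L r) ->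
     (exists n0 : nat, forall n : nat, (n0 < n)%N ->
        [/\ Psi r n L = nb_cliques s (turan_graph ((n - l1) %/ d) s),
            clique_intersecting r L (extremal_graph n l1 s d),
            nb_cliques r (extremal_graph n l1 s d) = Psi r n L
          & forall G : sgraph 'I_n,
              extremal r L G <->
              graph_iso (clique_part r G) (extremal_graph n l1 s d)]) /\
     (fun n : nat => (Psi r n L)%:R : R) ~_\oo
       (fun n : nat => ((n%:R - l1%:R) / (r%:R - l1%:R)) ^+ s : R)).
Proof.
move=> r3 sL Lr s0; rewrite !inE negb_or => /andP[s1 sr].
have sLr := sorted_rcons_lt sL Lr.
have {s0}s1 : (1 < s)%N by rewrite ltn_neqAle eq_sym s1.
split=> [nAP|d ap].
  split; first exact/littleo_nat/Psi_little.
  move=> E; have [C HC] := Psi_big_O sLr s1 nAP E.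
  exact: bigO_nat HC.
have [rE d0 _ _ _] := arith_prog_sizes sLr s1 ap.
have [n0 H] := Psi_arith_prog sLr s1 sr ap.
split.
  exists n0 => n n0n; have [PE I nbE ext] := H n n0n; split=> //.
  by rewrite PE nb_cliques_turan // ltnW.
have -> : r%:R - l1%:R = (s * d)%:R :> R by rewrite {1}rE natrD addrAC subrr add0r.
apply: turan_number_equiv => //; first exact: ltnW.
by exists n0 => n /H[].
Qed.
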